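(* Let $n\in\mathbb{N}$, $\alpha\in(0,1]$, and let $\lambda\in C^{n,\alpha}[0,T]$ generate the Loewner curve $\gamma$ (parametrized by halfplane capacity). Then there are real numbers $a_2,a_3,\dots,a_{2n+1}$, where each $a_m$ depends only on $\lambda^{(k)}(0)$ for $k=1,\dots,\lfloor m/2\rfloor$, such that as $t\to0^+$: if $\alpha\le 1/2$, $$\gamma(t)=2i\sqrt t+a_2t+i\,a_3t^{3/2}+a_4t^2+\cdots+a_{2n}t^n+O(t^{n+\alpha});$$ if $\alpha>1/2$, $$\gamma(t)=2i\sqrt t+a_2t+i\,a_3t^{3/2}+a_4t^2+\cdots+a_{2n}t^n+i\,a_{2n+1}t^{n+1/2}+O(t^{n+\alpha}).$$ (Here the terms alternate: $a_m t^{m/2}$ for even $m$ and $i\,a_m t^{m/2}$ for odd $m$.)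
   Context: Chordal Loewner equation: for a continuous real function $\lambda$ on $[0,T]$ and $z\in\mathbb{H}$, $g_t(z)$ solves $\partial_t g_t(z)=\frac{2}{g_t(z)-\lambda(t)}$, $g_0(z)=z$; $K_t$ is the set of $z$ whose solution hits $\lambda$ by time $t$; $g_t:\mathbb{H}\setminus K_t\to\mathbb{H}$ is conformal with $g_t(z)=z+\frac{2t}{z}+O(z^{-2})$ at $\infty$. $\lambda$ generates $\gamma:[0,T]\to\overline{\mathbb{H}}$ if $\mathbb{H}\setminus K_t$ is the unbounded component of $\mathbb{H}\setminus\gamma(0,t]$ for each $t$; then $\gamma$ is parametrized by halfplane capacity. $\phi\in C^{n,\alpha}(I)$ means $\phi',\dots,\phi^{(n)}$ exist, are continuous and bounded on $I$, and $\phi^{(n)}$ is $\alpha$-Hölder on $I$ (Lipschitz if $\alpha=1$).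
   Formalization: The normalization λ(0)=0 is assumed; it is needed because the stated expansion has no constant term (for λ≡1 the curve is 1+2i√t, and whenever λ(0)≠0 the claimed expansion fails). *)

(* Defs.v *)
From Stdlib Require Import Reals Lra.
Open Scope R_scope.

Definition Cplx := (R * R)%type.
Definition Re (z : Cplx) : R := fst z.
Definition Im (z : Cplx) : R := snd z.
Definition Cadd (z w : Cplx) : Cplx := (Re z + Re w, Im z + Im w).
Definition Csub (z w : Cplx) : Cplx := (Re z - Re w, Im z - Im w).
Definition Cnorm (z : Cplx) : R := sqrt (Re z * Re z + Im z * Im z).
Definition RtoC (x : R) : Cplx := (x, 0).
(** 2 / w for a complex number w (w <> 0): 2 * conj(w) / |w|^2 *)
Definition two_div (w : Cplx) : Cplx :=
  (2 * Re w / (Re w * Re w + Im w * Im w),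
   - (2 * Im w) / (Re w * Re w + Im w * Im w)).

Definition rderiv_within (a b : R) (f : R -> R) (d : R) (s : R) : Prop :=
  forall eps, 0 < eps -> exists delta, 0 < delta /\
    forall u, a <= u <= b -> u <> s -> Rabs (u - s) < delta ->
      Rabs ((f u - f s) / (u - s) - d) < eps.

Definition cderiv_within (a b : R) (h : R -> Cplx) (d : Cplx) (s : R) : Prop :=
  forall eps, 0 < eps -> exists delta, 0 < delta /\
    forall u, a <= u <= b -> u <> s -> Rabs (u - s) < delta ->
      Cnorm (Csub ((Re (h u) - Re (h s)) / (u - s), (Im (h u) - Im (h s)) / (u - s)) d) < eps.

Definition ccont_on (a b : R) (p : R -> Cplx) : Prop :=
  forall s, a <= s <= b -> forall eps, 0 < eps -> exists delta, 0 < delta /\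
    forall u, a <= u <= b -> Rabs (u - s) < delta -> Cnorm (Csub (p u) (p s)) < eps.

Definition rcont_on (a b : R) (f : R -> R) : Prop :=
  forall s, a <= s <= b -> forall eps, 0 < eps -> exists delta, 0 < delta /\
    forall u, a <= u <= b -> Rabs (u - s) < delta -> Rabs (f u - f s) < eps.

Definition is_deriv_family (T : R) (n : nat) (lam : R -> R) (D : nat -> R -> R) : Prop :=
  (forall s, 0 <= s <= T -> D 0%nat s = lam s) /\
  (forall k, (k < n)%nat -> forall s, 0 <= s <= T -> rderiv_within 0 T (D k) (D (S k) s) s).

Definition Holder_class (T : R) (n : nat) (alpha : R) (lam : R -> R) : Prop :=
  exists D : nat -> R -> R,
    is_deriv_family T n lam D /\
    (forall k, (k <= n)%nat -> rcont_on 0 T (D k)) /\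
    (forall k, (k <= n)%nat -> exists M, forall s, 0 <= s <= T -> Rabs (D k s) <= M) /\
    (exists M, forall x y, 0 <= x <= T -> 0 <= y <= T ->
        Rabs (D n x - D n y) <= M * Rpower (Rabs (x - y)) alpha).

(** The Loewner flow started at z (in H) survives up to time t: there is a solution
    h of  d/ds h(s) = 2 / (h(s) - lambda(s)), h(0) = z on [0,t] never hitting lambda.
    (By uniqueness of solutions this is exactly "z is not in K_t".) *)
Definition survives (lam : R -> R) (t : R) (z : Cplx) : Prop :=
  exists h : R -> Cplx, h 0 = z /\
    forall s, 0 <= s <= t ->
      h s <> RtoC (lam s) /\
      cderiv_within 0 t h (two_div (Csub (h s) (RtoC (lam s)))) s.

Definition hull (lam : R -> R) (t : R) (z : Cplx) : Prop :=
  0 < Im z /\ ~ survives lam t z.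

Definition slit_domain (gam : R -> Cplx) (t : R) (w : Cplx) : Prop :=
  0 < Im w /\ forall s, 0 < s <= t -> w <> gam s.

(** w lies in the unbounded (path-)component of the open set H \ gamma(0,t]:
    w can be joined inside that set to points of arbitrarily large modulus. *)
Definition unbounded_component (gam : R -> Cplx) (t : R) (w : Cplx) : Prop :=
  slit_domain gam t w /\
  forall M, exists p : R -> Cplx,
    ccont_on 0 1 p /\ p 0 = w /\ M < Cnorm (p 1) /\
    forall u, 0 <= u <= 1 -> slit_domain gam t (p u).

Definition generates (T : R) (lam : R -> R) (gam : R -> Cplx) : Prop :=
  ccont_on 0 T gam /\
  (forall s, 0 <= s <= T -> 0 <= Im (gam s)) /\
  forall t, 0 <= t <= T -> forall z,
    (0 < Im z /\ ~ hull lam t z) <-> unbounded_component gam t z.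

Definition exp_term (a : nat -> R) (m : nat) (t : R) : Cplx :=
  if Nat.even m then (a m * Rpower t (INR m / 2), 0)
  else (0, a m * Rpower t (INR m / 2)).

Fixpoint expansion (a : nat -> R) (N : nat) (t : R) : Cplx :=
  match N with
  | O => (0, 0)
  | S N' => Cadd (expansion a N' t) (exp_term a N t)
  end.

(* Main.v *)
(** For a fixed time t, the tip gamma(t) is the end point h(t) of the backward flow
    h' = -2/(h - lambda(t-s)), h(0) = lambda(t).  While lambda has a small 1/2-Hölder constant, h - lambda
    stays in a narrow cone around the imaginary axis, where Re(1/(u1 u2)) < 0: the backward flow
    contracts, so it can be started on the boundary, and it depends on lambda in a Lipschitz way for
    the sup norm.  Hence lambda may be replaced by its Taylor polynomial at 0 up to O(t^(n+alpha)), and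
    h by any approximate solution.  With s = t x^2 and r = i sqrt t the equation becomes
    G_x (G - Lambda) = 4 r^2 x, where Lambda is a real polynomial in x and r; it has a formal solution
    G = 2 r x + sum r^m q_m(x) with real polynomials q_m, computed recursively from
    (x q_m)' = (known terms), and q_m(1) gives a_m up to sign.

    If n = 0 and alpha <= 1/2 the curve need not be simple and only |gamma(t)| = O(t^alpha) is claimed.
    This follows from a size bound for the hull whenever gamma(t) lies in the half plane; times with
    gamma(t) real are limits of such times, since otherwise the hull would stop growing. *)

From Stdlib Require Import Reals Lra Lia Psatz List Factorial Arith Classical ClassicalEpsilon.
From Coquelicot Require Import Coquelicot.
Require Import Defs.
Import ListNotations.
Open Scope R_scope.

(** * Comparison principles on an interval *)

(** The hypothesis [generates] only decides which points lie in the unbounded component; it does not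
    locate gamma(t). The tip is therefore built from the flow alone, as a limit of points that
    survive up to t which is itself swallowed exactly at time t, and topology forces the curve
    through it. The backward flow has a square-root singularity at its start, where a plain Gronwall
    estimate would diverge. In the variable x with s = t x^2 the approximate velocity is 2r +
    O(r^2): comparable to sqrt t and pointing upwards all the way. So there are two cones, one for h
    - lambda and one for this velocity, and the quotient of their elements has positive real part.
    The assumption n >= 1 or alpha > 1/2 makes the local 1/2-Hölder constant as small as the cones
    require. The series is taken up to order 2n+1 in either case: its defect t^(n+1) is below
    t^(n+alpha) since alpha <= 1, and for alpha <= 1/2 its last term is absorbed into the error.
    Conformal maps enter only as flow maps of the equation, and harmonicity only through a
    four-point difference estimate. *)

Lemma mul_self_nonneg (x : R) : 0 <= x * x.
Proof. apply Rle_0_sqr. Qed.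

Lemma Rabs_mul_self (x : R) : Rabs x * Rabs x = x * x.
Proof. rewrite <- Rabs_mult. apply Rabs_pos_eq, mul_self_nonneg. Qed.

Lemma continuity_pt_ext_all (f g : R -> R) (x : R) :
  (forall u, f u = g u) -> continuity_pt f x -> continuity_pt g x.
Proof.
  intros E H. apply (continuity_pt_ext f g x); auto.
Qed.

Ltac ctn :=
  lazymatch goal with
  | |- continuity_pt (fun s => @?A s + @?B s) _ => apply (continuity_pt_plus A B); ctn
  | |- continuity_pt (fun s => @?A s - @?B s) _ => apply (continuity_pt_minus A B); ctn
  | |- continuity_pt (fun s => @?A s * @?B s) _ => apply (continuity_pt_mult A B); ctn
  | |- continuity_pt (fun s => - @?A s) _ => apply (continuity_pt_opp A); ctn
  | |- continuity_pt (fun s => exp (@?A s)) _ =>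
      apply (continuity_pt_comp A exp); [ctn | apply derivable_continuous_pt, derivable_pt_exp]
  | |- continuity_pt (fun s => (@?A s) ^ 2) _ =>
      apply (continuity_pt_ext_all (fun s => A s * A s));
      [ intros; ring | apply (continuity_pt_mult A A); ctn ]
  | |- continuity_pt (fun s => s) _ => apply continuity_pt_id
  | |- continuity_pt (fun _ => ?c) _ => apply continuity_pt_const; intros ? ?; reflexivity
  | |- _ => try assumption; auto
  end.

Lemma is_derive_continuity_pt (f : R -> R) (x l : R) :
  is_derive f x l -> continuity_pt f x.
Proof.
  intro H. apply derivable_continuous_pt. exists l. now apply is_derive_Reals.
Qed.

Lemma is_derive_eq (f : R -> R) (x l l' : R) :
  is_derive f x l -> l = l' -> is_derive f x l'.
Proof. now intros H <-. Qed.

Lemma is_derive_sq (f : R -> R) (x l : R) :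
  is_derive f x l -> is_derive (fun s => f s * f s) x (2 * f x * l).
Proof.
  intros H. eapply is_derive_eq.
  - apply (is_derive_mult f f x l l H H). intros; apply Rmult_comm.
  - unfold plus, mult; simpl; ring.
Qed.

Lemma continuity_pt_eps (f : R -> R) (x : R) :
  continuity_pt f x <->
  forall eps, 0 < eps -> exists d, 0 < d /\ forall u, Rabs (u - x) < d -> Rabs (f u - f x) < eps.
Proof.
  split.
  - intros H eps He. destruct (H eps He) as [d [Hd H']].
    exists d; split; [exact Hd|]. intros u Hu.
    destruct (Req_dec u x) as [->|Hne].
    + rewrite Rminus_diag, Rabs_R0; exact He.
    + apply H'. split; [split; [exact I | congruence] | exact Hu].
  - intros H eps He. destruct (H eps He) as [d [Hd H']].
    exists d; split; [exact Hd|]. intros u [_ Hu]. now apply H'.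
Qed.

Lemma mvt_open (f df : R -> R) (a b : R) :
  a < b ->
  (forall s, a <= s <= b -> continuity_pt f s) ->
  (forall s, a < s < b -> is_derive f s (df s)) ->
  exists c, a < c < b /\ f b - f a = df c * (b - a).
Proof.
  intros ab Hc Hd.
  assert (pr1 : forall c, a < c < b -> derivable_pt f c).
  { intros c Hc'. exists (df c). apply is_derive_Reals, Hd, Hc'. }
  assert (pr2 : forall c, a < c < b -> derivable_pt id c).
  { intros; apply derivable_pt_id. }
  destruct (MVT f id a b pr1 pr2 ab Hc) as [c [P E]].
  { intros; apply derivable_continuous_pt, derivable_pt_id. }
  exists c; split; [exact P|].
  assert (E1 : derive_pt f c (pr1 c P) = df c).
  { apply derive_pt_eq_0, is_derive_Reals, Hd, P. }
  assert (E2 : derive_pt id c (pr2 c P) = 1).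
  { apply derive_pt_eq_0, derivable_pt_lim_id. }
  rewrite E1, E2 in E. unfold id in E. lra.
Qed.

(* Where [F] is positive it grows at most exponentially, so it cannot leave 0 upwards: compare at
   the last zero before a point with [F > 0]. *)
Lemma barrier (F dF : R -> R) (a b C : R) :
  (forall s, a <= s <= b -> continuity_pt F s) ->
  (forall s, a < s < b -> is_derive F s (dF s)) ->
  (forall s, a < s < b -> 0 < F s -> dF s <= C * F s) ->
  F a <= 0 -> forall s, a <= s <= b -> F s <= 0.
Proof.
  intros Hc Hd Hb Ha s Hs. apply Rnot_lt_le; intro Hpos.
  destruct (completeness (fun r => a <= r <= s /\ F r <= 0)) as [s0 [Hub Hleast]].
  { exists s. intros r [Hr _]; lra. }
  { exists a. split; [lra|exact Ha]. }
  assert (Has0 : a <= s0) by (apply Hub; split; [lra|exact Ha]).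
  assert (Hs0s : s0 <= s) by (apply Hleast; intros r [Hr _]; lra).
  assert (Hcs0 := proj1 (continuity_pt_eps F s0) (Hc s0 ltac:(lra))).
  assert (F0 : F s0 <= 0).
  { apply Rnot_lt_le; intro HF.
    destruct (Hcs0 (F s0) HF) as [d [Hd0 Hd1]].
    assert (s0 <= s0 - d); [|lra].
    apply Hleast. intros r [Hr Hr'].
    apply Rnot_lt_le; intro Hlt.
    assert (r <= s0) by (apply Hub; split; assumption).
    assert (Rabs (F r - F s0) < F s0).
    { apply Hd1. apply Rabs_def1; lra. }
    apply Rabs_def2 in H0. lra. }
  assert (Hlt : s0 < s).
  { destruct Hs0s as [H|H]; [exact H|]. rewrite H in F0; lra. }
  assert (Hp : forall r, s0 < r <= s -> 0 < F r).
  { intros r Hr. apply Rnot_le_lt; intro H.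
    assert (r <= s0); [|lra]. apply Hub; split; [lra|exact H]. }
  destruct (mvt_open (fun r => F r * exp (- C * r)) (fun r => (dF r - C * F r) * exp (- C * r)) s0 s Hlt)
    as [c [Hc1 Hc2]].
  - intros r Hr. assert (continuity_pt F r) by (apply Hc; lra). ctn.
  - intros r Hr. specialize (Hd r ltac:(lra)).
    eapply is_derive_eq.
    + apply (is_derive_mult F (fun r => exp (- C * r)) r (dF r) (- C * exp (- C * r)) Hd).
      * auto_derive; [exact I|ring].
      * intros; apply Rmult_comm.
    + unfold plus, mult; simpl; ring.
  - assert (dF c <= C * F c) by (apply Hb; [lra|apply Hp; lra]).
    assert (0 < exp (- C * c)) by apply exp_pos.
    assert (0 < exp (- C * s)) by apply exp_pos.
    assert (0 < exp (- C * s0)) by apply exp_pos.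
    assert (0 < F s * exp (- C * s)) by (apply Rmult_lt_0_compat; assumption).
    assert (F s0 * exp (- C * s0) <= 0) by nra.
    assert ((dF c - C * F c) * exp (- C * c) <= 0) by nra.
    nra.
Qed.

(** [survives] asks for one-sided derivatives at both ends, while [sol] records interior ones only.
    Continuity of [g] up to the ends supplies the rest through the mean value theorem. *)
Lemma derive_within_of_interior (f g : R -> R) (a b : R) :
  (forall s, a <= s <= b -> continuity_pt f s) ->
  (forall s, a < s < b -> is_derive f s (g s)) ->
  (forall s, a <= s <= b -> continuity_pt g s) ->
  forall s, a <= s <= b -> rderiv_within a b f (g s) s.
Proof.
  intros Hf Hd Hg s Hs eps He.
  destruct (proj1 (continuity_pt_eps g s) (Hg s Hs) eps He) as [d [Hd0 Hd1]].
  exists d; split; [exact Hd0|]. intros u Hu Hne Hclose.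
  apply Rabs_def2 in Hclose.
  destruct (Rtotal_order u s) as [Hlt|[Heq|Hgt]]; [|contradiction|].
  - destruct (mvt_open f g u s Hlt) as [c [Hc E]].
    + intros; apply Hf; lra.
    + intros; apply Hd; lra.
    + replace ((f u - f s) / (u - s)) with (g c).
      * apply Hd1. apply Rabs_def1; lra.
      * replace (f u - f s) with (g c * (u - s)) by lra. field; lra.
  - destruct (mvt_open f g s u Hgt) as [c [Hc E]].
    + intros; apply Hf; lra.
    + intros; apply Hd; lra.
    + replace ((f u - f s) / (u - s)) with (g c).
      * apply Hd1. apply Rabs_def1; lra.
      * rewrite E. field; lra.
Qed.

(** Precomposing with [clamp] makes a function that is continuous on [a,b] continuous on the whole
    line, as integrals and [continuity_pt] at the end points require. *)
Definition clamp (a b s : R) : R := Rmax a (Rmin b s).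

Lemma clamp_in (a b s : R) : a <= b -> a <= clamp a b s <= b.
Proof.
  intros. unfold clamp. split; [apply Rmax_l|]. apply Rmax_lub; [assumption|apply Rmin_l].
Qed.

Lemma clamp_id (a b s : R) : a <= s <= b -> clamp a b s = s.
Proof.
  intros. unfold clamp. rewrite Rmin_right by lra. apply Rmax_right; lra.
Qed.

Lemma clamp_lip (a b s u : R) : Rabs (clamp a b s - clamp a b u) <= Rabs (s - u).
Proof.
  unfold clamp, Rmax, Rmin.
  repeat (destruct Rle_dec); unfold Rabs; repeat destruct Rcase_abs; lra.
Qed.

Lemma clamp_continuous (f : R -> R) (a b : R) :
  a <= b -> rcont_on a b f -> forall s, continuity_pt (fun r => f (clamp a b r)) s.
Proof.
  intros ab H s. apply continuity_pt_eps. intros eps He.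
  destruct (H (clamp a b s) (clamp_in a b s ab) eps He) as [d [Hd Hd']].
  exists d; split; [exact Hd|]. intros u Hu. apply Hd'.
  - now apply clamp_in.
  - eapply Rle_lt_trans; [apply clamp_lip|exact Hu].
Qed.

Lemma is_derive_of_within (f : R -> R) (a b d s : R) :
  a < s < b -> rderiv_within a b f d s -> is_derive f s d.
Proof.
  intros Hs H. apply is_derive_Reals. intros eps He.
  destruct (H eps He) as [del [Hdel H']].
  assert (Hm : 0 < Rmin del (Rmin (s - a) (b - s))).
  { repeat apply Rmin_glb_lt; lra. }
  exists (mkposreal _ Hm). intros h Hh0 Hh. simpl in Hh.
  assert (Rabs h < del) by (eapply Rlt_le_trans; [exact Hh|apply Rmin_l]).
  assert (Rabs h < Rmin (s - a) (b - s)) by (eapply Rlt_le_trans; [exact Hh|apply Rmin_r]).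
  assert (Rabs h < s - a) by (eapply Rlt_le_trans; [exact H1|apply Rmin_l]).
  assert (Rabs h < b - s) by (eapply Rlt_le_trans; [exact H1|apply Rmin_r]).
  apply Rabs_def2 in H2. apply Rabs_def2 in H3.
  specialize (H' (s + h)). replace (s + h - s) with h in H' by ring.
  apply H'; try lra.
Qed.

Lemma rcont_of_within (f : R -> R) (a b d s : R) :
  rderiv_within a b f d s ->
  forall eps, 0 < eps -> exists delta, 0 < delta /\
    forall u, a <= u <= b -> Rabs (u - s) < delta -> Rabs (f u - f s) < eps.
Proof.
  intros H eps He. destruct (H 1 Rlt_0_1) as [del [Hdel H']].
  assert (HM : 0 < Rabs d + 1) by (pose proof (Rabs_pos d); lra).
  exists (Rmin del (eps / (Rabs d + 1))). split.
  { apply Rmin_glb_lt; [lra|]. now apply Rdiv_lt_0_compat. }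
  intros u Hu Hc. destruct (Req_dec u s) as [->|Hne].
  { rewrite Rminus_diag, Rabs_R0; exact He. }
  assert (H1 : Rabs (u - s) < del) by (eapply Rlt_le_trans; [exact Hc|apply Rmin_l]).
  assert (H2 : Rabs (u - s) < eps / (Rabs d + 1)) by (eapply Rlt_le_trans; [exact Hc|apply Rmin_r]).
  specialize (H' u Hu Hne H1).
  replace (f u - f s) with ((f u - f s) / (u - s) * (u - s)) by (field; lra).
  rewrite Rabs_mult.
  assert (Rabs ((f u - f s) / (u - s)) <= Rabs d + 1).
  { replace ((f u - f s) / (u - s)) with ((f u - f s) / (u - s) - d + d) by ring.
    eapply Rle_trans; [apply Rabs_triang|]. lra. }
  apply Rle_lt_trans with ((Rabs d + 1) * Rabs (u - s)).
  { apply Rmult_le_compat_r; [apply Rabs_pos|assumption]. }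
  apply (Rmult_lt_compat_l _ _ _ HM) in H2.
  replace ((Rabs d + 1) * (eps / (Rabs d + 1))) with eps in H2 by (field; lra).
  exact H2.
Qed.

(** * The Picard-Lindelöf theorem *)

Definition lipschitz (B : R) (f : R -> R) : Prop :=
  forall s u, Rabs (f s - f u) <= B * Rabs (s - u).

Lemma lipschitz_continuity (B : R) (f : R -> R) (s : R) : lipschitz B f -> continuity_pt f s.
Proof.
  intros H. apply continuity_pt_eps. intros eps He.
  pose proof (Rabs_pos B).
  exists (eps / (Rabs B + 1)). split; [apply Rdiv_lt_0_compat; lra|].
  intros u Hu. eapply Rle_lt_trans; [apply H|].
  apply Rle_lt_trans with ((Rabs B + 1) * Rabs (u - s)).
  - apply Rmult_le_compat_r; [apply Rabs_pos|]. pose proof (Rle_abs B); lra.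
  - apply (Rmult_lt_compat_l (Rabs B + 1)) in Hu; [|lra].
    replace ((Rabs B + 1) * (eps / (Rabs B + 1))) with eps in Hu by (field; lra). exact Hu.
Qed.

Lemma ex_RInt_cont (f : R -> R) (a b : R) : (forall s, continuity_pt f s) -> ex_RInt f a b.
Proof.
  intros H. apply (ex_RInt_continuous (V := R_CompleteNormedModule)).
  intros; apply continuity_pt_filterlim, H.
Qed.

Lemma RInt_lipschitz (f : R -> R) (a B : R) :
  (forall s, continuity_pt f s) -> (forall s, Rabs (f s) <= B) ->
  lipschitz B (fun s => RInt f a s).
Proof.
  intros Hc Hb.
  assert (H : forall u s, u <= s -> Rabs (RInt f a s - RInt f a u) <= B * Rabs (s - u)).
  { intros u s Hus.
    assert (E := RInt_Chasles f a u s (ex_RInt_cont f a u Hc) (ex_RInt_cont f u s Hc)).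
    change (RInt f a u + RInt f u s = RInt f a s) in E.
    rewrite <- E, Rplus_minus_l, (Rabs_pos_eq (s - u)), Rmult_comm by lra.
    apply abs_RInt_le_const; [exact Hus|now apply ex_RInt_cont|intros; apply Hb]. }
  intros s u. destruct (Rle_dec u s) as [h|h]; [now apply H|].
  rewrite Rabs_minus_sym, (Rabs_minus_sym s). apply H; lra.
Qed.

Lemma is_derive_RInt_cont (f : R -> R) (a s : R) :
  (forall s, continuity_pt f s) -> is_derive (fun u => RInt f a u) s (f s).
Proof.
  intros Hc. apply (is_derive_RInt f _ a s).
  - apply filter_forall. intros u. apply (RInt_correct (V := R_CompleteNormedModule)). now apply ex_RInt_cont.
  - apply continuity_pt_filterlim, Hc.
Qed.

(** The factor 2 sums the geometric tail. [Lim_seq] is total, so the limit can be named before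
    convergence is known. The rate serves both the Picard iterates and the backward flows started at
    height 2^-k. *)
Lemma geometric_limit (u : nat -> R) (M : R) :
  (forall k, Rabs (u (S k) - u k) <= M * (/ 2) ^ k) ->
  forall k, Rabs (u k - real (Lim_seq u)) <= 2 * M * (/ 2) ^ k.
Proof.
  intros H.
  assert (HM : 0 <= M).
  { specialize (H 0%nat). pose proof (Rabs_pos (u 1%nat - u 0%nat)). simpl in H; lra. }
  assert (Hp : forall p k, Rabs (u (k + p)%nat - u k) <= 2 * M * (/ 2) ^ k).
  { assert (Hp' : forall p k, Rabs (u (k + p)%nat - u k) <= 2 * M * (/ 2) ^ k * (1 - (/ 2) ^ p)).
    { induction p as [|p IH]; intros k.
      - rewrite Nat.add_0_r, Rminus_diag, Rabs_R0. simpl. lra.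
      - replace (u (k + S p)%nat - u k) with ((u (S (k + p)) - u (k + p)%nat) + (u (k + p)%nat - u k))
          by (rewrite <- plus_n_Sm; ring).
        eapply Rle_trans; [apply Rabs_triang|].
        specialize (IH k). specialize (H (k + p)%nat). rewrite pow_add in H. simpl. nra. }
    intros p k. eapply Rle_trans; [apply Hp'|].
    assert (0 < (/ 2) ^ p) by (apply pow_lt; lra).
    assert (0 < (/ 2) ^ k) by (apply pow_lt; lra).
    rewrite <- (Rmult_1_r (2 * M * (/ 2) ^ k)) at 2.
    apply Rmult_le_compat_l; [|lra]. apply Rmult_le_pos; lra. }
  assert (Hcv : ex_finite_lim_seq u).
  { apply ex_lim_seq_cauchy_corr. intros eps.
    assert (Hz : is_lim_seq (fun k => 2 * M * (/ 2) ^ k) 0).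
    { replace (Finite 0) with (Rbar_mult (2 * M) 0) by (simpl; f_equal; ring).
      apply (is_lim_seq_scal_l (fun k => (/ 2) ^ k) (2 * M) 0).
      apply is_lim_seq_geom. rewrite Rabs_pos_eq; lra. }
    apply is_lim_seq_spec in Hz.
    destruct (Hz (pos_div_2 eps)) as [K HK].
    exists K. intros m p Hm Hp2.
    specialize (HK K (le_n K)). rewrite Rminus_0_r in HK. simpl in HK.
    apply Rabs_def2 in HK.
    pose proof (Hp (m - K)%nat K) as A. pose proof (Hp (p - K)%nat K) as B.
    replace (K + (m - K))%nat with m in A by lia. replace (K + (p - K))%nat with p in B by lia.
    replace (u m - u p) with ((u m - u K) - (u p - u K)) by ring.
    eapply Rle_lt_trans; [apply Rabs_triang|]. rewrite Rabs_Ropp. lra. }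
  apply Lim_seq_correct' in Hcv.
  intros k. apply is_lim_seq_spec in Hcv.
  apply le_epsilon. intros eps He.
  destruct (Hcv (mkposreal eps He)) as [K HK].
  specialize (HK (k + K)%nat ltac:(lia)). simpl in HK.
  specialize (Hp K k).
  replace (u k - Lim_seq u) with (- (u (k + K)%nat - u k) + (u (k + K)%nat - Lim_seq u)) by ring.
  eapply Rle_trans; [apply Rabs_triang|]. rewrite Rabs_Ropp. lra.
Qed.

Section Picard.
Variables (f1 f2 : R -> R -> R -> R) (B L x0 y0 : R).
Hypotheses (HL : 0 < L)
  (Hb1 : forall s x y, Rabs (f1 s x y) <= B) (Hb2 : forall s x y, Rabs (f2 s x y) <= B)
  (Hl1 : forall s x y x' y', Rabs (f1 s x y - f1 s x' y') <= L * (Rabs (x - x') + Rabs (y - y')))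
  (Hl2 : forall s x y x' y', Rabs (f2 s x y - f2 s x' y') <= L * (Rabs (x - x') + Rabs (y - y')))
  (Hc1 : forall x y, (forall s, continuity_pt x s) -> (forall s, continuity_pt y s) ->
     forall s, continuity_pt (fun s => f1 s (x s) (y s)) s)
  (Hc2 : forall x y, (forall s, continuity_pt x s) -> (forall s, continuity_pt y s) ->
     forall s, continuity_pt (fun s => f2 s (x s) (y s)) s).

(* Freezing the iterates on [s <= 0] makes them defined and continuous on the whole line while all
   estimates are only needed for [s >= 0]. *)
Fixpoint picard (k : nat) : (R -> R) * (R -> R) :=
  match k with
  | O => (fun _ => x0, fun _ => y0)
  | S k => (fun s => x0 + RInt (fun r => f1 r (fst (picard k) r) (snd (picard k) r)) 0 (Rmax 0 s),
            fun s => y0 + RInt (fun r => f2 r (fst (picard k) r) (snd (picard k) r)) 0 (Rmax 0 s))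
  end.

Lemma Rmax_0_lip (s u : R) : Rabs (Rmax 0 s - Rmax 0 u) <= Rabs (s - u).
Proof.
  unfold Rmax. repeat destruct Rle_dec; unfold Rabs; repeat destruct Rcase_abs; lra.
Qed.

Lemma bound_nonneg : 0 <= B.
Proof. eapply Rle_trans; [apply Rabs_pos|apply (Hb1 0 0 0)]. Qed.

Lemma lipschitz_shift (g : R -> R) (c : R) :
  (forall s, continuity_pt g s) -> (forall s, Rabs (g s) <= B) ->
  lipschitz B (fun s => c + RInt g 0 (Rmax 0 s)).
Proof.
  intros Hc Hb s u.
  replace (c + RInt g 0 (Rmax 0 s) - (c + RInt g 0 (Rmax 0 u)))
    with (RInt g 0 (Rmax 0 s) - RInt g 0 (Rmax 0 u)) by ring.
  eapply Rle_trans; [apply (RInt_lipschitz g 0 B Hc Hb)|].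
  apply Rmult_le_compat_l; [apply bound_nonneg|apply Rmax_0_lip].
Qed.

Lemma picard_lipschitz (k : nat) :
  lipschitz B (fst (picard k)) /\ lipschitz B (snd (picard k)).
Proof.
  induction k as [|k [IH1 IH2]]; simpl.
  - split; intros s u; rewrite Rminus_diag, Rabs_R0;
      apply Rmult_le_pos; [apply bound_nonneg|apply Rabs_pos|apply bound_nonneg|apply Rabs_pos].
  - split; apply lipschitz_shift; try (intros; apply Hb1); try (intros; apply Hb2).
    + apply Hc1; intros; eapply lipschitz_continuity; eassumption.
    + apply Hc2; intros; eapply lipschitz_continuity; eassumption.
Qed.

Lemma RInt_exp_le (c s : R) : 0 <= s -> 0 <= c ->
  RInt (fun r => c * exp (4 * L * r)) 0 s <= c / (4 * L) * exp (4 * L * s).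
Proof.
  intros Hs Hc.
  assert (E : is_RInt (fun r => c * exp (4 * L * r)) 0 s
     (minus (c / (4 * L) * exp (4 * L * s)) (c / (4 * L) * exp (4 * L * 0)))).
  { apply (is_RInt_derive (fun r => c / (4 * L) * exp (4 * L * r))).
    - intros r _. auto_derive; [exact I|field; lra].
    - intros r _. apply continuity_pt_filterlim. ctn. }
  assert (E' : RInt (fun r => c * exp (4 * L * r)) 0 s =
    c / (4 * L) * exp (4 * L * s) - c / (4 * L) * exp (4 * L * 0))
    by (apply (is_RInt_unique (V := R_CompleteNormedModule)); exact E).
  rewrite E'.
  assert (0 <= c / (4 * L)) by (apply Rdiv_le_0_compat; lra).
  pose proof (exp_pos (4 * L * 0)). nra.
Qed.

Lemma picard_int_bound (f g : R -> R) (c s : R) : 0 <= s -> 0 <= c ->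
  (forall s, continuity_pt f s) -> (forall s, continuity_pt g s) ->
  (forall r, 0 <= r -> Rabs (f r - g r) <= c * exp (4 * L * r)) ->
  Rabs (RInt f 0 s - RInt g 0 s) <= c / (4 * L) * exp (4 * L * s).
Proof.
  intros Hs Hc Hf Hg H.
  assert (E : RInt f 0 s - RInt g 0 s = RInt (fun r => f r - g r) 0 s).
  { symmetry. apply (RInt_minus f g 0 s); now apply ex_RInt_cont. }
  rewrite E. eapply Rle_trans; [|now apply RInt_exp_le].
  assert (forall s, continuity_pt (fun r => f r - g r) s) by (intros; ctn).
  eapply Rle_trans; [apply abs_RInt_le; [exact Hs|now apply ex_RInt_cont]|].
  apply RInt_le; [exact Hs| | |].
  - apply ex_RInt_cont. intros u. apply (continuity_pt_comp (fun r => f r - g r) Rabs); [auto|apply Rcontinuity_abs].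
  - apply ex_RInt_cont. intros; ctn.
  - intros r Hr. apply H; lra.
Qed.

Lemma picard_cont (k : nat) : forall s, continuity_pt (fst (picard k)) s /\ continuity_pt (snd (picard k)) s.
Proof.
  intros s. destruct (picard_lipschitz k). split; eapply lipschitz_continuity; eassumption.
Qed.

(** Bielecki's weight exp(4 L s): integrating it gains a factor 1/(4L), and the Lipschitz bound adds
    the errors of two coordinates, so every iteration contracts by 2L/(4L) = 1/2 on the whole half
    line at once. *)
Lemma picard_cauchy (k : nat) (s : R) : 0 <= s ->
  Rabs (fst (picard (S k)) s - fst (picard k) s) <= B / (4 * L) * exp (4 * L * s) * (/ 2) ^ k /\
  Rabs (snd (picard (S k)) s - snd (picard k) s) <= B / (4 * L) * exp (4 * L * s) * (/ 2) ^ k.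
Proof.
  pose proof bound_nonneg as HB.
  assert (HBL : 0 <= B / (4 * L)) by (apply Rdiv_le_0_compat; lra).
  revert s. induction k as [|k IH]; intros s Hs.
  - assert (HE : s <= exp (4 * L * s) / (4 * L)).
    { apply Rmult_le_reg_l with (4 * L); [lra|].
      replace (4 * L * (exp (4 * L * s) / (4 * L))) with (exp (4 * L * s)) by (field; lra).
      pose proof (exp_ineq1_le (4 * L * s)). lra. }
    assert (HE2 : s * B <= B / (4 * L) * exp (4 * L * s) * 1).
    { replace (B / (4 * L) * exp (4 * L * s) * 1) with (exp (4 * L * s) / (4 * L) * B) by (field; lra).
      apply Rmult_le_compat_r; assumption. }
    simpl. rewrite (Rmax_right 0 s) by lra.
    split; (rewrite Rplus_minus_l; eapply Rle_trans; [|exact HE2]);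
      rewrite <- (Rminus_0_r s) at 2; apply abs_RInt_le_const; auto; apply ex_RInt_cont.
    + apply Hc1; intros; ctn.
    + apply Hc2; intros; ctn.
  - assert (Hk : 0 < (/ 2) ^ k) by (apply pow_lt; lra).
    set (c := L * (2 * (B / (4 * L) * (/ 2) ^ k))).
    assert (Hc : 0 <= c) by (unfold c; apply Rmult_le_pos; [lra|]; pose proof (Rmult_le_pos _ _ HBL (Rlt_le _ _ Hk)); lra).
    assert (Ec : c / (4 * L) * exp (4 * L * s) = B / (4 * L) * exp (4 * L * s) * (/ 2) ^ S k).
    { unfold c. simpl. field. lra. }
    rewrite <- Ec.
    change (picard (S (S k))) with
      (fun s => x0 + RInt (fun r => f1 r (fst (picard (S k)) r) (snd (picard (S k)) r)) 0 (Rmax 0 s),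
       fun s => y0 + RInt (fun r => f2 r (fst (picard (S k)) r) (snd (picard (S k)) r)) 0 (Rmax 0 s)).
    cbn [fst snd].
    replace (fst (picard (S k)) s) with
      (x0 + RInt (fun r => f1 r (fst (picard k) r) (snd (picard k) r)) 0 (Rmax 0 s)) by reflexivity.
    replace (snd (picard (S k)) s) with
      (y0 + RInt (fun r => f2 r (fst (picard k) r) (snd (picard k) r)) 0 (Rmax 0 s)) by reflexivity.
    rewrite (Rmax_right 0 s) by lra.
    pose proof (picard_cont k) as Ck. pose proof (picard_cont (S k)) as CSk.
    split.
    + replace (x0 + _ - (x0 + _)) with
       (RInt (fun r => f1 r (fst (picard (S k)) r) (snd (picard (S k)) r)) 0 s
        - RInt (fun r => f1 r (fst (picard k) r) (snd (picard k) r)) 0 s) by ring.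
      apply picard_int_bound; auto.
      * apply Hc1; intros; apply CSk.
      * apply Hc1; intros; apply Ck.
      * intros r Hr. eapply Rle_trans; [apply Hl1|].
        destruct (IH r Hr). unfold c. rewrite Rmult_assoc.
        apply Rmult_le_compat_l; lra.
    + replace (y0 + _ - (y0 + _)) with
       (RInt (fun r => f2 r (fst (picard (S k)) r) (snd (picard (S k)) r)) 0 s
        - RInt (fun r => f2 r (fst (picard k) r) (snd (picard k) r)) 0 s) by ring.
      apply picard_int_bound; auto.
      * apply Hc2; intros; apply CSk.
      * apply Hc2; intros; apply Ck.
      * intros r Hr. eapply Rle_trans; [apply Hl2|].
        destruct (IH r Hr). unfold c. rewrite Rmult_assoc.
        apply Rmult_le_compat_l; lra.
Qed.

Lemma half_pow_small (M eps : R) : 0 < eps -> exists k, M * (/ 2) ^ k < eps.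
Proof.
  intros He.
  assert (Hz : is_lim_seq (fun k => M * (/ 2) ^ k) 0).
  { replace (Finite 0) with (Rbar_mult M 0) by (simpl; f_equal; ring).
    apply (is_lim_seq_scal_l (fun k => (/ 2) ^ k) M 0).
    apply is_lim_seq_geom. rewrite Rabs_pos_eq; lra. }
  apply is_lim_seq_spec in Hz. destruct (Hz (mkposreal eps He)) as [K HK].
  exists K. specialize (HK K (le_n K)). rewrite Rminus_0_r in HK. apply Rabs_def2 in HK. simpl in HK. lra.
Qed.

Lemma picard_lindelof : exists x y : R -> R, x 0 = x0 /\ y 0 = y0 /\
  forall s, 0 <= s -> is_derive x s (f1 s (x s) (y s)) /\ is_derive y s (f2 s (x s) (y s)).
Proof.
  pose proof bound_nonneg as HB.
  assert (HBL : 0 <= B / (4 * L)) by (apply Rdiv_le_0_compat; lra).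
  set (X := fun s => real (Lim_seq (fun k => fst (picard k) (Rmax 0 s)))).
  set (Y := fun s => real (Lim_seq (fun k => snd (picard k) (Rmax 0 s)))).
  set (W := fun s => 2 * (B / (4 * L) * exp (4 * L * (Rmax 0 s)))).
  assert (HX : forall k s, Rabs (fst (picard k) (Rmax 0 s) - X s) <= W s * (/ 2) ^ k).
  { intros k s. apply (geometric_limit (fun k => fst (picard k) (Rmax 0 s))).
    intros j. apply picard_cauchy, Rmax_l. }
  assert (HY : forall k s, Rabs (snd (picard k) (Rmax 0 s) - Y s) <= W s * (/ 2) ^ k).
  { intros k s. apply (geometric_limit (fun k => snd (picard k) (Rmax 0 s))).
    intros j. apply picard_cauchy, Rmax_l. }
  (* A common Lipschitz constant passes to pointwise limits, so the limits are continuous and can be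
     integrated. *)
  assert (LipLim : forall (P : nat -> R -> R) Z, (forall k, lipschitz B (P k)) ->
     (forall k s, Rabs (P k (Rmax 0 s) - Z s) <= W s * (/ 2) ^ k) -> lipschitz B Z).
  { intros P Z HP HZ s u. apply le_epsilon. intros eps He.
    destruct (half_pow_small (W s + W u) eps He) as [k Hk].
    pose proof (HZ k s) as A1. pose proof (HZ k u) as A2.
    pose proof (HP k (Rmax 0 s) (Rmax 0 u)) as A3.
    pose proof (Rmult_le_compat_l B _ _ HB (Rmax_0_lip s u)) as A4.
    replace (Z s - Z u) with (- (P k (Rmax 0 s) - Z s) + (P k (Rmax 0 s) - P k (Rmax 0 u)) + (P k (Rmax 0 u) - Z u)) by ring.
    eapply Rle_trans; [apply Rabs_triang|].
    eapply Rle_trans; [apply Rplus_le_compat_r, Rabs_triang|]. rewrite Rabs_Ropp. lra. }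
  assert (CX : forall s, continuity_pt X s).
  { intros s. apply (lipschitz_continuity B). apply (LipLim (fun k => fst (picard k))); [apply picard_lipschitz|exact HX]. }
  assert (CY : forall s, continuity_pt Y s).
  { intros s. apply (lipschitz_continuity B). apply (LipLim (fun k => snd (picard k))); [apply picard_lipschitz|exact HY]. }
  assert (Key : forall (f : R -> R -> R -> R) (c : R) (P : nat -> R -> R) (Z : R -> R),
    (forall s x y x' y', Rabs (f s x y - f s x' y') <= L * (Rabs (x - x') + Rabs (y - y'))) ->
    (forall x y, (forall s, continuity_pt x s) -> (forall s, continuity_pt y s) ->
       forall s, continuity_pt (fun s => f s (x s) (y s)) s) ->
    (forall k s, Rabs (P k (Rmax 0 s) - Z s) <= W s * (/ 2) ^ k) ->
    (forall k s, P (S k) s = c + RInt (fun r => f r (fst (picard k) r) (snd (picard k) r)) 0 (Rmax 0 s)) ->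
    forall s, 0 <= s -> Z s = c + RInt (fun r => f r (X r) (Y r)) 0 s).
  { intros f c P Z Hl Hc HZ HP s Hs.
    apply Rminus_diag_uniq. apply cond_eq. intros eps He.
    rewrite Rminus_0_r.
    destruct (half_pow_small (2 * W s) eps He) as [k Hk].
    pose proof (HZ (S k) s) as A. rewrite HP in A.
    rewrite (Rmax_right 0 s), (Rmax_right 0 s) in A by lra.
    assert (Hk0 : 0 < (/ 2) ^ k) by (apply pow_lt; lra).
    assert (B1 : Rabs (RInt (fun r => f r (fst (picard k) r) (snd (picard k) r)) 0 s
       - RInt (fun r => f r (X r) (Y r)) 0 s) <= L * (4 * (B / (4 * L)) * (/ 2) ^ k) / (4 * L) * exp (4 * L * s)).
    { apply picard_int_bound; auto.
      - pose proof (Rmult_le_pos _ _ HBL (Rlt_le _ _ Hk0)).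
        apply Rmult_le_pos; lra.
      - apply Hc; intros; apply picard_cont.
      - intros r Hr. eapply Rle_trans; [apply Hl|].
        pose proof (HX k r) as A1. pose proof (HY k r) as A2. unfold W in A1, A2.
        rewrite (Rmax_right 0 r) in A1, A2 by lra.
        rewrite Rmult_assoc. apply Rmult_le_compat_l; lra. }
    assert (B2 : L * (4 * (B / (4 * L)) * (/ 2) ^ k) / (4 * L) * exp (4 * L * s) = W s * (/ 2) ^ k / 2).
    { unfold W. rewrite (Rmax_right 0 s) by lra. field. lra. }
    rewrite B2 in B1. simpl in A.
    replace (Z s - (c + RInt (fun r => f r (X r) (Y r)) 0 s)) with
      (- (c + RInt (fun r => f r (fst (picard k) r) (snd (picard k) r)) 0 s - Z s) +
        (RInt (fun r => f r (fst (picard k) r) (snd (picard k) r)) 0 s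
       - RInt (fun r => f r (X r) (Y r)) 0 s)) by ring.
    eapply Rle_lt_trans; [apply Rabs_triang|]. rewrite Rabs_Ropp.
    assert (0 <= W s) by (unfold W; pose proof (exp_pos (4 * L * Rmax 0 s)); apply Rmult_le_pos; [lra|apply Rmult_le_pos; lra]).
    nra. }
  assert (EX := Key f1 x0 (fun k => fst (picard k)) X Hl1 Hc1 HX (fun k s => eq_refl)).
  assert (EY := Key f2 y0 (fun k => snd (picard k)) Y Hl2 Hc2 HY (fun k s => eq_refl)).
  (* [X] and [Y] are frozen for negative times and may have a corner at 0. The integrals agree with
     them for s >= 0 and have a two-sided derivative at 0 as well. *)
  exists (fun s => x0 + RInt (fun r => f1 r (X r) (Y r)) 0 s),
         (fun s => y0 + RInt (fun r => f2 r (X r) (Y r)) 0 s).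
  split; [|split].
  - rewrite RInt_point. unfold zero; simpl; ring.
  - rewrite RInt_point. unfold zero; simpl; ring.
  - intros s Hs. rewrite <- (EX s Hs), <- (EY s Hs). split.
    + eapply is_derive_eq.
      * apply (is_derive_plus (fun _ => x0) (fun s => RInt (fun r => f1 r (X r) (Y r)) 0 s)).
        -- apply is_derive_const.
        -- apply is_derive_RInt_cont. now apply Hc1.
      * unfold plus, zero; simpl; ring.
    + eapply is_derive_eq.
      * apply (is_derive_plus (fun _ => y0) (fun s => RInt (fun r => f2 r (X r) (Y r)) 0 s)).
        -- apply is_derive_const.
        -- apply is_derive_RInt_cont. now apply Hc2.
      * unfold plus, zero; simpl; ring.
Qed.
End Picard.

(** * Forward and backward Loewner flow *)

Definition nsq (lam x y : R -> R) (s : R) : R :=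
  (x s - lam s) * (x s - lam s) + y s * y s.

(* [k = 2] is the Loewner flow, [k = -2] (with [lam] reversed in time) the backward flow. *)
Definition sol (lam : R -> R) (k b : R) (x y : R -> R) : Prop :=
  (forall s, 0 <= s <= b -> continuity_pt x s /\ continuity_pt y s /\ 0 < nsq lam x y s) /\
  (forall s, 0 < s < b ->
     is_derive x s (k * (x s - lam s) / nsq lam x y s) /\
     is_derive y s (- (k * y s) / nsq lam x y s)).

Lemma continuity_pt_Rmax_const (f : R -> R) (c s : R) :
  continuity_pt f s -> continuity_pt (fun u => Rmax (f u) c) s.
Proof.
  intros H. apply (continuity_pt_ext_all (fun u => / 2 * (f u + c + Rabs (f u - c)))).
  - intros u. unfold Rmax, Rabs. destruct Rle_dec, Rcase_abs; lra.
  - assert (continuity_pt (fun u => Rabs (f u - c)) s).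
    { apply (continuity_pt_comp (fun u => f u - c) Rabs); [ctn|apply Rcontinuity_abs]. }
    apply (continuity_pt_mult (fun _ => / 2) (fun u => f u + c + Rabs (f u - c))); [ctn|].
    apply (continuity_pt_plus (fun u => f u + c) (fun u => Rabs (f u - c))); ctn.
Qed.

Lemma continuity_pt_quot (f g : R -> R) (s : R) :
  continuity_pt f s -> continuity_pt g s -> g s <> 0 -> continuity_pt (fun u => f u / g u) s.
Proof. intros; now apply (continuity_pt_div f g). Qed.

(** Truncated denominator in 1/w = conj w / |w|^2. The truncated field is globally bounded and
    Lipschitz, so its flow exists for all times; it is the Loewner flow as long as the distance to
    the driving point is at least rho. *)
Definition cap (rho X Y : R) : R := Rmax (X * X + Y * Y) (rho * rho).

Lemma cap_cases (rho X Y : R) :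
  let N := X * X + Y * Y in
  (cap rho X Y = N /\ rho * rho <= N) \/ (cap rho X Y = rho * rho /\ N <= rho * rho).
Proof.
  intros N. unfold cap. fold N. unfold Rmax. destruct Rle_dec; [right|left]; lra.
Qed.

Lemma cap_pos (rho X Y : R) : 0 < rho -> 0 < cap rho X Y.
Proof.
  intros H. unfold cap. apply Rlt_le_trans with (rho * rho); [nra|apply Rmax_r].
Qed.

Lemma trunc_bound (rho X Y Z : R) : 0 < rho -> Z * Z <= X * X + Y * Y ->
  Rabs (Z / cap rho X Y) <= / rho.
Proof.
  intros Hr HZ. pose proof (cap_pos rho X Y Hr) as Hc.
  assert (H1 : X * X + Y * Y <= cap rho X Y) by apply Rmax_l.
  assert (H2 : rho * rho <= cap rho X Y) by apply Rmax_r.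
  set (m := cap rho X Y) in *.
  assert (Hz : Rabs Z * rho <= m).
  { pose proof (Rabs_mul_self Z).
    pose proof (Rabs_pos Z). nra. }
  unfold Rdiv. rewrite Rabs_mult, (Rabs_pos_eq (/ m)) by (left; now apply Rinv_0_lt_compat).
  apply Rmult_le_reg_r with (m * rho); [nra|].
  replace (Rabs Z * / m * (m * rho)) with (Rabs Z * rho) by (field; lra).
  replace (/ rho * (m * rho)) with m by (field; lra). exact Hz.
Qed.

(* The map [w -> conj w / max(|w|^2, rho^2)] contracts distances up to the factor [rho^-2]. *)
Lemma trunc_lipschitz_sq (rho X Y X' Y' : R) : 0 < rho ->
  (rho * rho) * (rho * rho) *
   (Rsqr (X / cap rho X Y - X' / cap rho X' Y') + Rsqr (Y / cap rho X Y - Y' / cap rho X' Y'))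
  <= Rsqr (X - X') + Rsqr (Y - Y').
Proof.
  intros Hr.
  assert (Hmu : 0 < rho * rho) by nra.
  pose proof (cap_cases rho X Y) as C1. pose proof (cap_cases rho X' Y') as C2.
  pose proof (cap_pos rho X Y Hr) as P1. pose proof (cap_pos rho X' Y' Hr) as P2.
  cbv zeta in C1, C2.
  set (mu := rho * rho) in *. set (m := cap rho X Y) in *. set (m' := cap rho X' Y') in *.
  set (N := X * X + Y * Y) in *. set (N' := X' * X' + Y' * Y') in *.
  set (P := X * X' + Y * Y').
  assert (HP : 2 * P <= N + N').
  { unfold P, N, N'. pose proof (mul_self_nonneg (X - X')). pose proof (mul_self_nonneg (Y - Y')).
    nra. }
  assert (HP2 : - (N + N') <= 2 * P).
  { unfold P, N, N'. pose proof (mul_self_nonneg (X + X')). pose proof (mul_self_nonneg (Y + Y')).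
    nra. }
  set (a := mu / m). set (a' := mu / m').
  assert (E1 : mu * mu * (Rsqr (X / m - X' / m') + Rsqr (Y / m - Y' / m'))
    = a * a * N + a' * a' * N' - 2 * (a * a') * P).
  { unfold a, a', N, N', P, Rsqr. field. lra. }
  assert (E2 : Rsqr (X - X') + Rsqr (Y - Y') = N + N' - 2 * P).
  { unfold N, N', P, Rsqr. ring. }
  rewrite E1, E2.
  assert (Ha : 0 < a) by (apply Rdiv_lt_0_compat; lra).
  assert (Ha' : 0 < a') by (apply Rdiv_lt_0_compat; lra).
  assert (am : a * m = mu) by (unfold a; field; lra).
  assert (am' : a' * m' = mu) by (unfold a'; field; lra).
  destruct C1 as [[C1 C1']|[C1 C1']]; destruct C2 as [[C2 C2']|[C2 C2']].
  - assert (a <= 1) by nra. assert (a' <= 1) by nra. rewrite C1 in am. rewrite C2 in am'.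
    replace (a * a * N + a' * a' * N' - 2 * (a * a') * P) with (a * a' * (N + N' - 2 * P)).
    + assert (a * a' <= 1) by nra. nra.
    + replace (a * a * N) with (a * mu) by (rewrite <- am; ring).
      replace (a' * a' * N') with (a' * mu) by (rewrite <- am'; ring).
      replace (a * a' * (N + N' - 2 * P)) with (a' * (a * N) + a * (a' * N') - 2 * (a * a') * P) by ring.
      rewrite am, am'. ring.
  - assert (a' = 1) by (unfold a'; rewrite C2; field; lra).
    rewrite H. rewrite C1 in am.
    assert (a <= 1) by nra.
    replace (a * a * N) with (a * mu) by (rewrite <- am; ring).
    assert (0 <= (1 - a) * (N + mu - 2 * P)) by (apply Rmult_le_pos; lra).
    nra.
  - assert (a = 1) by (unfold a; rewrite C1; field; lra).
    rewrite H. rewrite C2 in am'.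
    assert (a' <= 1) by nra.
    replace (a' * a' * N') with (a' * mu) by (rewrite <- am'; ring).
    assert (0 <= (1 - a') * (N' + mu - 2 * P)) by (apply Rmult_le_pos; lra).
    nra.
  - assert (a = 1) by (unfold a; rewrite C1; field; lra).
    assert (a' = 1) by (unfold a'; rewrite C2; field; lra).
    rewrite H, H0. lra.
Qed.

Lemma trunc_lipschitz (rho X Y X' Y' : R) : 0 < rho ->
  Rabs (X / cap rho X Y - X' / cap rho X' Y') <= / (rho * rho) * (Rabs (X - X') + Rabs (Y - Y')) /\
  Rabs (Y / cap rho X Y - Y' / cap rho X' Y') <= / (rho * rho) * (Rabs (X - X') + Rabs (Y - Y')).
Proof.
  intros Hr. pose proof (trunc_lipschitz_sq rho X Y X' Y' Hr) as H.
  assert (Hmu : 0 < rho * rho) by nra.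
  set (mu := rho * rho) in *.
  set (p := X / _ - _) in *. set (q := Y / _ - _) in *.
  assert (S : forall z, Rsqr z = Rabs z * Rabs z).
  { intros z. unfold Rsqr. rewrite <- Rabs_mult. symmetry; apply Rabs_pos_eq, Rle_0_sqr. }
  rewrite !S in H.
  pose proof (Rabs_pos p). pose proof (Rabs_pos q).
  pose proof (Rabs_pos (X - X')). pose proof (Rabs_pos (Y - Y')).
  set (A := Rabs (X - X')) in *. set (B := Rabs (Y - Y')) in *.
  set (p' := Rabs p) in *. set (q' := Rabs q) in *.
  assert (0 <= mu * p' /\ 0 <= mu * q') by (split; nra).
  assert (G : forall z, 0 <= mu * z -> (mu * z) * (mu * z) <= A * A + B * B -> z <= / mu * (A + B)).
  { intros z Hz Hz2. apply Rmult_le_reg_l with mu; [lra|].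
    replace (mu * (/ mu * (A + B))) with (A + B) by (field; lra).
    apply Rnot_lt_le; intro. assert (0 <= A * B) by nra. nra. }
  split; apply G; try tauto.
  - assert (0 <= (mu * q') * (mu * q')) by nra. nra.
  - assert (0 <= (mu * p') * (mu * p')) by nra. nra.
Qed.

Lemma trunc_flow (lam : R -> R) (k rho x0 y0 : R) :
  (forall s, continuity_pt lam s) -> 0 < rho ->
  exists x y : R -> R, x 0 = x0 /\ y 0 = y0 /\
  forall s, 0 <= s ->
    is_derive x s (k * (x s - lam s) / cap rho (x s - lam s) (y s)) /\
    is_derive y s (- (k * y s) / cap rho (x s - lam s) (y s)).
Proof.
  intros Hl Hr.
  assert (Hmu : 0 < / (rho * rho)) by (apply Rinv_0_lt_compat; nra).
  assert (Hcont : forall c x y z, (forall s, continuity_pt x s) -> (forall s, continuity_pt y s) ->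
    (forall s, continuity_pt z s) ->
    forall s, continuity_pt (fun s => c * z s / cap rho (x s - lam s) (y s)) s).
  { intros c x y z Hx Hy Hz s. apply (continuity_pt_quot (fun s => c * z s)).
    - ctn.
    - unfold cap. apply (continuity_pt_Rmax_const (fun u => (x u - lam u) * (x u - lam u) + y u * y u)). ctn.
    - pose proof (cap_pos rho (x s - lam s) (y s) Hr); lra. }
  assert (Hbd : forall c X Y Z, Z * Z <= X * X + Y * Y -> Rabs (c * Z / cap rho X Y) <= Rabs c * / rho).
  { intros c X Y Z HZ. unfold Rdiv. rewrite Rmult_assoc, Rabs_mult.
    apply Rmult_le_compat_l; [apply Rabs_pos|]. now apply trunc_bound. }
  assert (Hlip : forall c u v A B M, Rabs (u - v) <= / (rho * rho) * M -> 0 <= M ->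
     A = c * u -> B = c * v -> Rabs (A - B) <= (Rabs c + 1) * / (rho * rho) * M).
  { intros c u v A B M H HM -> ->. rewrite <- Rmult_minus_distr_l, Rabs_mult.
    pose proof (Rabs_pos c). pose proof (Rabs_pos (u - v)).
    assert (0 <= / (rho * rho) * M) by nra. nra. }
  apply (picard_lindelof
    (fun s X Y => k * (X - lam s) / cap rho (X - lam s) Y)
    (fun s X Y => - (k * Y) / cap rho (X - lam s) Y)
    (Rabs k * / rho) ((Rabs k + 1) * / (rho * rho))).
  - apply Rmult_lt_0_compat; [pose proof (Rabs_pos k); lra|exact Hmu].
  - intros s X Y. apply Hbd. nra.
  - intros s X Y. rewrite Ropp_mult_distr_l, <- (Rabs_Ropp k). apply Hbd.
    pose proof (mul_self_nonneg (X - lam s)). lra.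
  - intros s X Y X' Y'.
    destruct (trunc_lipschitz rho (X - lam s) Y (X' - lam s) Y' Hr) as [H _].
    replace (X - lam s - (X' - lam s)) with (X - X') in H by ring.
    apply (Hlip k _ _ _ _ _ H); [|unfold Rdiv; ring|unfold Rdiv; ring].
    pose proof (Rabs_pos (X - X')); pose proof (Rabs_pos (Y - Y')); lra.
  - intros s X Y X' Y'.
    destruct (trunc_lipschitz rho (X - lam s) Y (X' - lam s) Y' Hr) as [_ H].
    replace (X - lam s - (X' - lam s)) with (X - X') in H by ring.
    rewrite <- (Rabs_Ropp k).
    apply (Hlip (- k) _ _ _ _ _ H); [|unfold Rdiv; ring|unfold Rdiv; ring].
    pose proof (Rabs_pos (X - X')); pose proof (Rabs_pos (Y - Y')); lra.
  - intros x y Hx Hy s. apply (Hcont k x y (fun s => x s - lam s)); auto. intros; ctn.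
  - intros x y Hx Hy s.
    apply (continuity_pt_ext_all (fun s => (- k) * y s / cap rho (x s - lam s) (y s))).
    + intros; unfold Rdiv; ring.
    + now apply Hcont.
Qed.

Lemma sol_of_trunc (lam : R -> R) (k rho b : R) (x y : R -> R) :
  0 < rho ->
  (forall s, 0 <= s ->
    is_derive x s (k * (x s - lam s) / cap rho (x s - lam s) (y s)) /\
    is_derive y s (- (k * y s) / cap rho (x s - lam s) (y s))) ->
  (forall s, 0 <= s <= b -> rho * rho <= nsq lam x y s) ->
  sol lam k b x y.
Proof.
  intros Hr H HN. split; intros s Hs.
  - destruct (H s) as [H1 H2]; [lra|]. split; [|split].
    + eapply is_derive_continuity_pt; eassumption.
    + eapply is_derive_continuity_pt; eassumption.
    + specialize (HN s Hs). nra.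
  - destruct (H s) as [H1 H2]; [lra|]. specialize (HN s ltac:(lra)).
    unfold cap in H1, H2. unfold nsq in *. rewrite Rmax_left in H1, H2 by lra. now split.
Qed.

Lemma continuity_nsq (lam x y : R -> R) (s : R) :
  continuity_pt lam s -> continuity_pt x s -> continuity_pt y s -> continuity_pt (nsq lam x y) s.
Proof. intros. unfold nsq. ctn. Qed.

(** The backward flow raises the imaginary part, so a start at height y0 never comes closer than y0
    to the real driving point, and truncation at rho = y0 is inactive. *)
Lemma backward_flow (lam : R -> R) (b x0 y0 : R) :
  (forall s, continuity_pt lam s) -> 0 < y0 ->
  exists x y, sol lam (-2) b x y /\ x 0 = x0 /\ y 0 = y0 /\
    forall s, 0 <= s <= b -> y0 <= y s.
Proof.
  intros Hl Hy0.
  destruct (trunc_flow lam (-2) y0 x0 y0 Hl Hy0) as [x [y [Hx [Hy H]]]].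
  exists x, y.
  assert (Hmono : forall s, 0 <= s <= b -> y0 <= y s).
  { intros s Hs. cut (y0 - y s <= 0); [lra|].
    (* Where y < y0 and the capped denominator m is at least y0^2, the bound -2y/m <= 2(y0 - y)/y0^2
       holds for either sign of y; positivity of y comes out of the argument instead of going in. *)
    apply (barrier (fun s => y0 - y s) (fun s => - (- (-2 * y s) / cap y0 (x s - lam s) (y s)))
             0 b (2 / (y0 * y0))).
    - intros r Hr. assert (continuity_pt y r) by (destruct (H r ltac:(lra)) as [_ D]; exact (is_derive_continuity_pt y r _ D)). ctn.
    - intros r Hr. eapply is_derive_eq.
      + apply (is_derive_minus (fun _ => y0) y); [apply is_derive_const|apply (H r); lra].
      + unfold minus, plus, opp, zero; simpl; ring.
    - intros r Hr HF. pose proof (cap_pos y0 (x r - lam r) (y r) Hy0) as Hc.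
      assert (Hc2 : y0 * y0 <= cap y0 (x r - lam r) (y r)) by apply Rmax_r.
      set (m := cap _ _ _) in *.
      replace (- (- (-2 * y r) / m)) with (2 * (- y r) * / m) by (field; lra).
      replace (2 / (y0 * y0) * (y0 - y r)) with (2 * (y0 - y r) * / (y0 * y0)) by (field; lra).
      assert (0 < / m) by (now apply Rinv_0_lt_compat).
      assert (/ m <= / (y0 * y0)) by (apply Rinv_le_contravar; nra).
      nra.
    - simpl. rewrite Hy; lra.
    - exact Hs. }
  split; [|auto].
  apply (sol_of_trunc lam (-2) y0); auto.
  intros s Hs. specialize (Hmono s Hs). unfold nsq.
  pose proof (mul_self_nonneg (x s - lam s)).
  assert (y0 * y0 <= y s * y s) by nra. lra.
Qed.

Lemma displacement (f g : R -> R) (M b : R) :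
  (forall s, 0 <= s <= b -> continuity_pt f s) ->
  (forall s, 0 < s < b -> is_derive f s (g s)) ->
  (forall s, 0 < s < b -> Rabs (g s) <= M) ->
  forall s, 0 <= s <= b -> Rabs (f s - f 0) <= M * s.
Proof.
  intros Hc Hd Hg s Hs. destruct (Req_dec s 0) as [->|Hne].
  - rewrite Rminus_diag, Rabs_R0; lra.
  - destruct (mvt_open f g 0 s) as [c [Hc1 E]].
    + lra.
    + intros; apply Hc; lra.
    + intros; apply Hd; lra.
    + rewrite E, Rabs_mult, Rminus_0_r, (Rabs_pos_eq s) by lra.
      apply Rmult_le_compat_r; [lra|]. apply Hg; lra.
Qed.

(** Each component of the truncated velocity is at most 2/rho in modulus, so up to time b each
    coordinate moves by at most 2b/rho. A start that far outside the reach of the driving function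
    stays at distance rho from it, and the truncation is inactive. This bounds the hull and shows
    that g_b moves distant points little. *)
Lemma far_flow (lam : R -> R) (Lam rho b x0 y0 : R) :
  (forall s, continuity_pt lam s) -> 0 < rho -> 0 <= b ->
  (forall s, 0 <= s <= b -> Rabs (lam s) <= Lam) ->
  (Lam + rho + 2 * / rho * b <= Rabs x0 \/ rho + 2 * / rho * b <= y0) ->
  exists x y, sol lam 2 b x y /\ x 0 = x0 /\ y 0 = y0 /\
    Rabs (y b - y0) <= 2 * / rho * b.
Proof.
  intros Hl Hr Hb HL Hfar.
  destruct (trunc_flow lam 2 rho x0 y0 Hl Hr) as [x [y [Hx [Hy H]]]].
  exists x, y.
  assert (Hri : 0 < / rho) by (now apply Rinv_0_lt_compat).
  assert (Dx : forall s, 0 <= s <= b -> Rabs (x s - x0) <= 2 * / rho * s).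
  { rewrite <- Hx. apply (displacement x (fun s => 2 * (x s - lam s) / cap rho (x s - lam s) (y s))).
    - intros s Hs. destruct (H s ltac:(lra)) as [D _]. exact (is_derive_continuity_pt x s _ D).
    - intros s Hs. apply (H s); lra.
    - intros s Hs. unfold Rdiv. rewrite Rmult_assoc, Rabs_mult, (Rabs_pos_eq 2) by lra.
      apply Rmult_le_compat_l; [lra|]. apply trunc_bound; [assumption|].
      pose proof (mul_self_nonneg (y s)). lra. }
  assert (Dy : forall s, 0 <= s <= b -> Rabs (y s - y0) <= 2 * / rho * s).
  { rewrite <- Hy. apply (displacement y (fun s => - (2 * y s) / cap rho (x s - lam s) (y s))).
    - intros s Hs. destruct (H s ltac:(lra)) as [_ D]. exact (is_derive_continuity_pt y s _ D).
    - intros s Hs. apply (H s); lra.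
    - intros s Hs. unfold Rdiv. rewrite Ropp_mult_distr_l, Rmult_assoc, Rabs_mult.
      rewrite Rabs_Ropp, (Rabs_pos_eq 2) by lra.
      apply Rmult_le_compat_l; [lra|]. apply trunc_bound; [assumption|].
      pose proof (mul_self_nonneg (x s - lam s)). lra. }
  split; [|split; [exact Hx|split; [exact Hy|apply Dy; lra]]].
  apply (sol_of_trunc lam 2 rho); auto.
  intros s Hs. specialize (Dx s Hs). specialize (Dy s Hs). specialize (HL s Hs).
  assert (2 * / rho * s <= 2 * / rho * b) by (apply Rmult_le_compat_l; lra).
  unfold nsq. destruct Hfar as [Hf|Hf].
  - assert (rho <= Rabs (x s - lam s)).
    { replace x0 with (- (x s - x0) + (x s - lam s) + lam s) in Hf by ring.
      pose proof (Rabs_triang (- (x s - x0) + (x s - lam s)) (lam s)).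
      pose proof (Rabs_triang (- (x s - x0)) (x s - lam s)). rewrite Rabs_Ropp in *. lra. }
    pose proof (Rabs_mul_self (x s - lam s)).
    pose proof (mul_self_nonneg (y s)).
    assert (rho * rho <= Rabs (x s - lam s) * Rabs (x s - lam s)) by nra. lra.
  - apply Rabs_le_between in Dy. assert (rho <= y s) by lra.
    pose proof (mul_self_nonneg (x s - lam s)).
    assert (rho * rho <= y s * y s) by nra. lra.
Qed.

(** * Distance between two flow lines *)

Definition dsq (x1 y1 x2 y2 : R -> R) (s : R) : R :=
  (x1 s - x2 s) * (x1 s - x2 s) + (y1 s - y2 s) * (y1 s - y2 s).

(* With [u_i = h_i - lam], the squared distance satisfies (|h1-h2|^2)' = -2k |h1-h2|^2 Re(1/(u1 u2)). *)
Lemma dsq_derive (lam : R -> R) (k b : R) (x1 y1 x2 y2 : R -> R) (s : R) :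
  sol lam k b x1 y1 -> sol lam k b x2 y2 -> 0 < s < b ->
  is_derive (dsq x1 y1 x2 y2) s
   (- 2 * k * dsq x1 y1 x2 y2 s *
      (((x1 s - lam s) * (x2 s - lam s) - y1 s * y2 s) * / (nsq lam x1 y1 s * nsq lam x2 y2 s))).
Proof.
  intros [C1 D1] [C2 D2] Hs.
  destruct (C1 s) as [_ [_ N1]]; [lra|]. destruct (C2 s) as [_ [_ N2]]; [lra|].
  destruct (D1 s Hs) as [Dx1 Dy1]. destruct (D2 s Hs) as [Dx2 Dy2].
  unfold dsq. eapply is_derive_eq.
  - apply (is_derive_plus (fun s => (x1 s - x2 s) * (x1 s - x2 s)) (fun s => (y1 s - y2 s) * (y1 s - y2 s))).
    + apply (is_derive_sq (fun s => x1 s - x2 s)), (is_derive_minus x1 x2); eassumption.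
    + apply (is_derive_sq (fun s => y1 s - y2 s)), (is_derive_minus y1 y2); eassumption.
  - unfold minus, plus, opp; simpl. unfold nsq in *. field. lra.
Qed.

Lemma dsq_continuity (x1 y1 x2 y2 : R -> R) (s : R) :
  continuity_pt x1 s -> continuity_pt y1 s -> continuity_pt x2 s -> continuity_pt y2 s ->
  continuity_pt (dsq x1 y1 x2 y2) s.
Proof. intros. unfold dsq. ctn. Qed.

Lemma sol_continuity (lam : R -> R) (k b : R) (x y : R -> R) (s : R) :
  sol lam k b x y -> 0 <= s <= b -> continuity_pt x s /\ continuity_pt y s.
Proof. intros [H _] Hs. destruct (H s Hs) as [A [B _]]. now split. Qed.

(** With u_j = X_j + i Y_j this is |Re(u1 u2)| <= (|u1|^2 + |u2|^2)/2, divided by |u1|^2 |u2|^2. *)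
Lemma product_ratio_bound (X1 Y1 X2 Y2 m : R) : 0 < m ->
  m <= X1 * X1 + Y1 * Y1 -> m <= X2 * X2 + Y2 * Y2 ->
  Rabs ((X1 * X2 - Y1 * Y2) * / ((X1 * X1 + Y1 * Y1) * (X2 * X2 + Y2 * Y2))) <= / m.
Proof.
  intros Hm H1 H2.
  set (N1 := X1 * X1 + Y1 * Y1) in *. set (N2 := X2 * X2 + Y2 * Y2) in *.
  assert (HN : 0 < N1 * N2) by nra.
  rewrite Rabs_mult, (Rabs_pos_eq (/ _)) by (left; now apply Rinv_0_lt_compat).
  assert (Rabs (X1 * X2 - Y1 * Y2) <= (N1 + N2) / 2).
  { apply Rabs_le. unfold N1, N2. pose proof (mul_self_nonneg (X1 - X2)). pose proof (mul_self_nonneg (Y1 - Y2)).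
    pose proof (mul_self_nonneg (X1 + X2)). pose proof (mul_self_nonneg (Y1 + Y2)). split; lra. }
  apply Rmult_le_reg_r with (N1 * N2 * m); [nra|].
  replace (Rabs (X1 * X2 - Y1 * Y2) * / (N1 * N2) * (N1 * N2 * m))
    with (Rabs (X1 * X2 - Y1 * Y2) * m) by (field; split; nra).
  replace (/ m * (N1 * N2 * m)) with (N1 * N2) by (field; lra).
  assert ((N1 + N2) / 2 * m <= N1 * N2) by nra. nra.
Qed.

Lemma flow_dependence (lam : R -> R) (k b m : R) (x1 y1 x2 y2 : R -> R) :
  sol lam k b x1 y1 -> sol lam k b x2 y2 -> 0 < m ->
  (forall s, 0 < s < b -> m <= nsq lam x1 y1 s /\ m <= nsq lam x2 y2 s) ->
  forall s, 0 <= s <= b ->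
   dsq x1 y1 x2 y2 s <= dsq x1 y1 x2 y2 0 * exp (2 * Rabs k * / m * s).
Proof.
  intros S1 S2 Hm HN s Hs.
  set (C := 2 * Rabs k * / m).
  cut (dsq x1 y1 x2 y2 s - dsq x1 y1 x2 y2 0 * exp (C * s) <= 0); [lra|].
  apply (barrier (fun s => dsq x1 y1 x2 y2 s - dsq x1 y1 x2 y2 0 * exp (C * s))
    (fun s => - 2 * k * dsq x1 y1 x2 y2 s *
      (((x1 s - lam s) * (x2 s - lam s) - y1 s * y2 s) * / (nsq lam x1 y1 s * nsq lam x2 y2 s))
      - dsq x1 y1 x2 y2 0 * (C * exp (C * s))) 0 b C).
  - intros r Hr. destruct (sol_continuity _ _ _ _ _ r S1 Hr). destruct (sol_continuity _ _ _ _ _ r S2 Hr).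
    assert (continuity_pt (dsq x1 y1 x2 y2) r) by (now apply dsq_continuity).
    apply (continuity_pt_minus (dsq x1 y1 x2 y2)); [assumption|]. ctn.
  - intros r Hr. apply (is_derive_minus (dsq x1 y1 x2 y2) (fun s => dsq x1 y1 x2 y2 0 * exp (C * s))).
    + now apply (dsq_derive lam k b).
    + auto_derive; [exact I|ring].
  - intros r Hr _. destruct (HN r Hr) as [N1 N2].
    pose proof (product_ratio_bound _ _ _ _ m Hm N1 N2) as Hp. fold (nsq lam x1 y1 r) in Hp. fold (nsq lam x2 y2 r) in Hp.
    set (q := (_ - _) * / _) in *.
    assert (0 <= dsq x1 y1 x2 y2 r) by (unfold dsq; apply Rplus_le_le_0_compat; apply Rle_0_sqr).
    assert (- 2 * k * q <= C).
    { eapply Rle_trans; [apply Rle_abs|]. rewrite !Rabs_mult. unfold C.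
      replace (Rabs (-2)) with 2 by (rewrite Rabs_left; lra).
      apply Rmult_le_compat_l; [pose proof (Rabs_pos k); lra|exact Hp]. }
    nra.
  - rewrite Rmult_0_r, exp_0. lra.
  - exact Hs.
Qed.

Lemma nsq_min (lam : R -> R) (k b : R) (x y : R -> R) :
  (forall s, continuity_pt lam s) -> 0 <= b -> sol lam k b x y ->
  exists m, 0 < m /\ forall s, 0 <= s <= b -> m <= nsq lam x y s.
Proof.
  intros Hl Hb S.
  destruct (continuity_ab_min (nsq lam x y) 0 b Hb) as [s0 [Hmin Hs0]].
  { intros c Hc. destruct (sol_continuity _ _ _ _ _ c S Hc). apply continuity_nsq; auto. }
  exists (nsq lam x y s0). split; [apply S; exact Hs0|exact Hmin].
Qed.

Lemma flow_unique (lam : R -> R) (k b : R) (x1 y1 x2 y2 : R -> R) :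
  (forall s, continuity_pt lam s) -> sol lam k b x1 y1 -> sol lam k b x2 y2 ->
  x1 0 = x2 0 -> y1 0 = y2 0 ->
  forall s, 0 <= s <= b -> x1 s = x2 s /\ y1 s = y2 s.
Proof.
  intros Hl S1 S2 Ex Ey s Hs.
  destruct (nsq_min lam k b x1 y1 Hl ltac:(lra) S1) as [m1 [Hm1 H1]].
  destruct (nsq_min lam k b x2 y2 Hl ltac:(lra) S2) as [m2 [Hm2 H2]].
  pose proof (flow_dependence lam k b (Rmin m1 m2) x1 y1 x2 y2 S1 S2 (Rmin_glb_lt _ _ _ Hm1 Hm2)) as H.
  specialize (H ltac:(intros r Hr; split;
    [apply Rle_trans with m1; [apply Rmin_l|apply H1; lra]|apply Rle_trans with m2; [apply Rmin_r|apply H2; lra]]) s Hs).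
  replace (dsq x1 y1 x2 y2 0) with 0 in H by (unfold dsq; rewrite Ex, Ey; ring).
  rewrite Rmult_0_l in H. unfold dsq in H.
  pose proof (mul_self_nonneg (x1 s - x2 s)). pose proof (mul_self_nonneg (y1 s - y2 s)).
  split; apply Rminus_diag_uniq, Rsqr_0_uniq; unfold Rsqr; lra.
Qed.

(** * Survival in terms of flow lines; time reversal and time shift *)

Lemma Cnorm_le_add (z : Cplx) : Cnorm z <= Rabs (Re z) + Rabs (Im z).
Proof.
  unfold Cnorm. pose proof (Rabs_pos (Re z)). pose proof (Rabs_pos (Im z)).
  rewrite <- (sqrt_Rsqr (Rabs (Re z) + Rabs (Im z))) by lra.
  apply sqrt_le_1_alt. unfold Rsqr.
  assert (E1 : Rabs (Re z) * Rabs (Re z) = Re z * Re z) by apply Rabs_mul_self.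
  assert (E2 : Rabs (Im z) * Rabs (Im z) = Im z * Im z) by apply Rabs_mul_self.
  nra.
Qed.

Lemma Re_le_Cnorm (z : Cplx) : Rabs (Re z) <= Cnorm z.
Proof.
  unfold Cnorm. rewrite <- (sqrt_Rsqr_abs (Re z)). apply sqrt_le_1_alt. unfold Rsqr.
  pose proof (mul_self_nonneg (Im z)). lra.
Qed.

Lemma Im_le_Cnorm (z : Cplx) : Rabs (Im z) <= Cnorm z.
Proof.
  unfold Cnorm. rewrite <- (sqrt_Rsqr_abs (Im z)). apply sqrt_le_1_alt. unfold Rsqr.
  pose proof (mul_self_nonneg (Re z)). lra.
Qed.

(** Here [lam0] is the given driving function and [lam] a continuous extension of it; only their
    values on [0,t] are compared. *)
Lemma survives_of_sol (lam0 lam : R -> R) (t : R) (x y : R -> R) :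
  (forall s, continuity_pt lam s) -> (forall s, 0 <= s <= t -> lam0 s = lam s) ->
  sol lam 2 t x y -> survives lam0 t (x 0, y 0).
Proof.
  intros Hl E S. exists (fun s => (x s, y s)). split; [reflexivity|].
  intros s Hs. rewrite (E s Hs). split.
  - intros Heq. injection Heq as Ex Ey. destruct S as [S _]. destruct (S s Hs) as [_ [_ N]].
    unfold nsq in N. rewrite Ex, Ey in N. lra.
  - assert (Cn : forall r, 0 <= r <= t -> continuity_pt (nsq lam x y) r).
    { intros r Hr. destruct (sol_continuity _ _ _ _ _ r S Hr). now apply continuity_nsq. }
    assert (D1 : rderiv_within 0 t x (2 * (x s - lam s) / nsq lam x y s) s).
    { apply (derive_within_of_interior x (fun s => 2 * (x s - lam s) / nsq lam x y s)); auto.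
      - intros r Hr. apply (sol_continuity _ _ _ _ _ r S Hr).
      - intros r Hr. apply S, Hr.
      - intros r Hr. destruct (sol_continuity _ _ _ _ _ r S Hr).
        apply (continuity_pt_quot (fun s => 2 * (x s - lam s))); [ctn|auto|].
        destruct S as [S _]. destruct (S r Hr) as [_ [_ N]]. lra. }
    assert (D2 : rderiv_within 0 t y (- (2 * y s) / nsq lam x y s) s).
    { apply (derive_within_of_interior y (fun s => - (2 * y s) / nsq lam x y s)); auto.
      - intros r Hr. apply (sol_continuity _ _ _ _ _ r S Hr).
      - intros r Hr. apply S, Hr.
      - intros r Hr. destruct (sol_continuity _ _ _ _ _ r S Hr).
        apply (continuity_pt_quot (fun s => - (2 * y s))); [ctn|auto|].
        destruct S as [S _]. destruct (S r Hr) as [_ [_ N]]. lra. }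
    intros eps He.
    destruct (D1 (eps / 2)) as [d1 [Hd1 H1]]; [lra|].
    destruct (D2 (eps / 2)) as [d2 [Hd2 H2]]; [lra|].
    exists (Rmin d1 d2). split; [now apply Rmin_glb_lt|].
    intros u Hu Hne Hc.
    specialize (H1 u Hu Hne (Rlt_le_trans _ _ _ Hc (Rmin_l _ _))).
    specialize (H2 u Hu Hne (Rlt_le_trans _ _ _ Hc (Rmin_r _ _))).
    eapply Rle_lt_trans; [apply Cnorm_le_add|].
    unfold nsq in *. simpl. rewrite !Rminus_0_r. lra.
Qed.

Lemma sol_of_survives (lam0 lam : R -> R) (t : R) (z : Cplx) : 0 <= t ->
  (forall s, 0 <= s <= t -> lam0 s = lam s) -> survives lam0 t z ->
  exists x y, sol lam 2 t x y /\ x 0 = Re z /\ y 0 = Im z.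
Proof.
  intros Ht E [h [H0 H]].
  (* Outside [0,t] nothing is known about [h]; freezing it there gives two-sided continuity at both
     ends. *)
  exists (fun s => Re (h (clamp 0 t s))), (fun s => Im (h (clamp 0 t s))).
  assert (D1 : forall s, 0 <= s <= t ->
    rderiv_within 0 t (fun s => Re (h (clamp 0 t s))) (Re (two_div (Csub (h s) (RtoC (lam0 s))))) s).
  { intros s Hs eps He. destruct (H s Hs) as [_ D]. destruct (D eps He) as [d [Hd D']].
    exists d; split; [exact Hd|]. intros u Hu Hne Hc. rewrite !clamp_id by assumption.
    eapply Rle_lt_trans; [|apply (D' u Hu Hne Hc)]. eapply Rle_trans; [|apply Re_le_Cnorm]. right; reflexivity. }
  assert (D2 : forall s, 0 <= s <= t ->
    rderiv_within 0 t (fun s => Im (h (clamp 0 t s))) (Im (two_div (Csub (h s) (RtoC (lam0 s))))) s).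
  { intros s Hs eps He. destruct (H s Hs) as [_ D]. destruct (D eps He) as [d [Hd D']].
    exists d; split; [exact Hd|]. intros u Hu Hne Hc. rewrite !clamp_id by assumption.
    eapply Rle_lt_trans; [|apply (D' u Hu Hne Hc)]. eapply Rle_trans; [|apply Im_le_Cnorm]. right; reflexivity. }
  split; [split|].
  - intros s Hs. split; [|split].
    + apply (continuity_pt_ext_all (fun r => (fun v => Re (h (clamp 0 t v))) (clamp 0 t r))).
      { intros r. f_equal. f_equal. apply clamp_id, clamp_in, Ht. }
      apply (clamp_continuous (fun v => Re (h (clamp 0 t v))) 0 t Ht).
      intros r Hr. now apply (rcont_of_within _ 0 t _ r (D1 r Hr)).
    + apply (continuity_pt_ext_all (fun r => (fun v => Im (h (clamp 0 t v))) (clamp 0 t r))).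
      { intros r. f_equal. f_equal. apply clamp_id, clamp_in, Ht. }
      apply (clamp_continuous (fun v => Im (h (clamp 0 t v))) 0 t Ht).
      intros r Hr. now apply (rcont_of_within _ 0 t _ r (D2 r Hr)).
    + unfold nsq. rewrite clamp_id by assumption. destruct (H s Hs) as [Hne _]. rewrite (E s Hs) in Hne.
      pose proof (mul_self_nonneg (Re (h s) - lam s)). pose proof (mul_self_nonneg (Im (h s))).
      apply Rnot_le_lt; intro Hle. apply Hne. unfold RtoC.
      assert (A : Re (h s) - lam s = 0) by (apply Rsqr_0_uniq; unfold Rsqr; lra).
      assert (B : Im (h s) = 0) by (apply Rsqr_0_uniq; unfold Rsqr; lra).
      apply Rminus_diag_uniq in A. unfold Re, Im in *. now rewrite <- A, <- B, <- surjective_pairing.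
  - intros s Hs. assert (Hs' : 0 <= s <= t) by lra.
    specialize (D1 s Hs'). specialize (D2 s Hs'). rewrite (E s Hs') in D1, D2.
    apply (is_derive_of_within _ 0 t _ s Hs) in D1. apply (is_derive_of_within _ 0 t _ s Hs) in D2.
    unfold nsq. rewrite clamp_id by assumption. split.
    + eapply is_derive_eq; [exact D1|]. simpl. now rewrite Rminus_0_r.
    + eapply is_derive_eq; [exact D2|]. simpl. now rewrite Rminus_0_r.
  - rewrite clamp_id by lra. now rewrite H0.
Qed.

Lemma is_derive_affine (f : R -> R) (c e s d : R) :
  is_derive f (c + e * s) d -> is_derive (fun s => f (c + e * s)) s (e * d).
Proof.
  intros H. apply (is_derive_comp f (fun s => c + e * s) s d e H).
  auto_derive; [exact I|ring].
Qed.

Lemma continuity_pt_affine (f : R -> R) (c e s : R) :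
  continuity_pt f (c + e * s) -> continuity_pt (fun s => f (c + e * s)) s.
Proof.
  intros H. apply (continuity_pt_comp (fun s => c + e * s) f); [ctn|exact H].
Qed.

Lemma sol_affine (lam lam' : R -> R) (k b b' c e : R) (x y : R -> R) :
  sol lam k b x y -> e * e = 1 ->
  (forall s, 0 <= s <= b' -> 0 <= c + e * s <= b) ->
  (forall s, 0 < s < b' -> 0 < c + e * s < b) ->
  (forall s, 0 <= s <= b' -> lam' s = lam (c + e * s)) ->
  sol lam' (e * k) b' (fun s => x (c + e * s)) (fun s => y (c + e * s)).
Proof.
  intros [S1 S2] He H1 H2 E. split; intros s Hs.
  - destruct (S1 _ (H1 s Hs)) as [A [B N]]. unfold nsq in *. rewrite (E s Hs).
    split; [|split]; [| |exact N]; now apply continuity_pt_affine.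
  - destruct (S2 _ (H2 s Hs)) as [A B]. unfold nsq in *. rewrite (E s) by lra.
    split; (eapply is_derive_eq; [apply is_derive_affine; eassumption|]); unfold Rdiv; ring.
Qed.

Lemma sol_reverse (lam lam' : R -> R) (k k' b : R) (x y : R -> R) :
  sol lam k b x y -> k' = - k -> (forall s, 0 <= s <= b -> lam' s = lam (b - s)) ->
  sol lam' k' b (fun s => x (b + -1 * s)) (fun s => y (b + -1 * s)).
Proof.
  intros S -> E. replace (- k) with (-1 * k) by ring.
  apply (sol_affine lam lam' k b b b (-1) x y S); try (intros; lra).
  intros s Hs. rewrite (E s Hs). f_equal; ring.
Qed.

Lemma sol_shift (lam lam' : R -> R) (k b b' c : R) (x y : R -> R) :
  sol lam k b x y -> 0 <= c -> c + b' <= b -> (forall s, 0 <= s <= b' -> lam' s = lam (c + s)) ->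
  sol lam' k b' (fun s => x (c + 1 * s)) (fun s => y (c + 1 * s)).
Proof.
  intros S Hc Hb E. replace k with (1 * k) by ring.
  apply (sol_affine lam lam' k b b' c 1 x y S); try (intros; lra).
  intros s Hs. rewrite (E s Hs). f_equal; ring.
Qed.

Lemma sol_restrict (lam : R -> R) (k b b' : R) (x y : R -> R) :
  sol lam k b x y -> b' <= b -> sol lam k b' x y.
Proof.
  intros [S1 S2] Hb. split; intros s Hs; [apply S1|apply S2]; lra.
Qed.

(* [L] is the time-reversed driving function; its 1/2-Hölder constant at 0 is at most 1/4. *)
Lemma cone_estimates (L : R -> R) (b y0 : R) (x y : R -> R) :
  (forall s, continuity_pt L s) ->
  (forall s, 0 <= s <= b -> (L s - L 0) * (L s - L 0) <= s / 16) ->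
  0 < y0 -> sol L (-2) b x y -> x 0 = L 0 -> y 0 = y0 ->
  (forall s, 0 <= s <= b -> y0 <= y s) ->
  forall s, 0 <= s <= b ->
    (x s - L 0) * (x s - L 0) <= s / 16 /\ (x s - L s) * (x s - L s) <= s / 4 /\
    15 / 4 * s <= y s * y s /\ y s * y s <= y0 * y0 + 4 * s.
Proof.
  intros Hc HL Hy0 S Ex Ey Hy.
  assert (N0 : forall s, 0 <= s <= b -> 0 < nsq L x y s) by (intros s Hs; apply S, Hs).
  assert (B1 : forall s, 0 <= s <= b -> (x s - L 0) * (x s - L 0) <= s / 16).
  { intros s Hs. cut ((x s - L 0) * (x s - L 0) - s * / 16 <= 0); [lra|].
    (* Where |x - L 0| exceeds sqrt(s)/4 it also exceeds |L s - L 0|. Then x - L 0 and x - L s have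
       the same sign, and the backward flow pulls x towards L 0. *)
    apply (barrier (fun s => (x s - L 0) * (x s - L 0) - s * / 16)
      (fun s => 2 * (x s - L 0) * (-2 * (x s - L s) / nsq L x y s) - / 16) 0 b 0).
    - intros r Hr. destruct (sol_continuity _ _ _ _ _ r S Hr). ctn.
    - intros r Hr. destruct S as [_ S]. destruct (S r Hr) as [D _].
      apply (is_derive_minus (fun s => (x s - L 0) * (x s - L 0)) (fun s => s * / 16)).
      + apply (is_derive_sq (fun s => x s - L 0)).
        eapply is_derive_eq; [apply (is_derive_minus x (fun _ => L 0)); [exact D|apply is_derive_const]|].
        unfold minus, plus, opp, zero; simpl; ring.
      + auto_derive; [exact I|ring].
    - intros r Hr HF. specialize (N0 r ltac:(lra)). specialize (HL r ltac:(lra)).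
      assert (0 <= (x r - L 0) * (x r - L r)).
      { pose proof (mul_self_nonneg (x r - L r)) as Q. nra. }
      replace (2 * (x r - L 0) * (-2 * (x r - L r) / nsq L x y r))
        with (- 4 * (((x r - L 0) * (x r - L r)) * / nsq L x y r)) by (field; lra).
      assert (0 <= (x r - L 0) * (x r - L r) * / nsq L x y r).
      { apply Rmult_le_pos; [assumption|left; now apply Rinv_0_lt_compat]. }
      lra.
    - simpl. rewrite Ex. lra.
    - exact Hs. }
  assert (B2 : forall s, 0 <= s <= b -> (x s - L s) * (x s - L s) <= s / 4).
  { intros s Hs. specialize (B1 s Hs). specialize (HL s Hs).
    pose proof (mul_self_nonneg ((x s - L 0) + (L s - L 0))) as Q. nra. }
  assert (Dy : forall r, 0 < r < b -> is_derive (fun s => y s * y s) r (4 * (y r * y r) / nsq L x y r)).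
  { intros r Hr. destruct S as [_ S]. destruct (S r Hr) as [_ D].
    eapply is_derive_eq; [apply is_derive_sq, D|]. unfold Rdiv; ring. }
  assert (Cy : forall r, 0 <= r <= b -> continuity_pt (fun s => y s * y s) r).
  { intros r Hr. destruct (sol_continuity _ _ _ _ _ r S Hr). ctn. }
  intros s Hs. split; [auto|split; [auto|split]].
  - cut (15 / 4 * s - y s * y s <= 0); [lra|].
    (* With q = y^2 and X = x - L s the derivative is (15 X^2 - q) / (4 (X^2 + q)). Since X^2 <=
       s/4, its numerator is at most 15 s/4 - q, the compared function itself; this self-consistency
       is the origin of 15/4. *)
    apply (barrier (fun s => 15 / 4 * s - y s * y s)
      (fun s => 15 / 4 - 4 * (y s * y s) / nsq L x y s) 0 b (/ (4 * (y0 * y0)))).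
    + intros r Hr. apply (continuity_pt_minus (fun s => 15 / 4 * s) (fun s => y s * y s)); [ctn|auto].
    + intros r Hr. apply (is_derive_minus (fun s => 15 / 4 * s) (fun s => y s * y s)); [|auto].
      auto_derive; [exact I|ring].
    + intros r Hr HF. specialize (B2 r ltac:(lra)). specialize (N0 r ltac:(lra)).
      specialize (Hy r ltac:(lra)). unfold nsq in *.
      set (X := x r - L r) in *. set (q := y r * y r) in *.
      assert (Hq : y0 * y0 <= q) by (unfold q; nra).
      assert (Hq0 : 0 < y0 * y0) by nra.
      apply Rle_trans with ((15 / 4 * r - q) * / (4 * (X * X + q))).
      * apply Rmult_le_reg_r with (4 * (X * X + q)); [lra|].
        replace ((15 / 4 * r - q) * / (4 * (X * X + q)) * (4 * (X * X + q))) with (15 / 4 * r - q) by (field; lra).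
        replace ((15 / 4 - 4 * q / (X * X + q)) * (4 * (X * X + q))) with (15 * (X * X + q) - 16 * q) by (field; lra).
        lra.
      * rewrite Rmult_comm. apply Rmult_le_compat_r; [lra|].
        apply Rinv_le_contravar; [lra|]. pose proof (mul_self_nonneg X) as Q. lra.
    + simpl. rewrite Ey. nra.
    + exact Hs.
  - cut (y s * y s - (y0 * y0 + 4 * s) <= 0); [lra|].
    apply (barrier (fun s => y s * y s - (y0 * y0 + 4 * s))
      (fun s => 4 * (y s * y s) / nsq L x y s - 4) 0 b 0).
    + intros r Hr. apply (continuity_pt_minus (fun s => y s * y s)); [auto|ctn].
    + intros r Hr. apply (is_derive_minus (fun s => y s * y s) (fun s => y0 * y0 + 4 * s)); [auto|].
      auto_derive; [exact I|ring].
    + intros r Hr HF. specialize (N0 r ltac:(lra)).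
      rewrite Rmult_0_l. cut (4 * (y r * y r) / nsq L x y r <= 4); [lra|].
      apply Rmult_le_reg_r with (nsq L x y r); [lra|].
      replace (4 * (y r * y r) / nsq L x y r * nsq L x y r) with (4 * (y r * y r)) by (field; lra).
      unfold nsq. pose proof (mul_self_nonneg (x r - L r)) as Q. lra.
    + simpl. rewrite Ey. lra.
    + exact Hs.
Qed.

(** Regularised start of the backward flow: height e above the driving point instead of on it, where
    the field is singular. *)
Definition seed (L : R -> R) (b e : R) (x y : R -> R) : Prop :=
  sol L (-2) b x y /\ x 0 = L 0 /\ y 0 = e /\ forall s, 0 <= s <= b -> e <= y s.

(* In the cone [|Re u| <= Im u] one has Re(1/(u1 u2)) <= 0, so the backward flow contracts. *)
Lemma seed_contraction (L : R -> R) (b e1 e2 : R) (x1 y1 x2 y2 : R -> R) :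
  (forall s, continuity_pt L s) ->
  (forall s, 0 <= s <= b -> (L s - L 0) * (L s - L 0) <= s / 16) ->
  0 < e1 -> 0 < e2 -> seed L b e1 x1 y1 -> seed L b e2 x2 y2 ->
  forall s, 0 <= s <= b -> dsq x1 y1 x2 y2 s <= (e1 - e2) * (e1 - e2).
Proof.
  intros Hc HL He1 He2 [S1 [Ex1 [Ey1 M1]]] [S2 [Ex2 [Ey2 M2]]] s Hs.
  pose proof (cone_estimates L b e1 x1 y1 Hc HL He1 S1 Ex1 Ey1 M1) as K1.
  pose proof (cone_estimates L b e2 x2 y2 Hc HL He2 S2 Ex2 Ey2 M2) as K2.
  cut (dsq x1 y1 x2 y2 s - (e1 - e2) * (e1 - e2) <= 0); [lra|].
  apply (barrier (fun s => dsq x1 y1 x2 y2 s - (e1 - e2) * (e1 - e2))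
   (fun s => - 2 * (-2) * dsq x1 y1 x2 y2 s *
      (((x1 s - L s) * (x2 s - L s) - y1 s * y2 s) * / (nsq L x1 y1 s * nsq L x2 y2 s))) 0 b 0).
  - intros r Hr. destruct (sol_continuity _ _ _ _ _ r S1 Hr). destruct (sol_continuity _ _ _ _ _ r S2 Hr).
    assert (continuity_pt (dsq x1 y1 x2 y2) r) by (now apply dsq_continuity).
    apply (continuity_pt_minus (dsq x1 y1 x2 y2)); [assumption|]. ctn.
  - intros r Hr. eapply is_derive_eq.
    + apply (is_derive_minus (dsq x1 y1 x2 y2) (fun s => (e1 - e2) * (e1 - e2))).
      * apply (dsq_derive L (-2) b x1 y1 x2 y2 r S1 S2 Hr).
      * apply is_derive_const.
    + unfold minus, plus, opp, zero; simpl; ring.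
  - intros r Hr _. rewrite Rmult_0_l.
    destruct (K1 r ltac:(lra)) as [_ [A1 [B1 _]]]. destruct (K2 r ltac:(lra)) as [_ [A2 [B2 _]]].
    specialize (M1 r ltac:(lra)). specialize (M2 r ltac:(lra)).
    assert (N1 : 0 < nsq L x1 y1 r) by (apply S1; lra).
    assert (N2 : 0 < nsq L x2 y2 r) by (apply S2; lra).
    assert (Hd : 0 <= dsq x1 y1 x2 y2 r) by (unfold dsq; apply Rplus_le_le_0_compat; apply Rle_0_sqr).
    assert (Hi : 0 < / (nsq L x1 y1 r * nsq L x2 y2 r)) by (apply Rinv_0_lt_compat; now apply Rmult_lt_0_compat).
    assert (P1 : (x1 r - L r) * (x2 r - L r) <= r / 4).
    { pose proof (mul_self_nonneg ((x1 r - L r) - (x2 r - L r))) as Q. nra. }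
    assert (P2 : r / 4 <= y1 r * y2 r).
    { apply Rnot_lt_le; intro Hlt. assert (0 < y1 r * y2 r) by nra.
      assert ((y1 r * y2 r) * (y1 r * y2 r) < (r / 4) * (r / 4)) by nra.
      assert ((15 / 4 * r) * (15 / 4 * r) <= (y1 r * y1 r) * (y2 r * y2 r)) by (apply Rmult_le_compat; lra).
      nra. }
    set (i := / _) in *. set (p := _ - y1 r * y2 r) in *. assert (Hp : p <= 0) by (unfold p; lra).
    assert (p * i <= 0) by nra. nra.
  - unfold dsq. rewrite Ex1, Ex2, Ey1, Ey2. lra.
  - exact Hs.
Qed.

(** * Tips *)

Lemma le_of_half_pow (a b M : R) : (forall k, a <= b + M * (/ 2) ^ k) -> a <= b.
Proof.
  intros H. apply le_epsilon. intros eps He.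
  destruct (half_pow_small M eps He) as [k Hk]. specialize (H k). lra.
Qed.

Lemma eq_of_half_pow (a b M : R) : (forall k, Rabs (a - b) <= M * (/ 2) ^ k) -> a = b.
Proof.
  intros H. apply Rminus_diag_uniq.
  assert (Rabs (a - b) <= 0).
  { apply (le_of_half_pow _ _ M). intros k. rewrite Rplus_0_l. apply H. }
  destruct (Req_dec (a - b) 0) as [E|E]; [exact E|]. apply Rabs_pos_lt in E. lra.
Qed.

Lemma abs_le_of_sq (a b : R) : 0 <= b -> a * a <= b * b -> Rabs a <= b.
Proof.
  intros Hb H. apply Rsqr_le_abs_0 in H. now rewrite (Rabs_pos_eq b) in H.
Qed.

(** Stands for p + iq = g_t^{-1}(lam(t)) without boundary values of conformal maps. Run backwards in
    time, the seeds show that p + iq is a limit of points that survive up to t; the next two clauses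
    say that it is itself swallowed exactly at t. The bound q^2 <= 4t serves to separate the curve
    near time 0 from a tip. *)
Definition is_tip (lam : R -> R) (t p q : R) : Prop :=
  (forall k, exists x y, seed (fun s => lam (t - s)) t ((/ 2) ^ k) x y /\
     Rabs (x t - p) <= 2 * (/ 2) ^ k /\ Rabs (y t - q) <= 2 * (/ 2) ^ k) /\
  (forall s, 0 <= s < t -> exists x y, sol lam 2 s x y /\ x 0 = p /\ y 0 = q) /\
  (~ exists x y, sol lam 2 t x y /\ x 0 = p /\ y 0 = q) /\
  0 < q /\ q * q <= 4 * t.

Lemma tip_exists (lam : R -> R) (t : R) :
  (forall s, continuity_pt lam s) -> 0 < t ->
  (forall s, 0 <= s <= t -> (lam (t - s) - lam (t - 0)) * (lam (t - s) - lam (t - 0)) <= s / 16) ->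
  exists p q, is_tip lam t p q.
Proof.
  intros Hl Ht HH. set (L := fun s => lam (t - s)).
  assert (HLc : forall s, continuity_pt L s).
  { intros s. apply (continuity_pt_comp (fun s => t - s) lam); [ctn|apply Hl]. }
  assert (Hpos : forall k, 0 < (/ 2) ^ k) by (intros; apply pow_lt; lra).
  assert (Hex : forall k, exists f : (R -> R) * (R -> R), seed L t ((/ 2) ^ k) (fst f) (snd f)).
  { intros k. destruct (backward_flow L t (L 0) ((/ 2) ^ k) HLc (Hpos k)) as [x [y H]].
    exists (x, y). exact H. }
  set (f := fun k => proj1_sig (constructive_indefinite_description _ (Hex k))).
  assert (Hf : forall k, seed L t ((/ 2) ^ k) (fst (f k)) (snd (f k))).
  { intros k. apply (proj2_sig (constructive_indefinite_description _ (Hex k))). }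
  clearbody f. clear Hex.
  assert (Hd : forall k s, 0 <= s <= t ->
     Rabs (fst (f (S k)) s - fst (f k) s) <= 1 * (/ 2) ^ k /\ Rabs (snd (f (S k)) s - snd (f k) s) <= 1 * (/ 2) ^ k).
  { intros k s Hs.
    pose proof (seed_contraction L t _ _ _ _ _ _ HLc HH (Hpos (S k)) (Hpos k) (Hf (S k)) (Hf k) s Hs) as H.
    unfold dsq in H. simpl in H. specialize (Hpos k).
    pose proof (mul_self_nonneg (fst (f (S k)) s - fst (f k) s)) as Q1.
    pose proof (mul_self_nonneg (snd (f (S k)) s - snd (f k) s)) as Q2.
    split; apply abs_le_of_sq; nra. }
  set (X := fun s => real (Lim_seq (fun k => fst (f k) s))).
  set (Y := fun s => real (Lim_seq (fun k => snd (f k) s))).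
  assert (HX : forall k s, 0 <= s <= t -> Rabs (fst (f k) s - X s) <= 2 * 1 * (/ 2) ^ k).
  { intros k s Hs. apply (geometric_limit (fun k => fst (f k) s)). intros j. now apply Hd. }
  assert (HY : forall k s, 0 <= s <= t -> Rabs (snd (f k) s - Y s) <= 2 * 1 * (/ 2) ^ k).
  { intros k s Hs. apply (geometric_limit (fun k => snd (f k) s)). intros j. now apply Hd. }
  assert (K : forall k s, 0 <= s <= t ->
    (fst (f k) s - L s) * (fst (f k) s - L s) <= s / 4 /\
    15 / 4 * s <= snd (f k) s * snd (f k) s /\ snd (f k) s * snd (f k) s <= (/ 2) ^ k * (/ 2) ^ k + 4 * s /\ 0 < snd (f k) s).
  { intros k s Hs. destruct (Hf k) as [S [Ex [Ey M]]].
    pose proof (cone_estimates L t _ _ _ HLc HH (Hpos k) S Ex Ey M s Hs) as H.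
    specialize (M s Hs). specialize (Hpos k). repeat split; try apply H. lra. }
  assert (Hle1 : forall k, (/ 2) ^ k <= 1).
  { intros k. rewrite <- (pow1 k). apply pow_incr. lra. }
  assert (KX : forall s, 0 <= s <= t -> (X s - L s) * (X s - L s) <= s / 4 /\ 15 / 4 * s <= Y s * Y s /\
     Y s * Y s <= 4 * s /\ 0 <= Y s).
  { intros s Hs. assert (Y0 : 0 <= Y s).
    { apply (le_of_half_pow _ _ 2). intros k. specialize (HY k s Hs). apply Rabs_le_between in HY.
      destruct (K k s Hs) as [_ [_ [_ P]]]. lra. }
    split; [|split; [|split; [|exact Y0]]].
    - apply (le_of_half_pow _ _ (4 * (Rabs (X s - L s) + 2) + 4)). intros k.
      specialize (HX k s Hs). destruct (K k s Hs) as [P _]. specialize (Hpos k). specialize (Hle1 k).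
      set (a := fst (f k) s) in *. set (e := (/ 2) ^ k) in *.
      apply Rabs_le_between in HX.
      pose proof (Rle_abs (X s - L s)). pose proof (Rle_abs (- (X s - L s))). rewrite Rabs_Ropp in *.
      set (A := Rabs (X s - L s)) in *.
      replace (X s - L s) with ((a - L s) - (a - X s)) by ring.
      set (v := a - X s) in *. set (u := a - L s) in *.
      assert (u = X s - L s + v) by (unfold u, v; ring).
      assert (0 <= A) by (unfold A; apply Rabs_pos).
      assert (- (A + 2) <= u <= A + 2) by lra.
      assert (- (2 * u * v) <= 4 * (A + 2) * e) by nra.
      assert (v * v <= 4 * e) by nra. nra.
    - apply (le_of_half_pow _ _ (4 * (Y s + 2) + 4)). intros k.
      specialize (HY k s Hs). destruct (K k s Hs) as [_ [P1 [P2 P3]]]. specialize (Hpos k). specialize (Hle1 k).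
      apply Rabs_le_between in HY.
      set (a := snd (f k) s) in *. set (e := (/ 2) ^ k) in *.
      assert (a * a <= (Y s + 2 * e) * (Y s + 2 * e)) by nra. nra.
    - apply (le_of_half_pow _ _ (4 * (Y s + 4) + 4)). intros k.
      specialize (HY k s Hs). destruct (K k s Hs) as [_ [P1 [P2 P3]]]. specialize (Hpos k). specialize (Hle1 k).
      apply Rabs_le_between in HY.
      set (a := snd (f k) s) in *. set (e := (/ 2) ^ k) in *.
      assert (Y s * Y s <= (a + 2 * e) * (a + 2 * e)) by nra.
      assert (a <= Y s + 2) by lra. assert (e * e <= e) by nra. nra. }
  (* From any time s1 > 0 on, the limit of the seeds has positive height and is a genuine backward
     solution. Reversed, it is the forward flow line of the tip up to time t - s1. *)
  assert (Bk : forall s1, 0 < s1 <= t -> exists x y, sol lam 2 (t - s1) x y /\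
     x 0 = X t /\ y 0 = Y t /\ x (t - s1) = X s1 /\ y (t - s1) = Y s1).
  { intros s1 Hs1. destruct (KX s1 ltac:(lra)) as [_ [Y1 [_ Y2]]].
    assert (Hy1 : 0 < Y s1) by nra.
    set (L1 := fun s => L (s1 + 1 * s)).
    assert (HL1 : forall s, continuity_pt L1 s) by (intros; now apply continuity_pt_affine).
    destruct (backward_flow L1 (t - s1) (X s1) (Y s1) HL1 Hy1) as [x [y [S [Ex [Ey M]]]]].
    (* After time s1 the squared distance to the driving point is at least 15 s1/4 for every seed
       and for the restarted flow, so the Gronwall constant does not depend on k. *)
    assert (Heq : forall s, 0 <= s <= t - s1 -> x s = X (s1 + 1 * s) /\ y s = Y (s1 + 1 * s)).
    { intros s Hs.
      assert (Hc : exists M0, forall k, Rabs (fst (f k) (s1 + 1 * s) - x s) <= M0 * (/ 2) ^ k /\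
          Rabs (snd (f k) (s1 + 1 * s) - y s) <= M0 * (/ 2) ^ k).
      { exists (3 * exp (2 * Rabs (-2) * / (15 / 4 * s1) * s)). intros k.
        destruct (Hf k) as [Sk _].
        assert (Sk' : sol L1 (-2) (t - s1) (fun s => fst (f k) (s1 + 1 * s)) (fun s => snd (f k) (s1 + 1 * s))).
        { apply (sol_shift L L1 (-2) t (t - s1) s1 _ _ Sk); try lra. intros; unfold L1; f_equal; ring. }
        pose proof (flow_dependence L1 (-2) (t - s1) (15 / 4 * s1) _ _ _ _ Sk' S ltac:(lra)) as G.
        specialize (G ltac:(intros r Hr; split; unfold nsq;
          [ destruct (K k (s1 + 1 * r) ltac:(lra)) as [_ [P _]];
            pose proof (mul_self_nonneg (fst (f k) (s1 + 1 * r) - L1 r)) as Q; lra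
          | specialize (M r ltac:(lra)); pose proof (mul_self_nonneg (x r - L1 r)) as Q; assert (Y s1 * Y s1 <= y r * y r) by nra; lra ]) s Hs).
        set (E := 2 * Rabs (-2) * / (15 / 4 * s1) * s) in *.
        assert (HE : 1 <= exp E).
        { rewrite <- exp_0. destruct (Req_dec E 0) as [->|]; [lra|].
          left. apply exp_increasing. assert (0 <= E); [|lra].
          unfold E. repeat apply Rmult_le_pos; try lra; [apply Rabs_pos|left; apply Rinv_0_lt_compat; lra]. }
        unfold dsq in G. rewrite Rmult_0_r, Rplus_0_r, Ex, Ey in G.
        specialize (HX k s1 ltac:(lra)). specialize (HY k s1 ltac:(lra)).
        apply Rabs_le_between in HX. apply Rabs_le_between in HY. specialize (Hpos k).
        set (e := (/ 2) ^ k) in *.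
        set (a := fst (f k) s1 - X s1) in *. set (b := snd (f k) s1 - Y s1) in *.
        assert (a * a <= 4 * (e * e)) by nra. assert (b * b <= 4 * (e * e)) by nra.
        set (u := fst (f k) (s1 + 1 * s) - x s) in *. set (v := snd (f k) (s1 + 1 * s) - y s) in *.
        assert (Hee : 0 < e * e) by nra.
        assert (u * u + v * v <= (3 * exp E * e) * (3 * exp E * e)).
        { eapply Rle_trans; [exact G|].
          apply Rle_trans with (8 * (e * e) * exp E).
          - apply Rmult_le_compat_r; [lra|]. lra.
          - replace (3 * exp E * e * (3 * exp E * e)) with (9 * (e * e) * exp E * exp E) by ring.
            assert (0 < (e * e) * exp E) by (apply Rmult_lt_0_compat; lra). nra. }
        pose proof (mul_self_nonneg u) as Q1. pose proof (mul_self_nonneg v) as Q2.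
        assert (0 <= 3 * exp E * e) by (apply Rmult_le_pos; lra).
        split; apply abs_le_of_sq; lra. }
      destruct Hc as [M0 Hc].
      split; apply (eq_of_half_pow _ _ (M0 + 2)); intros k; destruct (Hc k) as [C1 C2].
      - specialize (HX k (s1 + 1 * s) ltac:(lra)).
        replace (x s - X (s1 + 1 * s)) with (- (fst (f k) (s1 + 1 * s) - x s) + (fst (f k) (s1 + 1 * s) - X (s1 + 1 * s))) by ring.
        eapply Rle_trans; [apply Rabs_triang|]. rewrite Rabs_Ropp. lra.
      - specialize (HY k (s1 + 1 * s) ltac:(lra)).
        replace (y s - Y (s1 + 1 * s)) with (- (snd (f k) (s1 + 1 * s) - y s) + (snd (f k) (s1 + 1 * s) - Y (s1 + 1 * s))) by ring.
        eapply Rle_trans; [apply Rabs_triang|]. rewrite Rabs_Ropp. lra. }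
    exists (fun s => x (t - s1 + -1 * s)), (fun s => y (t - s1 + -1 * s)).
    split; [|split; [|split; [|split]]].
    - apply (sol_reverse L1 lam (-2) 2 (t - s1) x y S); [lra|].
      intros s Hs. unfold L1, L. f_equal; ring.
    - rewrite (proj1 (Heq (t - s1 + -1 * 0) ltac:(lra))). f_equal; ring.
    - rewrite (proj2 (Heq (t - s1 + -1 * 0) ltac:(lra))). f_equal; ring.
    - replace (t - s1 + -1 * (t - s1)) with 0 by ring. exact Ex.
    - replace (t - s1 + -1 * (t - s1)) with 0 by ring. exact Ey. }
  exists (X t), (Y t). split; [|split; [|split]].
  - intros k. exists (fst (f k)), (snd (f k)). split; [apply Hf|].
    specialize (HX k t ltac:(lra)). specialize (HY k t ltac:(lra)). lra.
  - intros s Hs. destruct (Bk (t - s) ltac:(lra)) as [x [y [S [Ex [Ey _]]]]].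
    exists x, y. replace (t - (t - s)) with s in S by ring. auto.
  (* A forward solution up to t would agree with the reversed limit at time t - s1, where its
     squared distance to [lam] is at most s1/4 + 4 s1 = 17/4 s1. By continuity it is above half of
     its value at t, and s1 below a tenth of that value contradicts this. *)
  - intros [x [y [S [Ex Ey]]]].
    assert (N : 0 < nsq lam x y t) by (apply S; lra).
    destruct (sol_continuity _ _ _ _ _ t S ltac:(lra)) as [Cx Cy].
    pose proof (continuity_nsq lam x y t (Hl t) Cx Cy) as Cn.
    destruct (proj1 (continuity_pt_eps _ _) Cn (nsq lam x y t / 2) ltac:(lra)) as [d [Hd0 Hd1]].
    set (s1 := Rmin t (Rmin d (nsq lam x y t / 10)) / 2).
    assert (Hm : 0 < Rmin t (Rmin d (nsq lam x y t / 10))) by (repeat apply Rmin_glb_lt; lra).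
    assert (Hs1 : 0 < s1) by (unfold s1; lra).
    assert (Hst : s1 < t) by (unfold s1; pose proof (Rmin_l t (Rmin d (nsq lam x y t / 10))); lra).
    pose proof (Rmin_r t (Rmin d (nsq lam x y t / 10))) as Hr.
    assert (Hsd : s1 < d) by (unfold s1; pose proof (Rmin_l d (nsq lam x y t / 10)); lra).
    assert (Hsn : s1 < nsq lam x y t / 10) by (unfold s1; pose proof (Rmin_r d (nsq lam x y t / 10)); lra).
    destruct (Bk s1 ltac:(lra)) as [x' [y' [S' [Ex' [Ey' [Ex1 Ey1]]]]]].
    destruct (flow_unique lam 2 (t - s1) x y x' y' Hl (sol_restrict lam 2 t (t - s1) x y S ltac:(lra)) S'
      ltac:(congruence) ltac:(congruence) (t - s1) ltac:(lra)) as [Ux Uy].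
    specialize (Hd1 (t - s1)). replace (t - s1 - t) with (- s1) in Hd1 by ring.
    rewrite Rabs_Ropp, Rabs_pos_eq in Hd1 by lra. specialize (Hd1 Hsd).
    apply Rabs_def2 in Hd1.
    assert (nsq lam x y (t - s1) <= 17 / 4 * s1).
    { unfold nsq. rewrite Ux, Uy, Ex1, Ey1.
      destruct (KX s1 ltac:(lra)) as [P1 [_ [P2 _]]]. unfold L in P1. lra. }
    lra.
  - destruct (KX t ltac:(lra)) as [_ [P1 [P2 P3]]]. split; [nra|lra].
Qed.

Definition extend (T : R) (lam : R -> R) (s : R) : R := lam (clamp 0 T s).

Lemma extend_eq (T t : R) (lam : R -> R) : t <= T ->
  forall s, 0 <= s <= t -> lam s = extend T lam s.
Proof. intros Ht s Hs. unfold extend. rewrite clamp_id; [reflexivity|lra]. Qed.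

Lemma ccont_pair (a b : R) (f g : R -> R) :
  (forall s, continuity_pt f s) -> (forall s, continuity_pt g s) -> ccont_on a b (fun s => (f s, g s)).
Proof.
  intros Hf Hg s Hs eps He.
  destruct (proj1 (continuity_pt_eps f s) (Hf s) (eps / 2) ltac:(lra)) as [d1 [Hd1 H1]].
  destruct (proj1 (continuity_pt_eps g s) (Hg s) (eps / 2) ltac:(lra)) as [d2 [Hd2 H2]].
  exists (Rmin d1 d2). split; [now apply Rmin_glb_lt|]. intros u Hu Hc.
  specialize (H1 u (Rlt_le_trans _ _ _ Hc (Rmin_l _ _))).
  specialize (H2 u (Rlt_le_trans _ _ _ Hc (Rmin_r _ _))).
  eapply Rle_lt_trans; [apply Cnorm_le_add|]. simpl. lra.
Qed.

Lemma ccont_components (a b : R) (p : R -> Cplx) : ccont_on a b p ->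
  rcont_on a b (fun s => Re (p s)) /\ rcont_on a b (fun s => Im (p s)).
Proof.
  intros H. split; intros s Hs eps He; destruct (H s Hs eps He) as [d [Hd Hd']];
    exists d; (split; [exact Hd|]); intros u Hu Hc; specialize (Hd' u Hu Hc);
    (eapply Rle_lt_trans; [|exact Hd']).
  - apply (Re_le_Cnorm (Csub (p u) (p s))).
  - apply (Im_le_Cnorm (Csub (p u) (p s))).
Qed.

Definition dist1 (z w : Cplx) : R := Rabs (Re z - Re w) + Rabs (Im z - Im w).

Lemma dist1_pos (z w : Cplx) : z <> w -> 0 < dist1 z w.
Proof.
  intros H. unfold dist1. pose proof (Rabs_pos (Re z - Re w)). pose proof (Rabs_pos (Im z - Im w)).
  destruct (Req_dec (Re z) (Re w)) as [E1|E1].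
  - destruct (Req_dec (Im z) (Im w)) as [E2|E2].
    + exfalso. apply H. destruct z, w; simpl in *; congruence.
    + pose proof (Rabs_pos_lt (Im z - Im w)). lra.
  - pose proof (Rabs_pos_lt (Re z - Re w)). lra.
Qed.

(** The segment from z to w stays at distance less than rad from z, hence off the curve, and is
    prepended to the path from w to infinity. *)
Lemma unbounded_component_near (gam : R -> Cplx) (t rad : R) (z w : Cplx) :
  unbounded_component gam t w -> 0 < Im z ->
  (forall s, 0 < s <= t -> rad <= dist1 (gam s) z) -> dist1 w z < rad ->
  unbounded_component gam t z.
Proof.
  intros [[Hw1 Hw2] Hw3] Hz Hr Hd.
  assert (Hseg : forall v, 0 <= v <= 1 ->
     slit_domain gam t (Re z + v * (Re w - Re z), Im z + v * (Im w - Im z))).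
  { intros v Hv. split; [simpl; nra|]. intros s Hs Heq.
    specialize (Hr s Hs). rewrite <- Heq in Hr. unfold dist1 in *. simpl in Hr.
    replace (Re z + v * (Re w - Re z) - Re z) with (v * (Re w - Re z)) in Hr by ring.
    replace (Im z + v * (Im w - Im z) - Im z) with (v * (Im w - Im z)) in Hr by ring.
    rewrite !Rabs_mult, (Rabs_pos_eq v) in Hr by lra.
    pose proof (Rabs_pos (Re w - Re z)). pose proof (Rabs_pos (Im w - Im z)). nra. }
  split.
  - specialize (Hseg 0 ltac:(lra)). rewrite !Rmult_0_l, !Rplus_0_r in Hseg.
    destruct z; exact Hseg.
  - intros M. destruct (Hw3 M) as [p [Hp [Hp0 [HpM Hps]]]].
    destruct (ccont_components _ _ _ Hp) as [C1 C2].
    (* [A] runs along the segment while u <= 1/2 and [B] along [p] afterwards. Adding the two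
       displacements from z and w gives the joined path by one formula, so its continuity needs no
       gluing. *)
    set (A := fun u => clamp 0 1 (0 + 2 * u)). set (B := fun u => clamp 0 1 (-1 + 2 * u)).
    exists (fun u => (Re z + A u * (Re w - Re z) + (Re (p (B u)) - Re w),
                      Im z + A u * (Im w - Im z) + (Im (p (B u)) - Im w))).
    assert (CA : forall s, continuity_pt A s).
    { intros s. apply (continuity_pt_affine (clamp 0 1)), (lipschitz_continuity 1).
      intros u v. rewrite Rmult_1_l. apply clamp_lip. }
    assert (CB1 : forall s, continuity_pt (fun u => Re (p (B u))) s).
    { intros s. apply (continuity_pt_affine (fun v => Re (p (clamp 0 1 v)))).
      apply (clamp_continuous (fun v => Re (p v)) 0 1); [lra|exact C1]. }
    assert (CB2 : forall s, continuity_pt (fun u => Im (p (B u))) s).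
    { intros s. apply (continuity_pt_affine (fun v => Im (p (clamp 0 1 v)))).
      apply (clamp_continuous (fun v => Im (p v)) 0 1); [lra|exact C2]. }
    assert (VA : forall u, u <= / 2 -> B u = 0).
    { intros u Hu. unfold B, clamp. rewrite Rmin_right by lra. apply Rmax_left; lra. }
    assert (VB : forall u, / 2 <= u -> A u = 1).
    { intros u Hu. unfold A, clamp. rewrite Rmin_left by lra. apply Rmax_right; lra. }
    split; [|split; [|split]].
    + apply ccont_pair; intros s.
      * apply (continuity_pt_plus (fun u => Re z + A u * (Re w - Re z)) (fun u => Re (p (B u)) - Re w)); ctn.
      * apply (continuity_pt_plus (fun u => Im z + A u * (Im w - Im z)) (fun u => Im (p (B u)) - Im w)); ctn.
    + assert (EA : A 0 = 0) by (unfold A; rewrite clamp_id; lra).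
      rewrite EA, (VA 0) by lra. rewrite Hp0. destruct z; simpl. f_equal; ring.
    + assert (EB : B 1 = 1) by (unfold B; rewrite clamp_id; lra).
      rewrite EB, (VB 1) by lra.
      replace (_, _) with (p 1); [exact HpM|]. destruct (p 1); simpl. f_equal; ring.
    + intros u Hu. destruct (Rle_dec u (/ 2)) as [Hu2|Hu2].
      * rewrite (VA u Hu2), Hp0, !Rminus_diag, !Rplus_0_r. apply Hseg. unfold A. apply clamp_in; lra.
      * rewrite (VB u) by lra. specialize (Hps (B u)).
        replace (_, _) with (p (B u)); [apply Hps; unfold B; apply clamp_in; lra|].
        destruct (p (B u)); simpl. f_equal; ring.
Qed.

Section Tip.
Variables (T : R) (lam0 : R -> R) (gam : R -> Cplx).
Let lam := extend T lam0.
Hypotheses (HT : 0 < T) (Hl : forall s, continuity_pt lam s) (Hg : generates T lam0 gam).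

Lemma survives_iff (t : R) (z : Cplx) : 0 <= t <= T ->
  survives lam0 t z <-> exists x y, sol lam 2 t x y /\ x 0 = Re z /\ y 0 = Im z.
Proof.
  intros Ht. split.
  - apply sol_of_survives; [lra|]. apply extend_eq; lra.
  - intros [x [y [S [Ex Ey]]]]. replace z with (x 0, y 0).
    + apply (survives_of_sol lam0 lam); auto. apply extend_eq; lra.
    + destruct z; simpl in *; congruence.
Qed.

Lemma component_iff (t : R) (z : Cplx) : 0 <= t <= T -> 0 < Im z ->
  unbounded_component gam t z <-> survives lam0 t z.
Proof.
  intros Ht Hz. destruct Hg as [_ [_ H]]. rewrite <- (H t Ht z). unfold hull. split.
  - intros [_ H1]. apply NNPP. intro. apply H1. tauto.
  - intros Hs. tauto.
Qed.

Lemma gam_components_cont :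
  (forall s, continuity_pt (fun r => Re (gam (clamp 0 T r))) s) /\
  (forall s, continuity_pt (fun r => Im (gam (clamp 0 T r))) s).
Proof.
  destruct Hg as [Hc _]. destruct (ccont_components _ _ _ Hc) as [C1 C2].
  split; [apply (clamp_continuous (fun r => Re (gam r)) 0 T)|apply (clamp_continuous (fun r => Im (gam r)) 0 T)]; auto; lra.
Qed.

(** If the curve missed the tip, it would miss a neighbourhood of it. Surviving points close to the
    tip lie in the unbounded component, and a short segment would put the tip there too, although it
    is swallowed by time t. *)
Lemma tip_on_curve (t p q : R) : 0 < t <= T -> is_tip lam t p q ->
  exists r, 0 <= r <= t /\ gam r = (p, q).
Proof.
  intros Ht [Happ [_ [Hnot [Hq _]]]].
  destruct gam_components_cont as [C1 C2].
  set (d := fun r => dist1 (gam (clamp 0 T r)) (p, q)).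
  assert (Cd : forall c, 0 <= c <= t -> continuity_pt d c).
  { intros c _. unfold d, dist1. simpl.
    apply (continuity_pt_plus (fun r => Rabs (Re (gam (clamp 0 T r)) - p)) (fun r => Rabs (Im (gam (clamp 0 T r)) - q))).
    - apply (continuity_pt_comp (fun r => Re (gam (clamp 0 T r)) - p) Rabs); [ctn|apply Rcontinuity_abs].
    - apply (continuity_pt_comp (fun r => Im (gam (clamp 0 T r)) - q) Rabs); [ctn|apply Rcontinuity_abs]. }
  (* Compactness forces time 0 into the interval, so r = 0 is still possible in the conclusion. *)
  destruct (continuity_ab_min d 0 t ltac:(lra) Cd) as [r [Hmin Hr]].
  exists r. split; [exact Hr|]. apply NNPP. intro Hne.
  assert (Er : clamp 0 T r = r) by (apply clamp_id; lra).
  assert (Hpos : 0 < d r) by (unfold d; rewrite Er; now apply dist1_pos).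
  apply Hnot. apply (survives_iff t (p, q) ltac:(lra)).
  apply component_iff; [lra|exact Hq|].
  destruct (half_pow_small 4 (d r) Hpos) as [k Hk].
  destruct (Happ k) as [x [y [[S [Ex [Ey M]]] [Hx Hy]]]].
  assert (Hk0 : 0 < (/ 2) ^ k) by (apply pow_lt; lra).
  assert (Hyt : 0 < y t) by (specialize (M t ltac:(lra)); lra).
  apply (unbounded_component_near gam t (d r) (p, q) (x t, y t)).
  - apply component_iff; [lra|exact Hyt|]. apply survives_iff; [lra|].
    exists (fun s => x (t + -1 * s)), (fun s => y (t + -1 * s)).
    split; [|simpl; split; f_equal; ring].
    apply (sol_reverse (fun s => lam (t - s)) lam (-2) 2 t x y S); [lra|].
    intros s Hs. f_equal; ring.
  - exact Hq.
  - intros s Hs. specialize (Hmin s ltac:(lra)). unfold d in Hmin at 2. now rewrite clamp_id in Hmin by lra.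
  - unfold dist1. simpl. lra.
Qed.

(** A point of the curve at a time r with 0 < r < t is not in the slit domain at r, whereas the tip
    at t survives up to r. *)
Lemma tip_eq_of_pos (t p q r : R) : 0 < t <= T -> is_tip lam t p q ->
  0 < r <= t -> gam r = (p, q) -> gam t = (p, q).
Proof.
  intros Ht [_ [Hs [_ [Hq _]]]] Hr E. destruct (Req_dec r t) as [<-|Hne]; [exact E|exfalso].
  assert (U : unbounded_component gam r (p, q)).
  { apply component_iff; [lra|exact Hq|]. apply survives_iff; [lra|]. apply Hs; lra. }
  destruct U as [[_ U] _]. apply (U r); [lra|]. now symmetry.
Qed.

(* The curve passes through every tip; it does so at the right time because the points [gam r],
   [0 < r < t], are swallowed before time [t].  Time 0 is excluded since the tips tend to the real
   line. *)
Lemma curve_is_tip (t0 : R) : t0 <= T ->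
  (forall t, 0 < t <= t0 -> exists p q, is_tip lam t p q) ->
  forall t p q, 0 < t <= t0 -> is_tip lam t p q -> gam t = (p, q).
Proof.
  intros Ht0 Hex t p q Ht Htip.
  destruct (tip_on_curve t p q ltac:(lra) Htip) as [r [Hr Er]].
  destruct (Req_dec r 0) as [->|Hr0]; [|apply (tip_eq_of_pos t p q r); auto; lra].
  exfalso. assert (Hq : 0 < q) by apply Htip.
  (* Suppose [gam 0] is the tip at t. As a point is swallowed at one time only, the tips at all
     other times t' are met at positive times, so at t' itself, with height at most 2 sqrt t'.
     Letting t' tend to 0 contradicts that [gam 0] has height q > 0. *)
  assert (Hall : forall t', 0 < t' <= t0 -> t' <> t -> Im (gam t') * Im (gam t') <= 4 * t').
  { intros t' Ht' Hne. destruct (Hex t' Ht') as [p' [q' Htip']].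
    destruct (tip_on_curve t' p' q' ltac:(lra) Htip') as [r' [Hr' Er']].
    assert (Hr0' : r' <> 0).
    { intros ->. rewrite Er in Er'. injection Er' as -> ->.
      destruct Htip as [_ [A1 [A2 _]]]. destruct Htip' as [_ [B1 [B2 _]]].
      destruct (Rlt_dec t t') as [Hlt|Hlt]; [apply A2, B1; lra|apply B2, A1; lra]. }
    rewrite (tip_eq_of_pos t' p' q' r') by (auto; lra). simpl. apply Htip'. }
  destruct Hg as [Hc _]. destruct (ccont_components _ _ _ Hc) as [_ C2].
  destruct (C2 0 ltac:(lra) (q / 2) ltac:(lra)) as [d [Hd H]].
  set (m := Rmin t (Rmin d (q * q / 16))).
  assert (Hm : 0 < m) by (unfold m; repeat apply Rmin_glb_lt; try lra; nra).
  assert (Hm1 : m <= t) by apply Rmin_l.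
  assert (Hm2 : m <= d) by (unfold m; eapply Rle_trans; [apply Rmin_r|apply Rmin_l]).
  assert (Hm3 : m <= q * q / 16) by (unfold m; eapply Rle_trans; [apply Rmin_r|apply Rmin_r]).
  specialize (Hall (m / 2) ltac:(lra) ltac:(lra)).
  specialize (H (m / 2) ltac:(lra)). rewrite Rminus_0_r, Rabs_pos_eq in H by lra.
  specialize (H ltac:(lra)). rewrite Er in H. simpl in H. apply Rabs_def2 in H.
  set (v := Im (gam (m / 2))) in *. assert (q / 2 < v) by lra. nra.
Qed.
End Tip.

(** * The formal expansion *)

Fixpoint peval (p : list R) (x : R) : R :=
  match p with [] => 0 | a :: p => a + x * peval p x end.

Fixpoint padd (p q : list R) : list R :=
  match p, q with
  | [], _ => q
  | _, [] => p
  | a :: p, b :: q => (a + b) :: padd p q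
  end.

Definition pscale (c : R) (p : list R) : list R := map (Rmult c) p.

Fixpoint pmul (p q : list R) : list R :=
  match p with [] => [] | a :: p => padd (pscale a q) (0 :: pmul p q) end.

Fixpoint pderiv (p : list R) : list R :=
  match p with [] => [] | _ :: p => padd p (0 :: pderiv p) end.

(* [pavg 1 p] is the polynomial solution [h] of (x h)' = p. *)
Fixpoint pavg (k : R) (p : list R) : list R :=
  match p with [] => [] | a :: p => a / k :: pavg (k + 1) p end.

Definition psum (f : nat -> list R) (l : list nat) : list R :=
  fold_right (fun i p => padd (f i) p) [] l.

Definition rsum (f : nat -> R) (l : list nat) : R :=
  fold_right (fun i s => f i + s) 0 l.

Fixpoint ppow (p : list R) (k : nat) : list R :=
  match k with O => [1] | S k => pmul p (ppow p k) end.

Lemma peval_padd (p q : list R) (x : R) : peval (padd p q) x = peval p x + peval q x.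
Proof.
  revert q; induction p as [|a p IH]; intros [|b q]; simpl; try ring. rewrite IH; ring.
Qed.

Lemma peval_pscale (c : R) (p : list R) (x : R) : peval (pscale c p) x = c * peval p x.
Proof. induction p as [|a p IH]; simpl; [ring|]. fold (pscale c p). rewrite IH; ring. Qed.

Lemma peval_pmul (p q : list R) (x : R) : peval (pmul p q) x = peval p x * peval q x.
Proof.
  induction p as [|a p IH]; simpl; [ring|].
  rewrite peval_padd, peval_pscale. simpl. rewrite IH; ring.
Qed.

Lemma peval_ppow (p : list R) (k : nat) (x : R) : peval (ppow p k) x = peval p x ^ k.
Proof. induction k as [|k IH]; simpl; [ring|]. rewrite peval_pmul, IH; ring. Qed.

Lemma peval_psum (f : nat -> list R) (l : list nat) (x : R) :
  peval (psum f l) x = rsum (fun i => peval (f i) x) l.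
Proof. induction l as [|i l IH]; simpl; [ring|]. rewrite peval_padd, IH; ring. Qed.

Lemma is_derive_peval (p : list R) (x : R) : is_derive (peval p) x (peval (pderiv p) x).
Proof.
  induction p as [|a p IH]; simpl.
  - apply (is_derive_const (V := R_NormedModule) 0).
  - rewrite peval_padd. simpl. eapply is_derive_eq.
    + apply (is_derive_plus (fun _ => a) (fun x => x * peval p x)).
      * apply is_derive_const.
      * apply (is_derive_mult (fun x => x) (peval p) x 1 (peval (pderiv p) x)); [apply @is_derive_id|exact IH|].
        intros; apply Rmult_comm.
    + unfold plus, mult, zero; simpl; ring.
Qed.

Lemma peval_pavg (k x : R) (p : list R) : 0 < k ->
  x * peval (pderiv (pavg k p)) x + k * peval (pavg k p) x = peval p x.
Proof.
  revert k; induction p as [|a p IH]; intros k Hk; simpl; [ring|].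
  specialize (IH (k + 1) ltac:(lra)). rewrite peval_padd. simpl. rewrite <- IH. field. lra.
Qed.

Lemma peval_bound (p : list R) : exists B, forall x, 0 <= x <= 1 -> Rabs (peval p x) <= B.
Proof.
  induction p as [|a p [B IH]].
  - exists 0. intros. simpl. rewrite Rabs_R0; lra.
  - exists (Rabs a + B). intros x Hx. simpl. eapply Rle_trans; [apply Rabs_triang|].
    rewrite Rabs_mult, (Rabs_pos_eq x) by lra.
    specialize (IH x Hx). pose proof (Rabs_pos (peval p x)). nra.
Qed.

(* The driving polynomial sum_k d_k/k! (rho^2 (1-x^2))^k, expanded in r = i rho. *)
Definition drive (d : nat -> R) (m : nat) : list R :=
  if Nat.even m then
    match m with
    | O => []
    | _ => pscale (d (Nat.div m 2) / INR (fact (Nat.div m 2)) * (-1) ^ (Nat.div m 2))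
             (ppow [1; 0; -1] (Nat.div m 2))
    end
  else [].

(** Comparing coefficients of r^(m+1) in the equation, the terms j = 1 and j = m of the convolution
    are 2 (q_m - drive_m) and 2 x q_m', since q_1 = 2x and drive_1 = 0. Hence (x q_m)' = drive_m -
    1/2 times the sum over 2 <= j <= m-1, which contains lower orders only. *)
Definition coeff_step (d : nat -> R) (f : nat -> list R) (m : nat) : list R :=
  pavg 1 (padd (drive d m)
    (pscale (- / 2) (psum (fun i => pmul (pderiv (f i))
       (padd (f (m + 1 - i)%nat) (pscale (-1) (drive d (m + 1 - i)%nat)))) (seq 2 (m - 2))))).

(** Course-of-values recursion: stage m stores all orders up to m. Order 1 is fixed by q_1' q_1 =
    4x, with the root 2x that points into the half plane. *)
Fixpoint coeff_table (d : nat -> R) (m : nat) : nat -> list R :=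
  match m with
  | O => fun _ => []
  | S m' => fun j =>
      if Nat.eqb j (S m') then
        (if Nat.eqb j 1 then [0; 2] else coeff_step d (coeff_table d m') j)
      else coeff_table d m' j
  end.

(* Coefficient of [r^m] in the formal solution [G(x,r)] of [G_x (G - drive) = 4 r^2 x]. *)
Definition coeff (d : nat -> R) (m : nat) : list R := coeff_table d m m.

Lemma coeff_table_eq (d : nat -> R) (m j : nat) : (j <= m)%nat -> coeff_table d m j = coeff d j.
Proof.
  induction m as [|m IH]; intros H.
  - replace j with O by lia. reflexivity.
  - destruct (Nat.eq_dec j (S m)) as [->|Hne]; [reflexivity|].
    simpl. destruct (Nat.eqb_spec j (S m)); [contradiction|]. apply IH; lia.
Qed.

Lemma psum_ext (f g : nat -> list R) (l : list nat) :
  (forall i, In i l -> f i = g i) -> psum f l = psum g l.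
Proof.
  induction l as [|i l IH]; intros H; simpl; [reflexivity|].
  rewrite (H i), IH; [reflexivity|intros; apply H; now right|now left].
Qed.

Lemma coeff_rec (d : nat -> R) (m : nat) : (2 <= m)%nat -> coeff d m = coeff_step d (coeff d) m.
Proof.
  intros Hm. destruct m as [|[|m]]; try lia. unfold coeff at 1.
  change (coeff_table d (S (S m)) (S (S m))) with
    (if Nat.eqb (S (S m)) (S (S m)) then
       (if Nat.eqb (S (S m)) 1 then [0; 2] else coeff_step d (coeff_table d (S m)) (S (S m)))
     else coeff_table d (S m) (S (S m))).
  rewrite Nat.eqb_refl. simpl Nat.eqb.
  cbv iota. unfold coeff_step. do 3 f_equal. apply psum_ext. intros i Hi. apply in_seq in Hi.
  rewrite !coeff_table_eq by lia. reflexivity.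
Qed.

Lemma drive_ext (d1 d2 : nat -> R) (m : nat) :
  (forall k, (1 <= k)%nat -> (k <= Nat.div m 2)%nat -> d1 k = d2 k) -> drive d1 m = drive d2 m.
Proof.
  intros H. unfold drive. destruct (Nat.even m) eqn:E; [|reflexivity].
  destruct m as [|[|m]]; [reflexivity|discriminate|].
  rewrite (H (Nat.div (S (S m)) 2)); [reflexivity| |lia].
  change 1%nat with (Nat.div 2 2). apply Nat.Div0.div_le_mono. lia.
Qed.

(** Order m refers to [drive] at orders at most m, and [drive d (2 * k)] contains [d k] alone; so
    the index never exceeds m/2. *)
Lemma coeff_ext (d1 d2 : nat -> R) (m : nat) :
  (forall k, (1 <= k)%nat -> (k <= Nat.div m 2)%nat -> d1 k = d2 k) -> coeff d1 m = coeff d2 m.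
Proof.
  induction m as [m IH] using lt_wf_ind. intros H.
  assert (Hlow : forall j, (j <= m)%nat ->
    forall k, (1 <= k)%nat -> (k <= Nat.div j 2)%nat -> d1 k = d2 k).
  { intros j Hj k Hk1 Hk2. apply H; [exact Hk1|]. etransitivity; [exact Hk2|]. now apply Nat.Div0.div_le_mono. }
  destruct m as [|[|m]]; [reflexivity|reflexivity|].
  rewrite !coeff_rec by lia. unfold coeff_step.
  rewrite (drive_ext d1 d2) by (apply Hlow; lia). do 3 f_equal.
  apply psum_ext. intros i Hi. apply in_seq in Hi.
  rewrite (IH i), (IH (S (S m) + 1 - i)%nat), (drive_ext d1 d2 (S (S m) + 1 - i))
    by (try lia; apply Hlow; lia). reflexivity.
Qed.

Lemma drive_1 (d : nat -> R) : drive d 1 = [].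
Proof. reflexivity. Qed.

Lemma rsum_app (f : nat -> R) (l l' : list nat) : rsum f (l ++ l') = rsum f l + rsum f l'.
Proof. induction l as [|i l IH]; simpl; [ring|]. rewrite IH; ring. Qed.

Lemma coeff_convolution (d : nat -> R) (x : R) (m : nat) : (1 <= m)%nat ->
  rsum (fun j => peval (pderiv (coeff d j)) x *
     (peval (coeff d (m + 1 - j)) x - peval (drive d (m + 1 - j)) x)) (seq 1 m)
  = if Nat.eqb m 1 then 4 * x else 0.
Proof.
  intros Hm. destruct m as [|[|m]]; [lia| |].
  - simpl. ring.
  - simpl Nat.eqb. cbv iota.
    assert (Es : seq 1 (S (S m)) = 1%nat :: seq 2 m ++ [S (S m)]).
    { change (seq 1 (S (S m))) with (1%nat :: seq 2 (S m)). f_equal. rewrite seq_S. reflexivity. }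
    rewrite Es. change (rsum ?f (1%nat :: ?l)) with (f 1%nat + rsum f l). rewrite rsum_app.
    replace (S (S m) + 1 - 1)%nat with (S (S m)) by lia.
    change (rsum ?f [?i]) with (f i + 0).
    cbv beta. replace (S (S m) + 1 - S (S m))%nat with 1%nat by lia.
    rewrite drive_1.
    change (coeff d 1) with [0; 2].
    pose proof (coeff_rec d (S (S m)) ltac:(lia)) as E.
    unfold coeff_step in E. replace (S (S m) - 2)%nat with m in E by lia.
    set (rhs := padd _ _) in E.
    pose proof (peval_pavg 1 x rhs Rlt_0_1) as A. rewrite <- E in A.
    unfold rhs in A. rewrite peval_padd, peval_pscale, peval_psum in A.
    assert (Er : rsum (fun i => peval (pmul (pderiv (coeff d i)) (padd (coeff d (S (S m) + 1 - i))
        (pscale (-1) (drive d (S (S m) + 1 - i))))) x) (seq 2 m)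
      = rsum (fun j => peval (pderiv (coeff d j)) x *
     (peval (coeff d (S (S m) + 1 - j)) x - peval (drive d (S (S m) + 1 - j)) x)) (seq 2 m)).
    { clear. induction (seq 2 m) as [|i l IH]; [reflexivity|]. simpl.
      rewrite peval_pmul, peval_padd, peval_pscale. simpl in IH. rewrite IH. ring. }
    rewrite Er in A.
    set (S0 := rsum _ (seq 2 m)) in *.
    assert (E2 : peval (pderiv [0; 2]) x = 2) by (simpl; ring).
    assert (E3 : peval [0; 2] x = 2 * x) by (simpl; ring).
    rewrite E2, E3. change (peval [] x) with 0. lra.
Qed.

(** * Truncated power series at a complex argument *)

Fixpoint cser (a : nat -> R) (r : C) (M : nat) : C :=
  match M with
  | O => 0%C
  | S M' => (cser a r M' + a (S M') * Cpow r (S M'))%C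
  end.

Lemma cser_minus (a b : nat -> R) (r : C) (M : nat) :
  cser (fun j => a j - b j) r M = (cser a r M - cser b r M)%C.
Proof.
  induction M as [|M IH]; simpl; [ring|]. rewrite IH, RtoC_minus. ring.
Qed.

Definition csum (f : nat -> C) (l : list nat) : C := fold_right (fun i s => (f i + s)%C) 0%C l.

Lemma csum_app (f : nat -> C) (l l' : list nat) : csum f (l ++ l') = (csum f l + csum f l')%C.
Proof. induction l as [|i l IH]; simpl; [ring|]. rewrite IH; ring. Qed.

Lemma csum_ext (f g : nat -> C) (l : list nat) :
  (forall i, In i l -> f i = g i) -> csum f l = csum g l.
Proof.
  induction l as [|i l IH]; intros H; simpl; [reflexivity|].
  rewrite (H i), IH; [reflexivity|intros; apply H; now right|now left].
Qed.

Lemma csum_plus (f g : nat -> C) (l : list nat) :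
  csum (fun i => (f i + g i)%C) l = (csum f l + csum g l)%C.
Proof. induction l as [|i l IH]; simpl; [ring|]. rewrite IH; ring. Qed.

Lemma cser_csum (a : nat -> R) (r : C) (M : nat) :
  cser a r M = csum (fun j => (a j * Cpow r j)%C) (seq 1 M).
Proof.
  induction M as [|M IH]; [reflexivity|].
  rewrite seq_S, csum_app, <- IH. simpl. ring.
Qed.

Lemma csum_mult (f : nat -> C) (c : C) (l : list nat) :
  (csum f l * c)%C = csum (fun i => (f i * c)%C) l.
Proof. induction l as [|i l IH]; simpl; [ring|]. rewrite <- IH; ring. Qed.

Lemma csum_minus (f g : nat -> C) (l : list nat) :
  csum (fun i => (f i - g i)%C) l = (csum f l - csum g l)%C.
Proof. induction l as [|i l IH]; simpl; [ring|]. rewrite IH; ring. Qed.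

Lemma csum_bound (f : nat -> C) (B : R) (l : list nat) :
  (forall i, In i l -> Cmod (f i) <= B) -> Cmod (csum f l) <= INR (length l) * B.
Proof.
  induction l as [|i l IH]; intros H.
  - simpl. rewrite Cmod_0. lra.
  - change (length (i :: l)) with (S (length l)). rewrite S_INR. simpl csum.
    eapply Rle_trans; [apply Cmod_triangle|].
    specialize (H i (or_introl eq_refl)) as H1.
    specialize (IH (fun j Hj => H j (or_intror Hj))). lra.
Qed.

(* Product of two truncated series, collected up to total degree [M+1]. *)
Definition triangle (a b : nat -> R) (r : C) (M : nat) : C :=
  csum (fun j => (a j * Cpow r j * cser b r (M + 1 - j))%C) (seq 1 M).

Lemma csum_rsum (a b : nat -> R) (r : C) (M : nat) (l : list nat) :
  (forall j, In j l -> (j <= M + 1)%nat) ->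
  csum (fun j => (a j * Cpow r j * (b (M + 1 - j)%nat * Cpow r (M + 1 - j)))%C) l =
  (rsum (fun j => (a j * b (M + 1 - j)%nat)%R) l * Cpow r (M + 1))%C.
Proof.
  induction l as [|j l IH]; intros H; simpl.
  - ring.
  - rewrite IH by (intros; apply H; now right). rewrite RtoC_plus, RtoC_mult.
    specialize (H j (or_introl eq_refl)).
    assert (E : Cpow r (M + 1) = (Cpow r j * Cpow r (M + 1 - j))%C).
    { rewrite <- Cpow_add_r. f_equal. lia. }
    rewrite E. ring.
Qed.

Lemma triangle_succ (a b : nat -> R) (r : C) (M : nat) :
  triangle a b r (S M) = (triangle a b r M +
    rsum (fun j => (a j * b (S M + 1 - j)%nat)%R) (seq 1 (S M)) * Cpow r (S M + 1))%C.
Proof.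
  unfold triangle. rewrite <- csum_rsum by (intros j Hj; apply in_seq in Hj; lia).
  rewrite (csum_ext _ (fun j => (a j * Cpow r j * cser b r (M + 1 - j) +
     a j * Cpow r j * (b (S M + 1 - j)%nat * Cpow r (S M + 1 - j)))%C) (seq 1 (S M))).
  - rewrite csum_plus. f_equal. rewrite seq_S, csum_app.
    simpl. replace (M + 1 - S M)%nat with O by lia. simpl. ring.
  - intros j Hj. apply in_seq in Hj.
    replace (S M + 1 - j)%nat with (S (M + 1 - j)) by lia. simpl. ring.
Qed.

(** The product differs from its triangle by pairs of total degree at least M + 2; there are at most
    M^2 of them, each bounded by B^2 |r|^(M+2). *)
Lemma triangle_bound (a b : nat -> R) (r : C) (M : nat) (B : R) : Cmod r <= 1 ->
  (forall j, (1 <= j <= M)%nat -> Rabs (a j) <= B /\ Rabs (b j) <= B) ->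
  Cmod (cser a r M * cser b r M - triangle a b r M)%C <= INR M * (INR M * (B * B)) * Cmod r ^ (M + 2).
Proof.
  intros Hr HB. unfold triangle. rewrite (cser_csum a), csum_mult, <- csum_minus.
  replace (INR M * (INR M * (B * B)) * Cmod r ^ (M + 2))
    with (INR (length (seq 1 M)) * (INR M * (B * B) * Cmod r ^ (M + 2)))
    by (rewrite length_seq; ring).
  apply csum_bound. intros j Hj. apply in_seq in Hj.
  replace (a j * Cpow r j * cser b r M - a j * Cpow r j * cser b r (M + 1 - j))%C
    with (a j * Cpow r j * (cser b r M - cser b r (M + 1 - j)))%C by ring.
  destruct (HB j ltac:(lia)) as [Ba Bb].
  assert (B0 : 0 <= B) by (eapply Rle_trans; [apply Rabs_pos|exact Ba]).
  assert (Hc0 : 0 <= Cmod r) by apply Cmod_ge_0.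
  assert (T : forall K, (K <= M)%nat -> forall K', (K' <= K)%nat ->
     Cmod (cser b r K - cser b r K')%C <= INR (K - K') * (B * Cmod r ^ (K' + 1))).
  { induction K as [|K IH]; intros HK K' HK'.
    - replace K' with O by lia. simpl. replace (0 - 0)%C with (Complex.RtoC 0) by ring. rewrite Cmod_0. lra.
    - destruct (Nat.eq_dec K' (S K)) as [->|Hne].
      + replace (cser b r (S K) - cser b r (S K))%C with (Complex.RtoC 0) by ring.
        rewrite Cmod_0, Nat.sub_diag. simpl. lra.
      + replace (S K - K')%nat with (S (K - K')) by lia. rewrite S_INR.
        simpl cser.
        replace (cser b r K + b (S K) * (r * Cpow r K) - cser b r K')%C
          with ((cser b r K - cser b r K') + b (S K) * Cpow r (S K))%C by (simpl; ring).
        eapply Rle_trans; [apply Cmod_triangle|].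
        specialize (IH ltac:(lia) K' ltac:(lia)).
        assert (Cmod (b (S K) * Cpow r (S K))%C <= B * Cmod r ^ (K' + 1)).
        { rewrite Cmod_mult, Cmod_R, Cmod_pow.
          destruct (HB (S K) ltac:(lia)) as [_ H1].
          apply Rmult_le_compat; [apply Rabs_pos|now apply pow_le|exact H1|].
          replace (S K) with ((K' + 1) + (K - K'))%nat by lia. rewrite pow_add.
          rewrite <- (Rmult_1_r (Cmod r ^ (K' + 1))) at 2.
          apply Rmult_le_compat_l; [now apply pow_le|].
          rewrite <- (pow1 (K - K')). apply pow_incr. lra. }
        lra. }
  specialize (T M (le_n M) (M + 1 - j)%nat ltac:(lia)).
  rewrite !Cmod_mult, Cmod_R, Cmod_pow.
  replace (M + 2)%nat with (j + (M + 1 - j + 1))%nat by lia. rewrite pow_add.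
  assert (INR (M - (M + 1 - j)) <= INR M) by (apply le_INR; lia).
  pose proof (pos_INR (M - (M + 1 - j))).
  assert (P1 : 0 <= Cmod r ^ j) by now apply pow_le.
  assert (P2 : 0 <= Cmod r ^ (M + 1 - j + 1)) by now apply pow_le.
  assert (T' : Cmod (cser b r M - cser b r (M + 1 - j))%C <= INR M * (B * Cmod r ^ (M + 1 - j + 1))).
  { eapply Rle_trans; [exact T|]. apply Rmult_le_compat_r; [now apply Rmult_le_pos|exact H]. }
  replace (INR M * (B * B) * (Cmod r ^ j * Cmod r ^ (M + 1 - j + 1)))
    with (B * Cmod r ^ j * (INR M * (B * Cmod r ^ (M + 1 - j + 1)))) by ring.
  apply Rmult_le_compat; [apply Rmult_le_pos; [apply Rabs_pos|exact P1]|apply Cmod_ge_0| |exact T'].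
  apply Rmult_le_compat_r; assumption.
Qed.

Lemma triangle_coeff (d : nat -> R) (x : R) (r : C) (M : nat) : (1 <= M)%nat ->
  triangle (fun j => peval (pderiv (coeff d j)) x)
    (fun j => peval (coeff d j) x - peval (drive d j) x) r M = (4 * x * (r * r))%C.
Proof.
  induction M as [|M IH]; intros HM; [lia|].
  rewrite triangle_succ, coeff_convolution by lia.
  destruct M as [|M].
  - unfold triangle. simpl. rewrite RtoC_mult. ring.
  - rewrite IH by lia. simpl Nat.eqb. cbv iota. ring.
Qed.

(** * Shadowing an approximate solution *)

(** Coordinates of a complex identity. Let V = a + ib, U = X + iY, w = p + iq, G = A + iB, let n = V
    (G - P) + 4 tau be the defect and e = (L - P) - n/V. As U = w + G - L, one finds 4 tau + V U = V
    (w - e), so that -4 tau/U - V = -(V/U)(w - e). *)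
Lemma shadow_algebra (a b X Y p q A P tau L B : R) :
  0 < X * X + Y * Y -> 0 < a * a + b * b -> L = p + A - X -> B = Y - q ->
  let N := X * X + Y * Y in
  let n1 := a * (A - P) - b * B + 4 * tau in
  let n2 := a * B + b * (A - P) in
  let e1 := L - P - (n1 * a + n2 * b) / (a * a + b * b) in
  let e2 := - ((n2 * a - n1 * b) / (a * a + b * b)) in
  - 4 * tau * X / N - a = - ((a * X + b * Y) / N * (p - e1) - (b * X - a * Y) / N * (q - e2)) /\
  4 * tau * Y / N - b = - ((a * X + b * Y) / N * (q - e2) + (b * X - a * Y) / N * (p - e1)).
Proof.
  intros HN HW -> ->. cbv zeta. split; field; lra.
Qed.

(** In the two cones |Im(V/U)| <= 2 Re(V/U). So the error can grow only if p^2 + q^2 < 3 eps (|p| +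
    |q|), which is impossible once p^2 + q^2 > 36 eps^2. *)
Lemma shadow_ineq (a b X Y p q e1 e2 eps Q : R) :
  0 < b -> Rabs a <= b / 2 -> 0 < Y -> Rabs X <= Y / 2 ->
  Rabs e1 <= eps -> Rabs e2 <= eps -> 0 <= eps -> 36 * (eps * eps) <= Q -> Q < p * p + q * q ->
  let N := X * X + Y * Y in
  p * - ((a * X + b * Y) / N * (p - e1) - (b * X - a * Y) / N * (q - e2)) +
  q * - ((a * X + b * Y) / N * (q - e2) + (b * X - a * Y) / N * (p - e1)) <= 0.
Proof.
  intros Hb Ha HY HX He1 He2 He HQ Hpq. cbv zeta.
  assert (HN : 0 < X * X + Y * Y) by nra.
  apply Rabs_le_between in Ha. apply Rabs_le_between in HX.
  assert (Ac0 : 0 < a * X + b * Y).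
  { assert (- (b / 2 * (Y / 2)) <= a * X) by nra. nra. }
  assert (Bc : Rabs (b * X - a * Y) <= 2 * (a * X + b * Y)).
  { apply Rabs_le. assert (- (b / 2 * (Y / 2)) <= a * X) by nra.
    assert (- (b * Y / 2) <= b * X <= b * Y / 2) by (split; nra).
    assert (- (b * Y / 2) <= a * Y <= b * Y / 2) by (split; nra). split; nra. }
  set (Ac := a * X + b * Y) in *. set (Bcc := b * X - a * Y) in *.
  replace (p * - (Ac / (X * X + Y * Y) * (p - e1) - Bcc / (X * X + Y * Y) * (q - e2)) +
    q * - (Ac / (X * X + Y * Y) * (q - e2) + Bcc / (X * X + Y * Y) * (p - e1)))
    with ((- (Ac * (p * p + q * q)) + (Ac * (p * e1 + q * e2) + Bcc * (q * e1 - p * e2))) * / (X * X + Y * Y))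
    by (field; lra).
  assert (Hi : 0 < / (X * X + Y * Y)) by (now apply Rinv_0_lt_compat).
  assert (H1 : Ac * (p * e1 + q * e2) <= Ac * (eps * (Rabs p + Rabs q))).
  { apply Rmult_le_compat_l; [lra|]. eapply Rle_trans; [apply Rle_abs|].
    eapply Rle_trans; [apply Rabs_triang|]. rewrite !Rabs_mult.
    pose proof (Rabs_pos p). pose proof (Rabs_pos q). nra. }
  assert (H2 : Bcc * (q * e1 - p * e2) <= 2 * Ac * (eps * (Rabs p + Rabs q))).
  { eapply Rle_trans; [apply Rle_abs|]. rewrite Rabs_mult.
    apply Rmult_le_compat; [apply Rabs_pos|apply Rabs_pos|exact Bc|].
    unfold Rminus. eapply Rle_trans; [apply Rabs_triang|]. rewrite Rabs_Ropp, !Rabs_mult.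
    pose proof (Rabs_pos p). pose proof (Rabs_pos q). nra. }
  pose proof (Rabs_mul_self p) as Ep.
  pose proof (Rabs_mul_self q) as Eq.
  assert (H3 : 3 * (eps * (Rabs p + Rabs q)) <= p * p + q * q).
  { rewrite <- Ep, <- Eq in Hpq |- *. pose proof (Rabs_pos p). pose proof (Rabs_pos q).
    set (u := Rabs p) in *. set (v := Rabs q) in *.
    apply Rnot_lt_le; intro Hlt.
    pose proof (mul_self_nonneg (u - v)) as S1.
    assert (S2 : (u + v) * (u + v) <= 2 * (u * u + v * v)) by lra.
    assert (0 <= u + v) by lra.
    assert (S3 : (u + v) * (u + v) < 6 * eps * (u + v)) by lra.
    assert (u + v < 6 * eps) by (apply Rnot_le_lt; intro; nra).
    nra. }
  assert (Ac * (3 * (eps * (Rabs p + Rabs q))) <= Ac * (p * p + q * q)) by (apply Rmult_le_compat_l; lra).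
  assert (- (Ac * (p * p + q * q)) + (Ac * (p * e1 + q * e2) + Bcc * (q * e1 - p * e2)) <= 0) by lra.
  nra.
Qed.

(* Substituting [s = t xi^2], the backward flow shadows any approximate solution [(A,B)] with small
   defect: the error obeys [w' = -(V/U)(w - e)] where both [V] and [U] point roughly upwards, so
   [Re(V/U) > 0] and the error stays of the order of [e]. *)
Lemma shadowing (L : R -> R) (t es eps1 eps2 : R) (x y A B a b P : R -> R) :
  (forall s, continuity_pt L s) -> 0 < t -> 0 < es ->
  (forall s, 0 <= s <= t -> (L s - L 0) * (L s - L 0) <= s / 16) ->
  seed L t es x y ->
  (forall xi, 0 <= xi <= 1 -> is_derive A xi (a xi) /\ is_derive B xi (b xi)) ->
  (forall xi, 0 <= xi <= 1 -> 0 < b xi /\ Rabs (a xi) <= b xi / 2) ->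
  (forall xi, 0 <= xi <= 1 -> Rabs (L (t * (xi * xi)) - P xi) <= eps1) ->
  (forall xi, 0 <= xi <= 1 ->
     Rabs (a xi * (A xi - P xi) - b xi * B xi + 4 * (t * xi)) <= eps2 * b xi /\
     Rabs (a xi * B xi + b xi * (A xi - P xi)) <= eps2 * b xi) ->
  Rabs (x t - A 1) <= 6 * (eps1 + 2 * eps2) + es /\ Rabs (y t - B 1) <= 6 * (eps1 + 2 * eps2) + es.
Proof.
  intros HLc Ht Hes HH Hseed HD HV H1 H2.
  destruct Hseed as [S [Ex [Ey M]]].
  pose proof (cone_estimates L t es x y HLc HH Hes S Ex Ey M) as K.
  set (eps := eps1 + 2 * eps2).
  set (n1 := fun xi => a xi * (A xi - P xi) - b xi * B xi + 4 * (t * xi)).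
  set (n2 := fun xi => a xi * B xi + b xi * (A xi - P xi)).
  set (e1 := fun xi => L (t * (xi * xi)) - P xi - (n1 xi * a xi + n2 xi * b xi) / (a xi * a xi + b xi * b xi)).
  set (e2 := fun xi => - ((n2 xi * a xi - n1 xi * b xi) / (a xi * a xi + b xi * b xi))).
  assert (HE : forall xi, 0 <= xi <= 1 -> Rabs (e1 xi) <= eps /\ Rabs (e2 xi) <= eps).
  { intros xi Hxi. destruct (HV xi Hxi) as [Vb Va]. destruct (H2 xi Hxi) as [N1 N2].
    specialize (H1 xi Hxi). fold (n1 xi) in N1. fold (n2 xi) in N2.
    assert (W : 0 < a xi * a xi + b xi * b xi) by nra.
    assert (G : forall u v, Rabs u <= eps2 * b xi * (b xi / 2) -> Rabs v <= eps2 * b xi * b xi ->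
        Rabs ((u + v) / (a xi * a xi + b xi * b xi)) <= 2 * eps2).
    { intros u v Hu Hv. unfold Rdiv. rewrite Rabs_mult, (Rabs_pos_eq (/ _)) by (left; now apply Rinv_0_lt_compat).
      apply Rmult_le_reg_r with (a xi * a xi + b xi * b xi); [exact W|].
      replace (Rabs (u + v) * / (a xi * a xi + b xi * b xi) * (a xi * a xi + b xi * b xi)) with (Rabs (u + v)) by (field; lra).
      pose proof (Rabs_triang u v).
      assert (0 <= eps2) by (pose proof (Rabs_pos (n1 xi)); nra).
      assert (0 <= eps2 * (a xi * a xi)) by (apply Rmult_le_pos; nra).
      assert (0 <= eps2 * (b xi * b xi)) by (apply Rmult_le_pos; nra).
      lra. }
    assert (G1 : forall n, Rabs n <= eps2 * b xi -> Rabs (n * a xi) <= eps2 * b xi * (b xi / 2)).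
    { intros n Hn. rewrite Rabs_mult. apply Rmult_le_compat; auto; apply Rabs_pos. }
    assert (G2 : forall n, Rabs n <= eps2 * b xi -> Rabs (n * b xi) <= eps2 * b xi * b xi).
    { intros n Hn. rewrite Rabs_mult, (Rabs_pos_eq (b xi)) by lra. apply Rmult_le_compat_r; lra. }
    split.
    - unfold e1. pose proof (G _ _ (G1 _ N1) (G2 _ N2)) as Q.
      eapply Rle_trans; [apply Rabs_triang|]. rewrite Rabs_Ropp. unfold eps. lra.
    - unfold e2. rewrite Rabs_Ropp. unfold Rminus.
      pose proof (G (n2 xi * a xi) (- (n1 xi * b xi)) (G1 _ N2)) as Q. rewrite Rabs_Ropp in Q.
      specialize (Q (G2 _ N1)). pose proof (Rabs_pos (L (t * (xi * xi)) - P xi)). unfold eps. lra. }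
  assert (He : 0 <= eps) by (eapply Rle_trans; [apply Rabs_pos|apply (HE 0); lra]).
  (* The factor 6 is the threshold of [shadow_ineq]; [es] pays for starting the flow at height es
     instead of on the real line. *)
  set (Q := 6 * eps + es).
  set (p := fun xi => x (t * (xi * xi)) - A xi). set (q := fun xi => y (t * (xi * xi)) - B xi).
  assert (Hdom : forall xi, 0 <= xi <= 1 -> 0 <= t * (xi * xi) <= t).
  { intros xi Hxi. assert (0 <= xi * xi <= 1) by (split; nra). split; nra. }
  assert (Hdom' : forall xi, 0 < xi < 1 -> 0 < t * (xi * xi) < t).
  { intros xi Hxi. assert (0 < xi * xi < 1) by (split; nra). split; nra. }
  assert (Csq : forall f xi, continuity_pt f (t * (xi * xi)) -> continuity_pt (fun xi => f (t * (xi * xi))) xi).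
  { intros f xi Hf. apply (continuity_pt_comp (fun xi => t * (xi * xi)) f); [ctn|exact Hf]. }
  assert (Dsq : forall f xi d, is_derive f (t * (xi * xi)) d ->
     is_derive (fun xi => f (t * (xi * xi))) xi (2 * t * xi * d)).
  { intros f xi d Hf. apply (is_derive_comp f (fun xi => t * (xi * xi)) xi d (2 * t * xi) Hf).
    auto_derive; [exact I|ring]. }
  assert (Main : p 1 * p 1 + q 1 * q 1 - Q * Q <= 0).
  { apply (barrier (fun xi => p xi * p xi + q xi * q xi - Q * Q)
      (fun xi => 2 * (p xi * (2 * t * xi * (-2 * (x (t * (xi * xi)) - L (t * (xi * xi))) / nsq L x y (t * (xi * xi))) - a xi) +
         q xi * (2 * t * xi * (- (-2 * y (t * (xi * xi))) / nsq L x y (t * (xi * xi))) - b xi))) 0 1 0).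
    - intros xi Hxi. destruct (sol_continuity _ _ _ _ _ _ S (Hdom xi Hxi)) as [Cx Cy].
      destruct (HD xi Hxi) as [DA DB].
      apply is_derive_continuity_pt in DA. apply is_derive_continuity_pt in DB.
      apply Csq in Cx. apply Csq in Cy.
      assert (continuity_pt p xi) by (unfold p; apply (continuity_pt_minus (fun xi => x (t * (xi * xi)))); assumption).
      assert (continuity_pt q xi) by (unfold q; apply (continuity_pt_minus (fun xi => y (t * (xi * xi)))); assumption).
      ctn.
    - intros xi Hxi. destruct S as [_ S]. destruct (S _ (Hdom' xi Hxi)) as [Dx Dy].
      destruct (HD xi ltac:(lra)) as [DA DB]. apply Dsq in Dx. apply Dsq in Dy.
      pose proof (is_derive_minus _ _ _ _ _ Dx DA) as Dp. pose proof (is_derive_minus _ _ _ _ _ Dy DB) as Dq.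
      change (is_derive p xi (2 * t * xi * (-2 * (x (t * (xi * xi)) - L (t * (xi * xi))) / nsq L x y (t * (xi * xi))) - a xi)) in Dp.
      change (is_derive q xi (2 * t * xi * (- (-2 * y (t * (xi * xi))) / nsq L x y (t * (xi * xi))) - b xi)) in Dq.
      eapply is_derive_eq.
      + apply (is_derive_minus (fun xi => p xi * p xi + q xi * q xi) (fun _ => Q * Q)).
        * apply (is_derive_plus (fun xi => p xi * p xi) (fun xi => q xi * q xi)); apply is_derive_sq; eassumption.
        * apply is_derive_const.
      + unfold minus, plus, opp, zero; simpl. ring.
    - intros xi Hxi HF. rewrite Rmult_0_l.
      specialize (K _ (Hdom xi ltac:(lra))). specialize (M _ (Hdom xi ltac:(lra))).
      destruct (HE xi ltac:(lra)) as [E1 E2]. destruct (HV xi ltac:(lra)) as [Vb Va].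
      destruct K as [_ [K1 [K2 _]]].
      assert (HN : 0 < nsq L x y (t * (xi * xi))) by (apply S, Hdom; lra).
      unfold nsq in *.
      destruct (shadow_algebra (a xi) (b xi) (x (t * (xi * xi)) - L (t * (xi * xi))) (y (t * (xi * xi)))
        (p xi) (q xi) (A xi) (P xi) (t * xi) (L (t * (xi * xi))) (B xi) HN ltac:(nra)
        ltac:(unfold p; ring) ltac:(unfold q; ring)) as [Z1 Z2].
      fold (n1 xi) in Z1, Z2. fold (n2 xi) in Z1, Z2. fold (e1 xi) in Z1, Z2. fold (e2 xi) in Z1, Z2.
      replace (2 * t * xi * (-2 * (x (t * (xi * xi)) - L (t * (xi * xi))) /
        ((x (t * (xi * xi)) - L (t * (xi * xi))) * (x (t * (xi * xi)) - L (t * (xi * xi))) + y (t * (xi * xi)) * y (t * (xi * xi)))) - a xi)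
        with (- 4 * (t * xi) * (x (t * (xi * xi)) - L (t * (xi * xi))) /
        ((x (t * (xi * xi)) - L (t * (xi * xi))) * (x (t * (xi * xi)) - L (t * (xi * xi))) + y (t * (xi * xi)) * y (t * (xi * xi))) - a xi)
        by (field; lra).
      replace (2 * t * xi * (- (-2 * y (t * (xi * xi))) /
        ((x (t * (xi * xi)) - L (t * (xi * xi))) * (x (t * (xi * xi)) - L (t * (xi * xi))) + y (t * (xi * xi)) * y (t * (xi * xi)))) - b xi)
        with (4 * (t * xi) * y (t * (xi * xi)) /
        ((x (t * (xi * xi)) - L (t * (xi * xi))) * (x (t * (xi * xi)) - L (t * (xi * xi))) + y (t * (xi * xi)) * y (t * (xi * xi))) - b xi)
        by (field; lra).
      rewrite Z1, Z2.
      assert (HX : Rabs (x (t * (xi * xi)) - L (t * (xi * xi))) <= y (t * (xi * xi)) / 2) by (apply abs_le_of_sq; [lra|nra]).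
      pose proof (shadow_ineq (a xi) (b xi) (x (t * (xi * xi)) - L (t * (xi * xi))) (y (t * (xi * xi)))
        (p xi) (q xi) (e1 xi) (e2 xi) eps (Q * Q) Vb Va ltac:(lra) HX E1 E2 He ltac:(unfold Q; nra) ltac:(lra)) as Z.
      cbv zeta in Z. lra.
    (* At xi = 0 the term 4 tau vanishes, so the defect is V (G - P) and e = L(0) - G(0): the
       initial error is exactly e + i es. *)
    - destruct (HE 0 ltac:(lra)) as [E1 E2]. destruct (HV 0 ltac:(lra)) as [Vb Va].
      assert (W : 0 < a 0 * a 0 + b 0 * b 0) by nra.
      assert (Ep : p 0 = e1 0).
      { unfold p, e1, n1, n2. rewrite !Rmult_0_r, Ex. field. lra. }
      assert (Eq : q 0 = es + e2 0).
      { unfold q, e2, n1, n2. rewrite !Rmult_0_r, Ey. field. lra. }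
      simpl. rewrite Ep, Eq. apply Rabs_le_between in E1. apply Rabs_le_between in E2.
      assert (e1 0 * e1 0 <= eps * eps) by nra. assert ((es + e2 0) * (es + e2 0) <= (es + eps) * (es + eps)) by nra.
      unfold Q. nra.
    - lra. }
  assert (HQ : 0 <= Q) by (unfold Q; lra).
  pose proof (mul_self_nonneg (p 1)) as S1. pose proof (mul_self_nonneg (q 1)) as S2.
  assert (P1 : Rabs (p 1) <= Q) by (apply abs_le_of_sq; lra).
  assert (P2 : Rabs (q 1) <= Q) by (apply abs_le_of_sq; lra).
  unfold p in P1. unfold q in P2. rewrite !Rmult_1_r in P1, P2. split; assumption.
Qed.

(** * The truncated formal series as an approximate solution *)

Definition taylor (d : nat -> R) (n : nat) (s : R) : R :=
  rsum (fun k => d k / INR (fact k) * s ^ k) (seq 1 n).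

(** The sign is that of i^m in r^m = (i sqrt t)^m, the remaining factor i for odd m being supplied
    by [exp_term]. *)
Definition curve_coeff (d : nat -> R) (m : nat) : R :=
  (-1) ^ (Nat.div m 2) * peval (coeff d m) 1.

Lemma Cpow_imaginary (rho : R) (k : nat) :
  Cpow (0, rho) (2 * k) = ((-1) ^ k * rho ^ (2 * k), 0) /\
  Cpow (0, rho) (2 * k + 1) = (0, (-1) ^ k * rho ^ (2 * k + 1)).
Proof.
  assert (E : forall j, Cpow (0, rho) (2 * j) = ((-1) ^ j * rho ^ (2 * j), 0)).
  { induction j as [|j IH].
    - simpl. unfold Complex.RtoC. f_equal; ring.
    - replace (2 * S j)%nat with (S (S (2 * j))) by lia. simpl Cpow.
      change (j + (j + 0))%nat with (2 * j)%nat. rewrite IH. unfold Cmult. cbn [fst snd pow].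
      generalize (rho ^ (2 * j)), ((-1) ^ j). intros u v. f_equal; ring. }
  split; [apply E|]. rewrite Cpow_add_r, E, pow_add. cbn [Cpow pow].
  unfold Cmult, Complex.RtoC. cbn [fst snd].
  generalize (rho ^ (2 * k)), ((-1) ^ k). intros u v. f_equal; ring.
Qed.

Lemma drive_even (d : nat -> R) (k : nat) (x : R) : (1 <= k)%nat ->
  peval (drive d (2 * k)) x = d k / INR (fact k) * (-1) ^ k * (1 - x * x) ^ k.
Proof.
  intros Hk. unfold drive. rewrite Nat.even_mul. simpl orb. cbv iota.
  assert (E : Nat.div (2 * k) 2 = k) by (rewrite Nat.mul_comm; now apply Nat.div_mul).
  rewrite E. destruct (2 * k)%nat eqn:E2; [lia|].
  rewrite peval_pscale, peval_ppow.
  replace (peval [1; 0; -1] x) with (1 - x * x) by (cbn [peval]; ring). reflexivity.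
Qed.

Lemma drive_odd (d : nat -> R) (k : nat) : drive d (2 * k + 1) = [].
Proof.
  unfold drive. rewrite Nat.even_add, Nat.even_mul. reflexivity.
Qed.

(** The sign (-1)^k of r^(2k) cancels the one built into [drive], and the cut-off 2n+1 admits
    exactly the derivatives of order 1 to n. The argument rho^2 (1 - x^2) is t - s, the reversed
    time; the constant term is absent because lam(0) = 0. *)
Lemma cser_drive (d : nat -> R) (rho x : R) (n : nat) :
  cser (fun j => peval (drive d j) x) (0, rho) (2 * n + 1) =
  (taylor d n (rho * rho * (1 - x * x)), 0).
Proof.
  induction n as [|n IH].
  - unfold taylor. cbn. unfold Cmult, Cplus, Complex.RtoC. cbn. f_equal; ring.
  - replace (2 * S n + 1)%nat with (S (S (2 * n + 1))) by lia.
    cbn [cser]. rewrite IH.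
    replace (S (S (2 * n + 1))) with (2 * (S n) + 1)%nat by lia.
    replace (S (2 * n + 1)) with (2 * (S n))%nat by lia.
    rewrite drive_odd, drive_even by lia.
    rewrite (proj1 (Cpow_imaginary rho (S n))).
    unfold taylor. rewrite (seq_S n 1), rsum_app. cbn [rsum fold_right Nat.add].
    unfold Cmult, Cplus, Complex.RtoC. cbn [fst snd peval].
    assert (E : (-1) ^ S n * (-1) ^ S n = 1).
    { rewrite <- Rpow_mult_distr. replace (-1 * -1) with 1 by ring. apply pow1. }
    rewrite Rpow_mult_distr, (pow_mult rho 2 (S n)).
    replace (rho * rho) with (rho ^ 2) by ring.
    set (c := (-1) ^ S n) in *. set (g := d (S n) / _). set (u := (1 - x * x) ^ S n). set (v := (rho ^ 2) ^ S n).
    f_equal; [|ring].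
    replace (g * c * u * (c * v)) with (g * u * v * (c * c)) by ring. rewrite E. ring.
Qed.

Lemma Rpower_half_INR (t : R) (m : nat) : 0 < t -> Rpower t (INR m / 2) = sqrt t ^ m.
Proof.
  intros Ht. replace (INR m / 2) with (/ 2 * INR m) by (unfold Rdiv; ring).
  rewrite <- Rpower_mult, Rpower_sqrt by exact Ht.
  apply Rpower_pow. now apply sqrt_lt_R0.
Qed.

Lemma expansion_eq_cser (d : nat -> R) (a : nat -> R) (N : nat) (t : R) : 0 < t ->
  (forall m, (1 <= m <= N)%nat -> a m = curve_coeff d m) ->
  expansion a N t = cser (fun j => peval (coeff d j) 1) (0, sqrt t) N.
Proof.
  intros Ht. induction N as [|N IH]; intros Ha; [reflexivity|].
  cbn [expansion cser]. rewrite IH by (intros; apply Ha; lia).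
  change (@eq Cplx) with (@eq C). unfold Cadd, Cplus, Re, Im. cbn [fst snd].
  assert (E : exp_term a (S N) t = Cmult (peval (coeff d (S N)) 1) (Cpow (0, sqrt t) (S N))).
  { unfold exp_term. rewrite (Ha (S N)) by lia. rewrite Rpower_half_INR by exact Ht.
    unfold curve_coeff. destruct (Nat.Even_or_Odd (S N)) as [[k Hk]|[k Hk]]; rewrite Hk.
    - rewrite Nat.even_mul. simpl orb. cbv iota.
      rewrite (proj1 (Cpow_imaginary _ k)).
      replace (Nat.div (2 * k) 2) with k by (rewrite Nat.mul_comm; symmetry; now apply Nat.div_mul).
      unfold Cmult, Complex.RtoC. cbn [fst snd].
      generalize (sqrt t ^ (2 * k)), ((-1) ^ k). intros u v. f_equal; ring.
    - rewrite Nat.even_add, Nat.even_mul. simpl orb. simpl Bool.eqb. cbv iota.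
      rewrite (proj2 (Cpow_imaginary _ k)).
      replace (Nat.div (2 * k + 1) 2) with k by (rewrite Nat.mul_comm, Nat.div_add_l by lia; simpl; lia).
      unfold Cmult, Complex.RtoC. cbn [fst snd].
      generalize (sqrt t ^ (2 * k + 1)), ((-1) ^ k). intros u v. f_equal; ring. }
  rewrite E. reflexivity.
Qed.

Lemma uniform_bound (f : nat -> list R) (M : nat) :
  exists B, 0 <= B /\ forall j x, (j <= M)%nat -> 0 <= x <= 1 -> Rabs (peval (f j) x) <= B.
Proof.
  induction M as [|M [B [HB IH]]].
  - destruct (peval_bound (f O)) as [B HB]. exists (Rmax 0 B). split; [apply Rmax_l|].
    intros j x Hj Hx. replace j with O by lia. eapply Rle_trans; [now apply HB|apply Rmax_r].
  - destruct (peval_bound (f (S M))) as [B' HB']. exists (Rmax B B'). split.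
    + eapply Rle_trans; [exact HB|apply Rmax_l].
    + intros j x Hj Hx. destruct (Nat.eq_dec j (S M)) as [->|Hne].
      * eapply Rle_trans; [now apply HB'|apply Rmax_r].
      * eapply Rle_trans; [apply IH; [lia|exact Hx]|apply Rmax_l].
Qed.

Lemma cser_derive (f : nat -> list R) (r : C) (M : nat) (x : R) :
  is_derive (fun x => fst (cser (fun j => peval (f j) x) r M)) x
    (fst (cser (fun j => peval (pderiv (f j)) x) r M)) /\
  is_derive (fun x => snd (cser (fun j => peval (f j) x) r M)) x
    (snd (cser (fun j => peval (pderiv (f j)) x) r M)).
Proof.
  induction M as [|M [IH1 IH2]].
  - split; apply (is_derive_const (V := R_NormedModule) 0).
  - cbn [cser]. unfold Cplus, Cmult, Complex.RtoC. cbn [fst snd].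
    pose proof (is_derive_peval (f (S M)) x) as D.
    split.
    + apply (is_derive_plus (fun x => fst (cser (fun j => peval (f j) x) r M))
        (fun x => peval (f (S M)) x * fst (Cpow r (S M)) - 0 * snd (Cpow r (S M)))); [exact IH1|].
      apply (is_derive_ext (fun x => fst (Cpow r (S M)) * peval (f (S M)) x)); [intros; simpl; ring|].
      eapply is_derive_eq; [apply (is_derive_scal (peval (f (S M)))), D|]. simpl; ring.
    + apply (is_derive_plus (fun x => snd (cser (fun j => peval (f j) x) r M))
        (fun x => peval (f (S M)) x * snd (Cpow r (S M)) + 0 * fst (Cpow r (S M)))); [exact IH2|].
      apply (is_derive_ext (fun x => snd (Cpow r (S M)) * peval (f (S M)) x)); [intros; simpl; ring|].
      eapply is_derive_eq; [apply (is_derive_scal (peval (f (S M)))), D|]. simpl; ring.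
Qed.

Lemma cser_leading (a : nat -> R) (r : C) (M : nat) (B : R) : Cmod r <= 1 -> 0 <= B ->
  (forall j, (1 <= j <= S M)%nat -> Rabs (a j) <= B) ->
  Cmod (cser a r (S M) - a 1%nat * r)%C <= INR M * (B * Cmod r ^ 2).
Proof.
  intros Hr HB. induction M as [|M IH]; intros Ha.
  - simpl. replace (0 + a 1%nat * (r * 1) - a 1%nat * r)%C with (Complex.RtoC 0) by ring.
    rewrite Cmod_0. lra.
  - rewrite S_INR. change (cser a r (S (S M))) with (cser a r (S M) + a (S (S M)) * Cpow r (S (S M)))%C.
    replace (cser a r (S M) + a (S (S M)) * Cpow r (S (S M)) - a 1%nat * r)%C
      with ((cser a r (S M) - a 1%nat * r) + a (S (S M)) * Cpow r (S (S M)))%C by ring.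
    eapply Rle_trans; [apply Cmod_triangle|].
    specialize (IH ltac:(intros; apply Ha; lia)).
    assert (Cmod (a (S (S M)) * Cpow r (S (S M)))%C <= B * Cmod r ^ 2).
    { rewrite Cmod_mult, Cmod_R, Cmod_pow.
      pose proof (Cmod_ge_0 r).
      apply Rmult_le_compat; [apply Rabs_pos|now apply pow_le|apply Ha; lia|].
      replace (S (S M)) with (2 + M)%nat by lia. rewrite pow_add.
      rewrite <- (Rmult_1_r (Cmod r ^ 2)) at 2.
      apply Rmult_le_compat_l; [now apply pow_le|].
      rewrite <- (pow1 M). apply pow_incr. lra. }
    lra.
Qed.

Lemma abs_fst_le_Cmod (z : C) : Rabs (fst z) <= Cmod z.
Proof. eapply Rle_trans; [apply Rmax_l|apply Rmax_Cmod]. Qed.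

Lemma abs_snd_le_Cmod (z : C) : Rabs (snd z) <= Cmod z.
Proof. eapply Rle_trans; [apply Rmax_r|apply Rmax_Cmod]. Qed.

Lemma approximate_solution (d : nat -> R) (n : nat) :
  exists K t1, 0 <= K /\ 0 < t1 <= 1 /\ forall t, 0 < t <= t1 ->
  exists A B a b : R -> R,
    (forall x, 0 <= x <= 1 -> is_derive A x (a x) /\ is_derive B x (b x)) /\
    (forall x, 0 <= x <= 1 -> 0 < b x /\ Rabs (a x) <= b x / 2) /\
    (forall x, 0 <= x <= 1 ->
       let P := taylor d n (t * (1 - x * x)) in
       Rabs (a x * (A x - P) - b x * B x + 4 * (t * x)) <= K * t ^ (n + 1) * b x /\
       Rabs (a x * B x + b x * (A x - P)) <= K * t ^ (n + 1) * b x) /\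
    (A 1, B 1) = cser (fun j => peval (coeff d j) 1) (0, sqrt t) (2 * n + 1).
Proof.
  set (M := (2 * n + 1)%nat).
  destruct (uniform_bound (fun j => pderiv (coeff d j)) M) as [B1 [HB1 H1]].
  destruct (uniform_bound (fun j => padd (coeff d j) (pscale (-1) (drive d j))) M) as [B2 [HB2 H2]].
  set (Bd := Rmax B1 B2).
  assert (HBd : 0 <= Bd) by (eapply Rle_trans; [exact HB1|apply Rmax_l]).
  set (c := INR (2 * n) * Bd).
  assert (Hc : 0 <= c) by (apply Rmult_le_pos; [apply pos_INR|exact HBd]).
  (* The derivative series is 2i rho up to c rho^2. For rho <= rho1 this error is at most rho/2,
     which puts the derivative into the cone required by [shadowing]. *)
  set (rho1 := / (1 + 2 * c)).
  assert (Hr1 : 0 < rho1 <= 1).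
  { unfold rho1. split; [apply Rinv_0_lt_compat; lra|]. rewrite <- Rinv_1. apply Rinv_le_contravar; lra. }
  exists (INR M * (INR M * (Bd * Bd))), (rho1 * rho1).
  assert (HK : 0 <= INR M * (INR M * (Bd * Bd))).
  { pose proof (pos_INR M). assert (0 <= Bd * Bd) by (now apply Rmult_le_pos). apply Rmult_le_pos; [assumption|]. now apply Rmult_le_pos. }
  split; [exact HK|]. split; [split; [apply Rmult_lt_0_compat; lra|apply Rle_trans with (1 * 1); [apply Rmult_le_compat; lra|lra]]|].
  intros t Ht. set (rho := sqrt t).
  assert (Hrho0 : 0 < rho) by (apply sqrt_lt_R0; lra).
  assert (Htt : rho * rho = t) by (apply sqrt_sqrt; lra).
  assert (Hrho1 : rho <= rho1) by (apply Rnot_lt_le; intro Hlt; assert (rho1 * rho1 < rho * rho) by (apply Rmult_le_0_lt_compat; lra); lra).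
  set (r := (0, rho) : C).
  assert (Hmod : Cmod r = rho).
  { unfold Cmod, r. cbn [fst snd]. replace (0 ^ 2 + rho ^ 2) with (rho ^ 2) by ring.
    rewrite <- Rsqr_pow2. apply sqrt_Rsqr; lra. }
  set (G := fun x => cser (fun j => peval (coeff d j) x) r M).
  set (V := fun x => cser (fun j => peval (pderiv (coeff d j)) x) r M).
  exists (fun x => fst (G x)), (fun x => snd (G x)), (fun x => fst (V x)), (fun x => snd (V x)).
  assert (Cone : forall x, 0 <= x <= 1 -> rho <= snd (V x) /\ Rabs (fst (V x)) <= rho / 2).
  { intros x Hx.
    assert (L : Cmod (V x - peval (pderiv (coeff d 1)) x * r)%C <= INR (2 * n) * (Bd * Cmod r ^ 2)).
    { unfold V, M. replace (2 * n + 1)%nat with (S (2 * n)) by lia.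
      apply (cser_leading (fun j => peval (pderiv (coeff d j)) x)); [rewrite Hmod; lra|exact HBd|].
      intros j Hj. eapply Rle_trans; [apply H1; [unfold M; lia|exact Hx]|apply Rmax_l]. }
    rewrite Hmod in L.
    assert (L2 : INR (2 * n) * (Bd * rho ^ 2) <= rho / 2).
    { replace (INR (2 * n) * (Bd * rho ^ 2)) with (rho * (c * rho)) by (unfold c; ring).
      cut (c * rho <= / 2); [intros Hh; apply (Rmult_le_compat_l rho) in Hh; lra|].
      apply Rle_trans with (c * rho1); [apply Rmult_le_compat_l; lra|].
      unfold rho1. apply Rmult_le_reg_r with (1 + 2 * c); [lra|].
      rewrite Rmult_assoc, Rinv_l by lra. lra. }
    pose proof (Rle_trans _ _ _ (abs_fst_le_Cmod _) (Rle_trans _ _ _ L L2)) as F1.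
    pose proof (Rle_trans _ _ _ (abs_snd_le_Cmod _) (Rle_trans _ _ _ L L2)) as F2.
    unfold Cminus, Cplus, Copp, Cmult, Complex.RtoC, r in F1, F2. cbn [fst snd] in F1, F2.
    change (coeff d 1) with [0; 2] in *. cbn [pderiv padd peval] in *.
    match type of F1 with Rabs ?u <= _ => replace u with (fst (V x)) in F1 by ring end.
    match type of F2 with Rabs ?u <= _ => replace u with (snd (V x) - 2 * rho) in F2 by ring end.
    split; [|exact F1].
    apply Rabs_le_between in F2. lra. }
  split; [|split; [|split]].
  - intros x Hx. apply (cser_derive (coeff d) r M x).
  - intros x Hx. destruct (Cone x Hx). split; lra.
  - intros x Hx. cbv zeta.
    set (P := taylor d n (t * (1 - x * x))).
    destruct (Cone x Hx) as [Cb Ca].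
    pose proof (triangle_bound (fun j => peval (pderiv (coeff d j)) x)
      (fun j => peval (coeff d j) x - peval (drive d j) x) r M Bd ltac:(rewrite Hmod; lra)) as T.
    specialize (T ltac:(intros j Hj; split;
      [ eapply Rle_trans; [apply H1; [lia|exact Hx]|apply Rmax_l]
      | specialize (H2 j x ltac:(lia) Hx); rewrite peval_padd, peval_pscale in H2;
        replace (peval (coeff d j) x + -1 * peval (drive d j) x)
          with (peval (coeff d j) x - peval (drive d j) x) in H2 by ring;
        eapply Rle_trans; [exact H2|apply Rmax_r] ])).
    rewrite triangle_coeff in T by (unfold M; lia).
    rewrite (cser_minus (fun j => peval (coeff d j) x) (fun j => peval (drive d j) x)) in T.
    fold (V x) in T. fold (G x) in T.
    assert (EP : cser (fun j => peval (drive d j) x) r M = (P, 0)).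
    { unfold r, M. rewrite cser_drive, Htt. reflexivity. }
    rewrite EP, Hmod in T.
    (* The defect starts at degree M + 2 = 2n + 3. Its spare factor rho is exchanged for the
       imaginary part of [V x], which is at least rho, as [shadowing] measures the defect relative
       to the velocity. *)
    assert (Ek : rho ^ (M + 2) = t ^ (n + 1) * rho).
    { unfold M. replace (2 * n + 1 + 2)%nat with (2 * (n + 1) + 1)%nat by lia.
      rewrite pow_add, pow_mult, <- Htt. simpl. f_equal; [f_equal|]; ring. }
    rewrite Ek in T.
    assert (T' : Cmod (V x * (G x - (P, 0)) - 4 * x * (r * r))%C <= INR M * (INR M * (Bd * Bd)) * t ^ (n + 1) * snd (V x)).
    { eapply Rle_trans; [exact T|]. rewrite <- Rmult_assoc.
      apply Rmult_le_compat_l; [|exact Cb].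
      apply Rmult_le_pos; [exact HK|]. apply pow_le; lra. }
    pose proof (Rle_trans _ _ _ (abs_fst_le_Cmod _) T') as F1.
    pose proof (Rle_trans _ _ _ (abs_snd_le_Cmod _) T') as F2.
    unfold Cminus, Cplus, Copp, Cmult, Complex.RtoC, r in F1, F2. cbn [fst snd] in F1, F2.
    split.
    + match type of F1 with Rabs ?u <= _ =>
        replace u with (fst (V x) * (fst (G x) - P) - snd (V x) * snd (G x) + 4 * (t * x)) in F1
          by (rewrite <- Htt; ring) end. exact F1.
    + match type of F2 with Rabs ?u <= _ =>
        replace u with (fst (V x) * snd (G x) + snd (V x) * (fst (G x) - P)) in F2 by ring end. exact F2.
  - unfold G, r, rho. symmetry. apply surjective_pairing.
Qed.

(** * Taylor expansion of the driving function *)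

Lemma Rpower_decreasing (t c c' : R) : 0 < t <= 1 -> c <= c' -> Rpower t c' <= Rpower t c.
Proof.
  intros Ht Hc. unfold Rpower.
  assert (ln t <= 0).
  { rewrite <- ln_1. destruct (proj2 Ht) as [Hlt| ->]; [left; apply ln_increasing; lra|lra]. }
  assert (Hle : c' * ln t <= c * ln t) by nra.
  destruct Hle as [Hlt| ->]; [left; now apply exp_increasing|lra].
Qed.

Lemma Rpower_mono (x y c : R) : 0 < x <= y -> 0 <= c -> Rpower x c <= Rpower y c.
Proof. intros H Hc. now apply Rle_Rpower_l. Qed.

Lemma rderiv_within_unique (a b s d d' : R) (f : R -> R) :
  a < b -> a <= s <= b -> rderiv_within a b f d s -> rderiv_within a b f d' s -> d = d'.
Proof.
  intros Hab Hs H H'. apply NNPP; intro Hne.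
  assert (He : 0 < Rabs (d - d') / 2) by (pose proof (Rabs_pos_lt (d - d') ltac:(lra)); lra).
  destruct (H _ He) as [e1 [He1 H1]]. destruct (H' _ He) as [e2 [He2 H2]].
  assert (Hm : 0 < Rmin (b - a) (Rmin e1 e2)) by (repeat apply Rmin_glb_lt; lra).
  set (m := Rmin (b - a) (Rmin e1 e2) / 2).
  pose proof (Rmin_l (b - a) (Rmin e1 e2)). pose proof (Rmin_r (b - a) (Rmin e1 e2)).
  pose proof (Rmin_l e1 e2). pose proof (Rmin_r e1 e2).
  assert (Hu : exists u, a <= u <= b /\ u <> s /\ Rabs (u - s) = m).
  { destruct (Rle_dec (s + m) b).
    - exists (s + m). unfold m in *. repeat split; try lra.
      replace (s + _ - s) with (Rmin (b - a) (Rmin e1 e2) / 2) by ring. apply Rabs_pos_eq; lra.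
    - exists (s - m). unfold m in *. repeat split; try lra.
      replace (s - _ - s) with (- (Rmin (b - a) (Rmin e1 e2) / 2)) by ring. rewrite Rabs_Ropp. apply Rabs_pos_eq; lra. }
  destruct Hu as [u [Hu1 [Hu2 Hu3]]].
  specialize (H1 u Hu1 Hu2 ltac:(unfold m in *; lra)). specialize (H2 u Hu1 Hu2 ltac:(unfold m in *; lra)).
  set (q := (f u - f s) / (u - s)) in *.
  replace (d - d') with (- (q - d) + (q - d')) in He, H1, H2 by ring.
  pose proof (Rabs_triang (- (q - d)) (q - d')) as T. rewrite Rabs_Ropp in T. lra.
Qed.

(** The derivatives named in the theorem and those hidden in [Holder_class] are given separately;
    this identifies them on [0,T]. *)
Lemma deriv_family_unique (T : R) (n : nat) (lam : R -> R) (D D' : nat -> R -> R) :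
  0 < T -> is_deriv_family T n lam D -> is_deriv_family T n lam D' ->
  forall k, (k <= n)%nat -> forall s, 0 <= s <= T -> D k s = D' k s.
Proof.
  intros HT [H0 H] [H0' H']. induction k as [|k IH]; intros Hk s Hs.
  - now rewrite H0, H0'.
  - apply (rderiv_within_unique 0 T s _ _ (D k) HT Hs).
    + apply H; [lia|exact Hs].
    + intros eps He. destruct (H' k ltac:(lia) s Hs eps He) as [d [Hd Hd']].
      exists d; split; [exact Hd|]. intros u Hu Hne Hc. rewrite !IH by (lia || assumption). auto.
Qed.

Fixpoint ptaylor (c : nat -> R) (k : nat) (s : R) : R :=
  match k with
  | O => c O
  | S k' => ptaylor c k' s + c k / INR (fact k) * s ^ k
  end.

Lemma ptaylor_taylor (c : nat -> R) (n : nat) (s : R) : ptaylor c n s = c O + taylor c n s.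
Proof.
  induction n as [|n IH]; [unfold taylor; simpl; ring|].
  unfold taylor in *. rewrite seq_S, rsum_app. cbn [ptaylor]. rewrite IH. cbn [rsum fold_right Nat.add]. ring.
Qed.

Lemma ptaylor_0 (c : nat -> R) (k : nat) : ptaylor c k 0 = c O.
Proof. induction k as [|k IH]; simpl; [reflexivity|]. rewrite IH. ring. Qed.

Lemma ptaylor_derive (c : nat -> R) (k : nat) (s : R) :
  is_derive (ptaylor c (S k)) s (ptaylor (fun j => c (S j)) k s).
Proof.
  assert (Dm : forall j, is_derive (fun s => c (S j) / INR (fact (S j)) * s ^ (S j)) s
     (c (S j) / INR (fact j) * s ^ j)).
  { intros j.
    replace (c (S j) / INR (fact j) * s ^ j) with (c (S j) / INR (fact (S j)) * (INR (S j) * s ^ j)).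
    - apply (is_derive_scal (fun s => s ^ S j)). apply is_derive_Reals.
      apply (derivable_pt_lim_pow s (S j)).
    - rewrite fact_simpl, mult_INR. field.
      split; [apply INR_fact_neq_0|apply not_0_INR; lia]. }
  induction k as [|k IH].
  - apply (is_derive_ext (fun s => c O + c 1%nat / INR (fact 1) * s ^ 1)); [reflexivity|].
    eapply is_derive_eq.
    + apply (is_derive_plus (fun _ => c O) (fun s => c 1%nat / INR (fact 1) * s ^ 1));
        [apply is_derive_const|apply Dm].
    + unfold plus, zero; simpl. field.
  - apply (is_derive_ext (fun s => ptaylor c (S k) s + c (S (S k)) / INR (fact (S (S k))) * s ^ (S (S k))));
      [reflexivity|].
    apply (is_derive_plus (ptaylor c (S k)) (fun s => c (S (S k)) / INR (fact (S (S k))) * s ^ (S (S k))));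
      [exact IH|apply Dm].
Qed.

Lemma extend_derive (T : R) (f g : R -> R) (s : R) : 0 < s < T ->
  (forall r, 0 <= r <= T -> rderiv_within 0 T f (g r) r) -> is_derive (extend T f) s (g s).
Proof.
  intros Hs H. apply (is_derive_of_within _ 0 T); [exact Hs|].
  intros eps He. destruct (H s ltac:(lra) eps He) as [d [Hd Hd']].
  exists d; split; [exact Hd|]. intros u Hu Hne Hc. unfold extend. rewrite !clamp_id by lra. auto.
Qed.

Lemma extend_continuity (T : R) (f : R -> R) (s : R) : 0 < T -> rcont_on 0 T f -> continuity_pt (extend T f) s.
Proof. intros HT H. apply (clamp_continuous f 0 T); [lra|exact H]. Qed.

(** Induction from the top derivative downwards: the Hölder bound controls D n, and each use of the
    mean value theorem goes down one derivative and gains one factor s. Factorials are given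
    away. *)
Lemma taylor_remainder (T alpha M : R) (n : nat) (D : nat -> R -> R) :
  0 < T -> 0 < alpha ->
  (forall k, (k < n)%nat -> forall s, 0 <= s <= T -> rderiv_within 0 T (D k) (D (S k) s) s) ->
  (forall k, (k <= n)%nat -> rcont_on 0 T (D k)) ->
  (forall x y, 0 <= x <= T -> 0 <= y <= T -> Rabs (D n x - D n y) <= M * Rpower (Rabs (x - y)) alpha) ->
  forall s, 0 < s <= T ->
    Rabs (D O s - ptaylor (fun j => D j 0) n s) <= M * Rpower s (INR n + alpha).
Proof.
  intros HT Ha HD HC HH.
  assert (HM : 0 <= M).
  { specialize (HH T 0 ltac:(lra) ltac:(lra)). pose proof (Rabs_pos (D n T - D n 0)).
    assert (0 < Rpower (Rabs (T - 0)) alpha) by apply exp_pos. nra. }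
  assert (G : forall k, (k <= n)%nat -> forall s, 0 < s <= T ->
    Rabs (D (n - k)%nat s - ptaylor (fun j => D (n - k + j)%nat 0) k s) <= M * Rpower s (INR k + alpha)).
  { induction k as [|k IH]; intros Hk s Hs.
    - rewrite Nat.sub_0_r. simpl. rewrite Nat.add_0_r, Rplus_0_l.
      replace s with (Rabs (s - 0)) at 2 by (rewrite Rminus_0_r; apply Rabs_pos_eq; lra).
      apply HH; lra.
    - set (m := (n - S k)%nat).
      assert (Em : (n - k)%nat = S m) by (unfold m; lia).
      rewrite Em in IH.
      set (c := fun j => D (m + j)%nat 0).
      destruct (mvt_open (fun r => extend T (D m) r - ptaylor c (S k) r)
        (fun r => D (S m) r - ptaylor (fun j => c (S j)) k r) 0 s) as [xi [Hxi E]].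
      + lra.
      + intros r Hr. apply (continuity_pt_minus (extend T (D m)) (ptaylor c (S k))).
        * apply extend_continuity; [exact HT|]. apply HC. unfold m; lia.
        * eapply is_derive_continuity_pt, ptaylor_derive.
      + intros r Hr. apply (is_derive_minus (extend T (D m)) (ptaylor c (S k))).
        * apply (extend_derive T (D m) (D (S m))); [lra|]. intros; apply HD; [unfold m; lia|assumption].
        * apply ptaylor_derive.
      + rewrite ptaylor_0 in E. unfold extend in E. rewrite !clamp_id in E by lra.
        unfold c in E at 2. rewrite Nat.add_0_r, Rminus_diag, !Rminus_0_r in E. rewrite E.
        rewrite Rabs_mult, (Rabs_pos_eq s) by lra.
        specialize (IH ltac:(lia) xi ltac:(lra)).
        replace (ptaylor (fun j => c (S j)) k xi) with (ptaylor (fun j => D (S m + j)%nat 0) k xi).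
        * apply Rle_trans with (M * Rpower s (INR k + alpha) * s).
          -- apply Rmult_le_compat_r; [lra|]. eapply Rle_trans; [exact IH|].
             apply Rmult_le_compat_l; [exact HM|]. apply Rpower_mono; [lra|]. pose proof (pos_INR k); lra.
          -- right. rewrite Rmult_assoc. f_equal. rewrite <- (Rpower_1 s) at 2 by lra.
             rewrite <- Rpower_plus. f_equal. rewrite S_INR. ring.
        * unfold c. generalize m. clear. intros m. induction k as [|k IHk]; cbn [ptaylor]; [f_equal; lia|].
          rewrite IHk. f_equal. f_equal. f_equal. f_equal. lia. }
  intros s Hs. specialize (G n (le_n n) s Hs). rewrite Nat.sub_diag in G. exact G.
Qed.

Lemma taylor_at_0 (d : nat -> R) (n : nat) : taylor d n 0 = 0.
Proof.
  pose proof (ptaylor_taylor d n 0). rewrite ptaylor_0 in H. lra.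
Qed.

(** Either a bounded first derivative or alpha > 1/2 gives a Hölder exponent beta > 1/2, so squared
    increments are o(y - x) and the constant 1/16 is reached at small scales. *)
Lemma small_holder (T alpha M : R) (n : nat) (D : nat -> R -> R) :
  0 < T -> 0 < alpha -> ((1 <= n)%nat \/ 1 / 2 < alpha) ->
  (forall k, (k < n)%nat -> forall s, 0 <= s <= T -> rderiv_within 0 T (D k) (D (S k) s) s) ->
  (forall k, (k <= n)%nat -> rcont_on 0 T (D k)) ->
  (forall k, (k <= n)%nat -> exists B, forall s, 0 <= s <= T -> Rabs (D k s) <= B) ->
  (forall x y, 0 <= x <= T -> 0 <= y <= T -> Rabs (D n x - D n y) <= M * Rpower (Rabs (x - y)) alpha) ->
  exists t0, 0 < t0 /\ forall x y, 0 <= x <= T -> 0 <= y <= T -> 0 < y - x <= t0 ->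
    (D O x - D O y) * (D O x - D O y) <= (y - x) / 16.
Proof.
  intros HT Ha Hcase HD HC HB HH.
  assert (Hexp : exists B beta, 0 <= B /\ 1 / 2 < beta /\ forall x y, 0 <= x <= T -> 0 <= y <= T -> 0 < y - x ->
     Rabs (D O x - D O y) <= B * Rpower (y - x) beta).
  { destruct n as [|n].
    - exists (Rabs M), alpha. split; [apply Rabs_pos|split; [destruct Hcase; [lia|assumption]|]].
      intros x y Hx Hy Hxy. eapply Rle_trans; [now apply HH|].
      rewrite Rabs_minus_sym, (Rabs_pos_eq (y - x)) by lra.
      apply Rmult_le_compat_r; [left; apply exp_pos|apply Rle_abs].
    - destruct (HB 1%nat ltac:(lia)) as [B HB1].
      exists (Rabs B), 1. split; [apply Rabs_pos|split; [lra|]]. intros x y Hx Hy Hxy.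
      rewrite Rpower_1 by exact Hxy.
      destruct (mvt_open (extend T (D O)) (D 1%nat) x y) as [xi [Hxi E]].
      + lra.
      + intros r Hr. apply extend_continuity; [exact HT|apply HC; lia].
      + intros r Hr. apply (extend_derive T (D O)); [lra|]. intros; apply HD; [lia|assumption].
      + unfold extend in E. rewrite !clamp_id in E by lra.
        rewrite Rabs_minus_sym, E, Rabs_mult, (Rabs_pos_eq (y - x)) by lra.
        apply Rmult_le_compat_r; [lra|]. eapply Rle_trans; [apply HB1; lra|apply Rle_abs]. }
  destruct Hexp as [B [beta [HB0 [Hbeta HL]]]].
  (* Chosen so that B^2 t0^(2 beta - 1) = B^2 / (16 B^2 + 1) <= 1/16; the 1 in the denominator
     covers B = 0. *)
  set (t0 := Rpower (/ (16 * (B * B) + 1)) (/ (2 * beta - 1))).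
  assert (HBB : 0 <= B * B) by nra.
  exists t0. split; [apply exp_pos|]. intros x y Hx Hy Hxy.
  specialize (HL x y Hx Hy ltac:(lra)).
  set (s := y - x) in *.
  assert (Es : Rpower s beta * Rpower s beta = s * Rpower s (2 * beta - 1)).
  { rewrite <- Rpower_plus. rewrite <- (Rpower_1 s) at 2 by lra. rewrite <- Rpower_plus. f_equal; ring. }
  assert (Hp : Rpower s (2 * beta - 1) <= / (16 * (B * B) + 1)).
  { eapply Rle_trans; [apply (Rpower_mono s t0); lra|]. unfold t0. rewrite Rpower_mult.
    rewrite Rinv_l by lra. rewrite Rpower_1; [lra|]. apply Rinv_0_lt_compat; lra. }
  assert (Hpp : 0 < Rpower s (2 * beta - 1)) by apply exp_pos.
  assert (Hq : B * B * Rpower s (2 * beta - 1) <= / 16).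
  { apply Rle_trans with (B * B * / (16 * (B * B) + 1)); [apply Rmult_le_compat_l; assumption|].
    apply Rmult_le_reg_r with (16 * (B * B) + 1); [lra|].
    rewrite Rmult_assoc, Rinv_l by lra. lra. }
  set (v := D O x - D O y) in *.
  pose proof (Rabs_mul_self v) as Ev.
  rewrite <- Ev.
  apply Rle_trans with ((B * Rpower s beta) * (B * Rpower s beta)).
  - apply Rmult_le_compat; try apply Rabs_pos; assumption.
  - replace (B * Rpower s beta * (B * Rpower s beta)) with (B * B * (Rpower s beta * Rpower s beta)) by ring.
    rewrite Es. replace (B * B * (s * Rpower s (2 * beta - 1))) with (s * (B * B * Rpower s (2 * beta - 1))) by ring.
    unfold Rdiv. apply Rmult_le_compat_l; [lra|exact Hq].
Qed.

Lemma pow_le_Rpower (t c : R) (n : nat) : 0 < t <= 1 -> c <= 1 -> t ^ (n + 1) <= Rpower t (INR n + c).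
Proof.
  intros Ht Hc. rewrite <- Rpower_pow by lra. apply Rpower_decreasing; [exact Ht|].
  rewrite plus_INR; simpl; lra.
Qed.

Lemma simple_curve_expansion (n : nat) (alpha T : R) (lam : R -> R) (gam : R -> Cplx) (D : nat -> R -> R) :
  0 < alpha <= 1 -> 0 < T -> lam 0 = 0 -> ((1 <= n)%nat \/ 1 / 2 < alpha) ->
  Holder_class T n alpha lam -> generates T lam gam -> is_deriv_family T n lam D ->
  exists K delta, 0 < delta <= 1 /\
    forall t, 0 < t -> t < delta -> t <= T ->
      let z := cser (fun j => peval (coeff (fun k => D k 0) j) 1) (0, sqrt t) (2 * n + 1) in
      Rabs (Re (gam t) - fst z) <= K * Rpower t (INR n + alpha) /\
      Rabs (Im (gam t) - snd z) <= K * Rpower t (INR n + alpha).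
Proof.
  intros Ha HT Hl0 Hcase [D' [HD' [HC [HB [M HH]]]]] Hg HD.
  pose proof (deriv_family_unique T n lam D D' HT HD HD') as HU.
  destruct HD' as [HD0 HDS].
  assert (HM : 0 <= M).
  { specialize (HH T 0 ltac:(lra) ltac:(lra)). pose proof (Rabs_pos (D' n T - D' n 0)).
    assert (0 < Rpower (Rabs (T - 0)) alpha) by apply exp_pos. nra. }
  destruct (small_holder T alpha M n D' HT ltac:(lra) Hcase HDS HC HB HH) as [t0 [Ht0 Hsmall]].
  pose proof (taylor_remainder T alpha M n D' HT ltac:(lra) HDS HC HH) as HT1.
  set (d := fun k => D k 0).
  assert (Htay : forall s, 0 < s <= T -> Rabs (lam s - taylor d n s) <= M * Rpower s (INR n + alpha)).
  { intros s Hs. specialize (HT1 s Hs). rewrite ptaylor_taylor, HD0 in HT1 by lra.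
    rewrite HD0, Hl0 in HT1 by lra.
    replace (taylor (fun j => D' j 0) n s) with (taylor d n s) in HT1.
    - rewrite Rplus_0_l in HT1. exact HT1.
    - unfold taylor. assert (forall l, (forall i, In i l -> (i <= n)%nat) ->
        rsum (fun k => d k / INR (fact k) * s ^ k) l = rsum (fun k => D' k 0 / INR (fact k) * s ^ k) l).
      { induction l as [|i l IH]; intros Hin; [reflexivity|]. cbn [rsum fold_right].
        unfold rsum in IH. rewrite IH by (intros; apply Hin; now right).
        unfold d. rewrite (HU i) by (try apply Hin; try (now left); lra). reflexivity. }
      apply H. intros i Hi. apply in_seq in Hi. lia. }
  destruct (approximate_solution d n) as [K0 [t1 [HK0 [Ht1 Happ]]]].
  set (el := extend T lam).
  assert (Hel : forall s, 0 <= s <= T -> el s = lam s) by (intros s Hs; unfold el, extend; now rewrite clamp_id).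
  assert (Hcl : forall s, continuity_pt el s).
  { intros s. apply extend_continuity; [exact HT|]. intros r Hr eps He.
    destruct (HC O ltac:(lia) r Hr eps He) as [dd [Hdd Hdd']]. exists dd; split; [exact Hdd|].
    intros u Hu Hc. rewrite <- !HD0 by assumption. auto. }
  set (tm := Rmin T t0).
  assert (Htm : 0 < tm) by (apply Rmin_glb_lt; assumption).
  assert (HtmT : tm <= T) by apply Rmin_l.
  assert (Htm0 : tm <= t0) by apply Rmin_r.
  assert (HL : forall t, 0 < t <= tm -> forall s, 0 <= s <= t ->
    (el (t - s) - el (t - 0)) * (el (t - s) - el (t - 0)) <= s / 16).
  { intros t Ht s Hs. destruct (Req_dec s 0) as [->|Hs0].
    - rewrite Rminus_diag. lra.
    - rewrite !Hel by lra. rewrite <- !HD0 by lra.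
      pose proof (Hsmall (t - s) (t - 0) ltac:(lra) ltac:(lra) ltac:(lra)) as Q.
      replace ((t - 0 - (t - s)) / 16) with (s / 16) in Q by lra. exact Q. }
  (* This is the bound of [shadowing] with Taylor error M t^(n+alpha) and defect K0 t^(n+alpha); the
     seed height 2^-k disappears in the limit. *)
  exists (6 * (M + 2 * K0)), (Rmin tm t1). split.
  { split; [apply Rmin_glb_lt; lra|]. eapply Rle_trans; [apply Rmin_r|lra]. }
  intros t Ht Htd HtT z.
  assert (Htm' : t < tm) by (eapply Rlt_le_trans; [exact Htd|apply Rmin_l]).
  assert (Ht1' : t < t1) by (eapply Rlt_le_trans; [exact Htd|apply Rmin_r]).
  destruct (tip_exists el t Hcl Ht (HL t ltac:(lra))) as [p [q Htip]].
  rewrite (curve_is_tip T lam gam HT Hcl Hg tm HtmT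
    (fun t Ht => tip_exists el t Hcl (proj1 Ht) (HL t Ht)) t p q ltac:(lra) Htip).
  destruct (Happ t ltac:(lra)) as [A [B [a [b [HAB [Hab [Hres Hend]]]]]]].
  fold z in Hend. rewrite <- Hend. cbn [fst snd Re Im].
  set (R0 := Rpower t (INR n + alpha)).
  assert (HR0 : 0 < R0) by apply exp_pos.
  assert (Hpow : t ^ (n + 1) <= R0) by (apply pow_le_Rpower; lra).
  assert (Hpow0 : 0 < t ^ (n + 1)) by (apply pow_lt; exact Ht).
  assert (Happrox : forall k, exists x y, Rabs (x - p) <= 2 * (/ 2) ^ k /\ Rabs (y - q) <= 2 * (/ 2) ^ k /\
     Rabs (x - A 1) <= 6 * (M + 2 * K0) * R0 + (/ 2) ^ k /\ Rabs (y - B 1) <= 6 * (M + 2 * K0) * R0 + (/ 2) ^ k).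
  { intros k. destruct Htip as [Hk _]. destruct (Hk k) as [x [y [Sd [E1 E2]]]].
    exists (x t), (y t). split; [exact E1|split; [exact E2|]].
    replace (6 * (M + 2 * K0) * R0) with (6 * (M * R0 + 2 * (K0 * R0))) by ring.
    apply (shadowing (fun s => el (t - s)) t ((/ 2) ^ k) (M * R0) (K0 * R0) x y A B a b
      (fun xi => taylor d n (t * (1 - xi * xi)))); auto.
    - intros s. apply (continuity_pt_comp (fun s => t - s) el); [ctn|apply Hcl].
    - apply pow_lt; lra.
    - apply HL; lra.
    - intros xi Hxi. cbv beta. assert (Hx2 : 0 <= xi * xi <= 1) by (split; nra).
      replace (t - t * (xi * xi)) with (t * (1 - xi * xi)) by ring.
      assert (Hs0 : 0 <= t * (1 - xi * xi) <= t) by (split; nra).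
      rewrite Hel by lra.
      (* The remainder estimate is available at positive times only; at time 0 both functions
         vanish. *)
      destruct (Req_dec (t * (1 - xi * xi)) 0) as [->|Hne].
      + rewrite taylor_at_0, Hl0, Rminus_diag, Rabs_R0. apply Rmult_le_pos; lra.
      + eapply Rle_trans; [apply Htay; lra|]. apply Rmult_le_compat_l; [exact HM|].
        apply Rpower_mono; [lra|]. pose proof (pos_INR n); lra.
    - intros xi Hxi. destruct (Hres xi Hxi) as [Q1 Q2]. destruct (Hab xi Hxi) as [Vb _].
      assert (K0 * t ^ (n + 1) * b xi <= K0 * R0 * b xi).
      { apply Rmult_le_compat_r; [lra|]. apply Rmult_le_compat_l; assumption. }
      split; (eapply Rle_trans; [eassumption|assumption]). }
  split; apply (le_of_half_pow _ _ 3); intros k; destruct (Happrox k) as [x [y [E1 [E2 [E3 E4]]]]].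
  - replace (p - A 1) with (- (x - p) + (x - A 1)) by ring.
    eapply Rle_trans; [apply Rabs_triang|]. rewrite Rabs_Ropp. lra.
  - replace (q - B 1) with (- (y - q) + (y - B 1)) by ring.
    eapply Rle_trans; [apply Rabs_triang|]. rewrite Rabs_Ropp. lra.
Qed.

(** * Strict growth of the hulls *)

Definition cder (f : R -> C) (s : R) (l : C) : Prop :=
  is_derive (fun r => fst (f r)) s (fst l) /\ is_derive (fun r => snd (f r)) s (snd l).

Definition ccont (f : R -> C) (s : R) : Prop :=
  continuity_pt (fun r => fst (f r)) s /\ continuity_pt (fun r => snd (f r)) s.

Lemma cder_eq (f : R -> C) (s : R) (l l' : C) : cder f s l -> l = l' -> cder f s l'.
Proof. now intros H <-. Qed.

Lemma cder_plus (f g : R -> C) (s : R) (l m : C) :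
  cder f s l -> cder g s m -> cder (fun r => (f r + g r)%C) s (l + m)%C.
Proof.
  intros [F1 F2] [G1 G2]. split.
  - apply (is_derive_plus (fun r => fst (f r)) (fun r => fst (g r))); assumption.
  - apply (is_derive_plus (fun r => snd (f r)) (fun r => snd (g r))); assumption.
Qed.

Lemma cder_minus (f g : R -> C) (s : R) (l m : C) :
  cder f s l -> cder g s m -> cder (fun r => (f r - g r)%C) s (l - m)%C.
Proof.
  intros [F1 F2] [G1 G2]. split.
  - apply (is_derive_minus (fun r => fst (f r)) (fun r => fst (g r))); assumption.
  - apply (is_derive_minus (fun r => snd (f r)) (fun r => snd (g r))); assumption.
Qed.

Lemma cder_sq (f : R -> C) (s : R) (l : C) :
  cder f s l -> cder (fun r => (f r * f r)%C) s (2 * (f s * l))%C.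
Proof.
  intros [F1 F2]. unfold Cmult. split; cbn [fst snd].
  - eapply is_derive_eq.
    + apply (is_derive_minus (fun r => fst (f r) * fst (f r)) (fun r => snd (f r) * snd (f r)));
        apply is_derive_sq; eassumption.
    + unfold minus, plus, opp; simpl. ring.
  - eapply is_derive_eq.
    + apply (is_derive_plus (fun r => fst (f r) * snd (f r)) (fun r => snd (f r) * fst (f r))).
      * apply (is_derive_mult (fun r => fst (f r)) (fun r => snd (f r)) s _ _ F1 F2). intros; apply Rmult_comm.
      * apply (is_derive_mult (fun r => snd (f r)) (fun r => fst (f r)) s _ _ F2 F1). intros; apply Rmult_comm.
    + unfold plus, mult; simpl. ring.
Qed.

Lemma ccont_plus (f g : R -> C) (s : R) : ccont f s -> ccont g s -> ccont (fun r => (f r + g r)%C) s.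
Proof.
  intros [F1 F2] [G1 G2]. unfold Cplus. split; cbn [fst snd].
  - apply (continuity_pt_plus (fun r => fst (f r)) (fun r => fst (g r))); assumption.
  - apply (continuity_pt_plus (fun r => snd (f r)) (fun r => snd (g r))); assumption.
Qed.

Lemma ccont_minus (f g : R -> C) (s : R) : ccont f s -> ccont g s -> ccont (fun r => (f r - g r)%C) s.
Proof.
  intros [F1 F2] [G1 G2]. unfold Cminus, Cplus, Copp. split; cbn [fst snd].
  - apply (continuity_pt_minus (fun r => fst (f r)) (fun r => fst (g r))); assumption.
  - apply (continuity_pt_minus (fun r => snd (f r)) (fun r => snd (g r))); assumption.
Qed.

Lemma ccont_sq (f : R -> C) (s : R) : ccont f s -> ccont (fun r => (f r * f r)%C) s.
Proof.
  intros [F1 F2]. unfold Cmult. split; cbn [fst snd]; ctn.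
Qed.

Lemma Cmod_sq (z : C) : Cmod z * Cmod z = fst z * fst z + snd z * snd z.
Proof.
  unfold Cmod. rewrite sqrt_sqrt; [ring|].
  pose proof (pow2_ge_0 (fst z)). pose proof (pow2_ge_0 (snd z)). lra.
Qed.

Lemma inner_le_Cmod (z w : C) : fst z * fst w + snd z * snd w <= Cmod z * Cmod w.
Proof.
  pose proof (Cmod_ge_0 z). pose proof (Cmod_ge_0 w).
  apply Rsqr_incr_0_var; [|now apply Rmult_le_pos]. unfold Rsqr.
  replace (Cmod z * Cmod w * (Cmod z * Cmod w)) with ((Cmod z * Cmod z) * (Cmod w * Cmod w)) by ring.
  rewrite !Cmod_sq. pose proof (mul_self_nonneg (fst z * snd w - snd z * fst w)) as Q. lra.
Qed.

(** The quantity |f|^2 + e^2 starts below 2 e^2 and grows at rate at most 2L + 1, because 2 |f| (L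
    |f| + e) <= (2L + 1)(|f|^2 + e^2). *)
Lemma gronwall (f df : R -> C) (b L e : R) : 0 <= L -> 0 <= e ->
  (forall s, 0 <= s <= b -> ccont f s) ->
  (forall s, 0 < s < b -> cder f s (df s)) ->
  (forall s, 0 < s < b -> Cmod (df s) <= L * Cmod (f s) + e) ->
  Cmod (f 0) <= e ->
  forall s, 0 <= s <= b -> Cmod (f s) <= e * (2 * exp ((2 * L + 1) * b)).
Proof.
  intros HL He Hc Hd Hb H0 s Hs.
  set (k := 2 * L + 1).
  assert (M : Cmod (f s) * Cmod (f s) + e * e - 2 * (e * e) * exp (k * s) <= 0).
  { rewrite Cmod_sq.
    apply (barrier (fun s => fst (f s) * fst (f s) + snd (f s) * snd (f s) + e * e - 2 * (e * e) * exp (k * s))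
      (fun s => 2 * (fst (f s) * fst (df s) + snd (f s) * snd (df s)) - 2 * (e * e) * (k * exp (k * s))) 0 b k).
    - intros r Hr. destruct (Hc r Hr) as [C1 C2]. ctn.
    - intros r Hr. destruct (Hd r Hr) as [D1 D2]. eapply is_derive_eq.
      + apply (is_derive_minus (fun s => fst (f s) * fst (f s) + snd (f s) * snd (f s) + e * e)
          (fun s => 2 * (e * e) * exp (k * s))).
        * apply (is_derive_plus (fun s => fst (f s) * fst (f s) + snd (f s) * snd (f s)) (fun _ => e * e)).
          -- apply (is_derive_plus (fun s => fst (f s) * fst (f s)) (fun s => snd (f s) * snd (f s)));
               apply is_derive_sq; eassumption.
          -- apply is_derive_const.
        * apply (is_derive_scal (fun s => exp (k * s)) r (2 * (e * e)) (k * exp (k * r))).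
          auto_derive; [exact I|ring].
      + unfold minus, plus, opp, zero, scal; simpl; unfold mult; simpl. ring.
    - intros r Hr _. rewrite <- Cmod_sq. specialize (Hb r Hr).
      pose proof (inner_le_Cmod (f r) (df r)) as I. pose proof (Cmod_ge_0 (f r)) as P.
      set (u := Cmod (f r)) in *.
      assert (u * Cmod (df r) <= u * (L * u + e)) by (now apply Rmult_le_compat_l).
      pose proof (mul_self_nonneg (u - e)) as Q.
      assert (0 <= L * (e * e)) by (apply Rmult_le_pos; nra).
      unfold k. nra.
    - rewrite <- Cmod_sq, Rmult_0_r, exp_0. pose proof (Cmod_ge_0 (f 0)). nra.
    - exact Hs. }
  assert (Hk : exp (k * s) <= exp (k * b)).
  { destruct (proj2 Hs) as [Hlt| ->]; [left; apply exp_increasing; unfold k; nra|lra]. }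
  assert (H1 : 1 <= exp (k * b)).
  { rewrite <- exp_0. destruct (Rle_lt_or_eq_dec 0 b ltac:(lra)) as [Hb0|<-].
    - left; apply exp_increasing. unfold k; nra.
    - rewrite Rmult_0_r. lra. }
  set (E := exp (k * b)) in *.
  assert (e * e * exp (k * s) <= e * e * E) by (apply Rmult_le_compat_l; [nra|exact Hk]).
  assert (e * e * E <= e * e * E * E) by (rewrite <- (Rmult_1_r (e * e * E)) at 1; apply Rmult_le_compat_l; nra).
  apply Rsqr_incr_0_var; [unfold Rsqr; nra|]. apply Rmult_le_pos; lra.
Qed.

Definition path (x y : R -> R) (s : R) : C := (x s, y s).
Definition rel (lam x y : R -> R) (s : R) : C := (x s - lam s, y s).

Lemma sol_cder (lam : R -> R) (b : R) (x y : R -> R) (s : R) :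
  sol lam 2 b x y -> 0 < s < b -> cder (path x y) s (2 * / rel lam x y s)%C.
Proof.
  intros S Hs. destruct S as [S1 S2]. destruct (S2 s Hs) as [D1 D2].
  destruct (S1 s ltac:(lra)) as [_ [_ N]].
  unfold path, rel, Cinv, Cmult, Complex.RtoC. split; cbn [fst snd].
  - eapply is_derive_eq; [exact D1|]. unfold nsq in *. field. nra.
  - eapply is_derive_eq; [exact D2|]. unfold nsq in *. field. nra.
Qed.

Lemma rel_inv_bound (lam x y : R -> R) (d s : R) : 0 < d -> d * d <= nsq lam x y s ->
  rel lam x y s <> 0%C /\ Cmod (/ rel lam x y s)%C <= / d.
Proof.
  intros Hd HN.
  assert (Hm : d <= Cmod (rel lam x y s)).
  { apply Rsqr_incr_0_var; [|apply Cmod_ge_0]. unfold Rsqr. rewrite Cmod_sq. exact HN. }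
  assert (Hne : rel lam x y s <> 0%C) by (apply Cmod_gt_0; lra).
  split; [exact Hne|]. rewrite Cmod_inv by exact Hne. apply Rinv_le_contravar; assumption.
Qed.

Lemma sol_ccont (lam : R -> R) (k b : R) (x y : R -> R) (s : R) :
  sol lam k b x y -> 0 <= s <= b -> ccont (path x y) s.
Proof. intros S Hs. exact (sol_continuity _ _ _ _ _ s S Hs). Qed.

Lemma Cmod_scaled (c : R) (z : C) : 0 <= c -> Cmod (c * z)%C = c * Cmod z.
Proof. intros Hc. rewrite Cmod_mult, Cmod_R, Rabs_pos_eq; [reflexivity|exact Hc]. Qed.

Lemma Cmod_add4 (a b c d : C) : Cmod (a + b + c + d)%C <= Cmod a + Cmod b + Cmod c + Cmod d.
Proof.
  eapply Rle_trans; [apply Cmod_triangle|]. apply Rplus_le_compat_r.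
  eapply Rle_trans; [apply Cmod_triangle|]. apply Rplus_le_compat_r. apply Cmod_triangle.
Qed.

(* Mean value property up to third order for the time-[b] flow map: the increments [w_k] from the
   four corners satisfy [S = sum w_k], [Q = sum w_k^2] linear equations with O(eta^3) forcing, and
   both vanish initially. *)
Lemma four_point (lam : R -> R) (b d : R) : 0 <= b -> 0 < d ->
  exists K, 0 <= K /\ forall eta, 0 < eta <= 1 ->
   forall x0 y0 x1 y1 x2 y2 x3 y3 x4 y4,
   sol lam 2 b x0 y0 -> sol lam 2 b x1 y1 -> sol lam 2 b x2 y2 -> sol lam 2 b x3 y3 -> sol lam 2 b x4 y4 ->
   (forall s, 0 <= s <= b -> d * d <= nsq lam x0 y0 s) -> (forall s, 0 <= s <= b -> d * d <= nsq lam x1 y1 s) ->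
   (forall s, 0 <= s <= b -> d * d <= nsq lam x2 y2 s) -> (forall s, 0 <= s <= b -> d * d <= nsq lam x3 y3 s) ->
   (forall s, 0 <= s <= b -> d * d <= nsq lam x4 y4 s) ->
   x1 0 = x0 0 + eta -> y1 0 = y0 0 -> x2 0 = x0 0 - eta -> y2 0 = y0 0 ->
   x3 0 = x0 0 -> y3 0 = y0 0 + eta -> x4 0 = x0 0 -> y4 0 = y0 0 - eta ->
   Rabs (y1 b + y2 b + y3 b + y4 b - 4 * y0 b) <= K * (eta * (eta * eta)).
Proof.
  intros Hb Hd.
  set (D := / d). assert (HD : 0 < D) by (now apply Rinv_0_lt_compat).
  set (L := 4 * (D * D)). assert (HL : 0 <= L) by (unfold L; nra).
  set (G := 2 * exp ((2 * L + 1) * b)). assert (HG : 0 < G) by (unfold G; pose proof (exp_pos ((2 * L + 1) * b)); lra).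
  assert (HD3 : 0 < D * D * D) by (repeat (apply Rmult_lt_0_compat; [|assumption]); assumption).
  assert (HG3 : 0 < G * G * G) by (repeat (apply Rmult_lt_0_compat; [|assumption]); assumption).
  (* [cQ] and [cS] are the forcing constants of Q and S. With 4 G^3 D eta^3 bounding the cubic
     terms, Q is forced by 4 D^2 times that bound, and S by 2 D^3 times it plus 2 D^3 times the
     bound on Q. *)
  set (cQ := 16 * (G * G * G) * (D * D * D)).
  assert (HcQ : 0 <= cQ) by (unfold cQ; apply Rmult_le_pos; lra).
  set (cS := 2 * (cQ * G) * (D * D * D) + 8 * (G * G * G) * (D * D * D * D)).
  assert (HcS : 0 <= cS).
  { unfold cS. assert (0 < D * D * D * D) by (now apply Rmult_lt_0_compat).
    assert (0 <= cQ * G) by (apply Rmult_le_pos; lra).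
    apply Rplus_le_le_0_compat; apply Rmult_le_pos; lra. }
  exists (cS * G). split; [apply Rmult_le_pos; lra|].
  intros eta Heta x0 y0 x1 y1 x2 y2 x3 y3 x4 y4 S0 S1 S2 S3 S4 N0 N1 N2 N3 N4 X1 Y1 X2 Y2 X3 Y3 X4 Y4.
  set (i0 := fun s => (/ rel lam x0 y0 s)%C).
  assert (Bi0 : forall s, 0 <= s <= b -> Cmod (i0 s) <= D).
  { intros s Hs. apply (rel_inv_bound lam x0 y0 d s Hd (N0 s Hs)). }
  (* The resolvent identity 1/u = 1/u0 - w/(u0 u) makes the equation of each increment homogeneous,
     so w stays O(eta). *)
  assert (W : forall x y, sol lam 2 b x y -> (forall s, 0 <= s <= b -> d * d <= nsq lam x y s) ->
     Cmod (path x y 0 - path x0 y0 0)%C <= eta ->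
     exists i : R -> C, (forall s, 0 <= s <= b -> Cmod (i s) <= D /\
        i s = (i0 s - (path x y s - path x0 y0 s) * i0 s * i s)%C) /\
       (forall s, 0 < s < b -> cder (fun s => (path x y s - path x0 y0 s)%C) s
          (- (2 * ((path x y s - path x0 y0 s) * i0 s * i s)))%C) /\
       (forall s, 0 <= s <= b -> Cmod (path x y s - path x0 y0 s)%C <= eta * G)).
  { intros x y S N H0. set (w := fun s => (path x y s - path x0 y0 s)%C).
    exists (fun s => (/ rel lam x y s)%C).
    assert (I1 : forall s, 0 <= s <= b -> Cmod (/ rel lam x y s)%C <= D /\
       (/ rel lam x y s = i0 s - w s * i0 s * / rel lam x y s)%C).
    { intros s Hs. destruct (rel_inv_bound lam x y d s Hd (N s Hs)) as [A1 A2].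
      destruct (rel_inv_bound lam x0 y0 d s Hd (N0 s Hs)) as [A3 _].
      split; [exact A2|]. unfold i0.
      assert (Ew : w s = (rel lam x y s - rel lam x0 y0 s)%C).
      { unfold w, path, rel, Cminus, Cplus, Copp. cbn [fst snd]. f_equal; ring. }
      rewrite Ew. field. split; assumption. }
    assert (I2 : forall s, 0 < s < b -> cder w s (- (2 * (w s * i0 s * / rel lam x y s)))%C).
    { intros s Hs. eapply cder_eq.
      - apply cder_minus; [apply (sol_cder lam b x y s S Hs)|apply (sol_cder lam b x0 y0 s S0 Hs)].
      - destruct (I1 s ltac:(lra)) as [_ E]. fold (i0 s). rewrite E at 1. ring. }
    split; [exact I1|split; [exact I2|]].
    apply (gronwall w (fun s => (- (2 * (w s * i0 s * / rel lam x y s)))%C) b L eta); try lra; auto.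
    - intros s Hs. apply ccont_minus; eapply sol_ccont; eassumption.
    - intros s Hs. destruct (I1 s ltac:(lra)) as [A _]. specialize (Bi0 s ltac:(lra)).
      rewrite Cmod_opp, Cmod_scaled, !Cmod_mult by lra.
      pose proof (Cmod_ge_0 (w s)). pose proof (Cmod_ge_0 (i0 s)). pose proof (Cmod_ge_0 (/ rel lam x y s)%C).
      assert (Cmod (w s) * Cmod (i0 s) * Cmod (/ rel lam x y s)%C <= Cmod (w s) * D * D).
      { apply Rmult_le_compat; try assumption; [apply Rmult_le_pos; assumption|]. now apply Rmult_le_compat_l. }
      unfold L. assert (0 <= Cmod (w s) * D * D) by (apply Rmult_le_pos; [apply Rmult_le_pos|]; lra). lra. }
  assert (I0 : forall x y, (x 0 - x0 0) * (x 0 - x0 0) + (y 0 - y0 0) * (y 0 - y0 0) = eta * eta ->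
     Cmod (path x y 0 - path x0 y0 0)%C <= eta).
  { intros x y E. apply Rsqr_incr_0_var; [|lra]. unfold Rsqr. rewrite Cmod_sq.
    unfold path, Cminus, Cplus, Copp. cbn [fst snd]. unfold Rminus in E. rewrite E. lra. }
  destruct (W x1 y1 S1 N1 (I0 _ _ ltac:(rewrite X1, Y1; ring))) as [i1 [A1 [D1 B1]]].
  destruct (W x2 y2 S2 N2 (I0 _ _ ltac:(rewrite X2, Y2; ring))) as [i2 [A2 [D2 B2]]].
  destruct (W x3 y3 S3 N3 (I0 _ _ ltac:(rewrite X3, Y3; ring))) as [i3 [A3 [D3 B3]]].
  destruct (W x4 y4 S4 N4 (I0 _ _ ltac:(rewrite X4, Y4; ring))) as [i4 [A4 [D4 B4]]].
  set (w1 := fun s => (path x1 y1 s - path x0 y0 s)%C) in *.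
  set (w2 := fun s => (path x2 y2 s - path x0 y0 s)%C) in *.
  set (w3 := fun s => (path x3 y3 s - path x0 y0 s)%C) in *.
  set (w4 := fun s => (path x4 y4 s - path x0 y0 s)%C) in *.
  assert (CW : forall x y, sol lam 2 b x y -> forall s, 0 <= s <= b -> ccont (fun s => (path x y s - path x0 y0 s)%C) s).
  { intros x y S s Hs. apply ccont_minus; eapply sol_ccont; eassumption. }
  pose proof (CW x1 y1 S1) as C1. pose proof (CW x2 y2 S2) as C2.
  pose proof (CW x3 y3 S3) as C3. pose proof (CW x4 y4 S4) as C4.
  fold w1 in C1. fold w2 in C2. fold w3 in C3. fold w4 in C4. clear CW W I0.
  set (e3 := eta * (eta * eta)). assert (He3 : 0 < e3) by (unfold e3; repeat apply Rmult_lt_0_compat; lra).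
  set (cube := fun s => (w1 s * w1 s * w1 s * i1 s + w2 s * w2 s * w2 s * i2 s + w3 s * w3 s * w3 s * i3 s + w4 s * w4 s * w4 s * i4 s)%C).
  assert (Bcube : forall s, 0 <= s <= b -> Cmod (cube s) <= 4 * (G * G * G) * D * e3).
  { intros s Hs. unfold cube. eapply Rle_trans; [apply Cmod_add4|].
    assert (T : forall w i : C, Cmod w <= eta * G -> Cmod i <= D -> Cmod (w * w * w * i)%C <= (G * G * G) * D * e3).
    { intros w i Hw Hi. rewrite !Cmod_mult. pose proof (Cmod_ge_0 w). pose proof (Cmod_ge_0 i).
      replace (G * G * G * D * e3) with ((eta * G) * (eta * G) * (eta * G) * D) by (unfold e3; ring).
      apply Rmult_le_compat; try assumption; [repeat apply Rmult_le_pos; assumption|].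
      apply Rmult_le_compat; try assumption; [repeat apply Rmult_le_pos; assumption|].
      apply Rmult_le_compat; assumption. }
    pose proof (T (w1 s) (i1 s) (B1 s Hs) (proj1 (A1 s Hs))). pose proof (T (w2 s) (i2 s) (B2 s Hs) (proj1 (A2 s Hs))).
    pose proof (T (w3 s) (i3 s) (B3 s Hs) (proj1 (A3 s Hs))). pose proof (T (w4 s) (i4 s) (B4 s Hs) (proj1 (A4 s Hs))). lra. }
  set (Q := fun s => (w1 s * w1 s + w2 s * w2 s + w3 s * w3 s + w4 s * w4 s)%C).
  set (S := fun s => (w1 s + w2 s + w3 s + w4 s)%C).
  (* Iterating the resolvent identity moves the dependence on the individual u into the cubic term;
     the linear and quadratic terms have common coefficients i0^2 and i0^3 and can be summed. *)
  assert (Sq : forall w i i0 : C, i = (i0 - w * i0 * i)%C ->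
     (2 * (w * - (2 * (w * i0 * i))) = - (4 * (w * w * (i0 * i0))) + 4 * (i0 * i0 * (w * w * w * i)))%C).
  { intros w i j E. rewrite E at 1. ring. }
  assert (Sl : forall w i i0 : C, i = (i0 - w * i0 * i)%C ->
     (- (2 * (w * i0 * i)) = - (2 * (w * (i0 * i0))) + 2 * (w * w * (i0 * i0 * i0)) - 2 * (i0 * i0 * i0 * (w * w * w * i)))%C).
  { intros w i j E. rewrite E at 1. rewrite E at 1. ring. }
  (* These are eta times the fourth roots of unity, whose sum and sum of squares vanish. *)
  assert (Ini : (w1 0 = (eta, 0) /\ w2 0 = (- eta, 0) /\ w3 0 = (0, eta) /\ w4 0 = (0, - eta))).
  { unfold w1, w2, w3, w4, path, Cminus, Cplus, Copp. cbn [fst snd].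
    rewrite X1, X2, X3, X4, Y1, Y2, Y3, Y4. repeat split; f_equal; ring. }
  destruct Ini as [Z1 [Z2 [Z3 Z4]]].
  assert (BQ : forall s, 0 <= s <= b -> Cmod (Q s) <= (cQ * e3) * G).
  { apply (gronwall Q (fun s => (- (4 * (Q s * (i0 s * i0 s))) + 4 * (i0 s * i0 s * cube s))%C) b L (cQ * e3)); auto.
    - apply Rmult_le_pos; lra.
    - intros s Hs. unfold Q. apply ccont_plus; [apply ccont_plus; [apply ccont_plus|]|]; apply ccont_sq; auto.
    - intros s Hs. unfold Q. eapply cder_eq.
      + apply cder_plus; [apply cder_plus; [apply cder_plus|]|]; apply cder_sq; [apply D1|apply D2|apply D3|apply D4]; exact Hs.
      + fold (w1 s) (w2 s) (w3 s) (w4 s).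
        rewrite (Sq (w1 s) (i1 s) (i0 s) (proj2 (A1 s ltac:(lra)))), (Sq (w2 s) (i2 s) (i0 s) (proj2 (A2 s ltac:(lra)))),
          (Sq (w3 s) (i3 s) (i0 s) (proj2 (A3 s ltac:(lra)))), (Sq (w4 s) (i4 s) (i0 s) (proj2 (A4 s ltac:(lra)))).
        unfold cube. ring.
    - intros s Hs. specialize (Bi0 s ltac:(lra)). specialize (Bcube s ltac:(lra)).
      eapply Rle_trans; [apply Cmod_triangle|]. rewrite Cmod_opp, !Cmod_scaled, !Cmod_mult by lra.
      pose proof (Cmod_ge_0 (i0 s)). pose proof (Cmod_ge_0 (Q s)). pose proof (Cmod_ge_0 (cube s)).
      assert (P : Cmod (i0 s) * Cmod (i0 s) <= D * D) by (apply Rmult_le_compat; assumption).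
      assert (P0 : 0 <= Cmod (i0 s) * Cmod (i0 s)) by (apply Rmult_le_pos; assumption).
      assert (Cmod (Q s) * (Cmod (i0 s) * Cmod (i0 s)) <= Cmod (Q s) * (D * D)) by (now apply Rmult_le_compat_l).
      assert (Cmod (i0 s) * Cmod (i0 s) * Cmod (cube s) <= D * D * (4 * (G * G * G) * D * e3)) by (apply Rmult_le_compat; assumption).
      unfold L, cQ. lra.
    - unfold Q. rewrite Z1, Z2, Z3, Z4.
      replace (_ + _)%C with (Complex.RtoC 0); [rewrite Cmod_0; apply Rmult_le_pos; lra|].
      unfold Cplus, Cmult, Complex.RtoC. cbn [fst snd]. f_equal; ring. }
  assert (BS : forall s, 0 <= s <= b -> Cmod (S s) <= (cS * e3) * G).
  { apply (gronwall S (fun s => (- (2 * (S s * (i0 s * i0 s))) + 2 * (i0 s * i0 s * i0 s * Q s)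
        + - (2 * (i0 s * i0 s * i0 s * cube s)))%C) b L (cS * e3)); auto.
    - apply Rmult_le_pos; lra.
    - intros s Hs. unfold S. apply ccont_plus; [apply ccont_plus; [apply ccont_plus|]|]; auto.
    - intros s Hs. unfold S. eapply cder_eq.
      + apply cder_plus; [apply cder_plus; [apply cder_plus|]|]; [apply D1|apply D2|apply D3|apply D4]; exact Hs.
      + fold (w1 s) (w2 s) (w3 s) (w4 s).
        rewrite (Sl (w1 s) (i1 s) (i0 s) (proj2 (A1 s ltac:(lra)))), (Sl (w2 s) (i2 s) (i0 s) (proj2 (A2 s ltac:(lra)))),
          (Sl (w3 s) (i3 s) (i0 s) (proj2 (A3 s ltac:(lra)))), (Sl (w4 s) (i4 s) (i0 s) (proj2 (A4 s ltac:(lra)))).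
        unfold cube, Q. ring.
    - intros s Hs. specialize (Bi0 s ltac:(lra)). specialize (Bcube s ltac:(lra)). specialize (BQ s ltac:(lra)).
      eapply Rle_trans; [apply Cmod_triangle|].
      eapply Rle_trans; [apply Rplus_le_compat_r, Cmod_triangle|].
      rewrite !Cmod_opp, !Cmod_scaled, !Cmod_mult by lra.
      pose proof (Cmod_ge_0 (i0 s)). pose proof (Cmod_ge_0 (Q s)). pose proof (Cmod_ge_0 (cube s)).
      pose proof (Cmod_ge_0 (S s)).
      assert (P : Cmod (i0 s) * Cmod (i0 s) <= D * D) by (apply Rmult_le_compat; assumption).
      assert (P0 : 0 <= Cmod (i0 s) * Cmod (i0 s)) by (apply Rmult_le_pos; assumption).
      assert (P3 : Cmod (i0 s) * Cmod (i0 s) * Cmod (i0 s) <= D * D * D) by (apply Rmult_le_compat; assumption).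
      assert (P30 : 0 <= Cmod (i0 s) * Cmod (i0 s) * Cmod (i0 s)) by (apply Rmult_le_pos; assumption).
      assert (Cmod (S s) * (Cmod (i0 s) * Cmod (i0 s)) <= Cmod (S s) * (D * D)) by (now apply Rmult_le_compat_l).
      assert (0 <= Cmod (S s) * (D * D)) by (apply Rmult_le_pos; nra).
      assert (Cmod (i0 s) * Cmod (i0 s) * Cmod (i0 s) * Cmod (cube s) <= D * D * D * (4 * (G * G * G) * D * e3)) by (apply Rmult_le_compat; assumption).
      assert (Cmod (i0 s) * Cmod (i0 s) * Cmod (i0 s) * Cmod (Q s) <= D * D * D * (cQ * e3 * G)) by (apply Rmult_le_compat; assumption).
      unfold L, cS. lra.
    - unfold S. rewrite Z1, Z2, Z3, Z4.
      replace (_ + _)%C with (Complex.RtoC 0); [rewrite Cmod_0; apply Rmult_le_pos; lra|].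
      unfold Cplus, Complex.RtoC. cbn [fst snd]. f_equal; ring. }
  specialize (BS b ltac:(lra)).
  assert (F : Rabs (snd (S b)) <= Cmod (S b)) by (eapply Rle_trans; [apply Rmax_r|apply Rmax_Cmod]).
  replace (snd (S b)) with (y1 b + y2 b + y3 b + y4 b - 4 * y0 b) in F.
  - fold e3. lra.
  - unfold S, w1, w2, w3, w4, path, Cminus, Cplus, Copp. cbn [fst snd]. ring.
Qed.

(** The equation y' = -2y/N with N >= m > 0 keeps y exp(2s/m) from falling below y(0). *)
Lemma sol_im_pos (lam : R -> R) (b : R) (x y : R -> R) :
  (forall s, continuity_pt lam s) -> 0 <= b -> sol lam 2 b x y -> 0 < y 0 ->
  forall s, 0 <= s <= b -> 0 < y s.
Proof.
  intros Hl Hb S Hy s Hs.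
  destruct (nsq_min lam 2 b x y Hl Hb S) as [m [Hm HN]].
  set (c := 2 / m). assert (Hc : 0 < c) by (apply Rdiv_lt_0_compat; lra).
  assert (F : y 0 - y s * exp (c * s) <= 0).
  { apply (barrier (fun s => y 0 - y s * exp (c * s))
     (fun s => - ((- (2 * y s) / nsq lam x y s) * exp (c * s) + y s * (c * exp (c * s)))) 0 b c).
    - intros r Hr. destruct (sol_continuity _ _ _ _ _ r S Hr). ctn.
    - intros r Hr. destruct S as [_ S]. destruct (S r Hr) as [_ D].
      eapply is_derive_eq.
      + apply (is_derive_minus (fun _ => y 0) (fun s => y s * exp (c * s))); [apply is_derive_const|].
        apply (is_derive_mult y (fun s => exp (c * s)) r _ (c * exp (c * r)) D).
        * auto_derive; [exact I|ring].
        * intros; apply Rmult_comm.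
      + unfold minus, plus, opp, zero, mult; simpl. ring.
    - intros r Hr HF. specialize (HN r ltac:(lra)). pose proof (exp_pos (c * r)) as HE.
      set (E := exp (c * r)) in *.
      assert (Hi : 0 < / nsq lam x y r) by (apply Rinv_0_lt_compat; lra).
      assert (Hi2 : 2 * / nsq lam x y r <= c).
      { unfold c, Rdiv. apply Rmult_le_compat_l; [lra|]. now apply Rinv_le_contravar. }
      replace (- (- (2 * y r) / nsq lam x y r * E + y r * (c * E)))
        with (- (y r * E) * (c - 2 * / nsq lam x y r)) by (unfold Rdiv; ring).
      set (i := 2 * / nsq lam x y r) in *. set (v := y r * E) in *.
      assert (0 < i) by (unfold i; lra). nra.
    - simpl. rewrite Rmult_0_r, exp_0. lra.
    - exact Hs. }
  pose proof (exp_pos (c * s)). nra.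
Qed.

Lemma sol_im_decreasing (lam : R -> R) (b : R) (x y : R -> R) :
  (forall s, continuity_pt lam s) -> 0 < b -> sol lam 2 b x y -> 0 < y 0 -> y b < y 0.
Proof.
  intros Hl Hb S Hy. pose proof (sol_im_pos lam b x y Hl ltac:(lra) S Hy) as P.
  destruct (mvt_open y (fun s => - (2 * y s) / nsq lam x y s) 0 b Hb) as [c [Hc E]].
  - intros r Hr. apply (sol_continuity _ _ _ _ _ r S Hr).
  - intros r Hr. apply S, Hr.
  - specialize (P c ltac:(lra)). assert (N : 0 < nsq lam x y c) by (apply S; lra).
    assert (0 < 2 * y c * / nsq lam x y c) by (apply Rmult_lt_0_compat; [lra|now apply Rinv_0_lt_compat]).
    replace (- (2 * y c) / nsq lam x y c) with (- (2 * y c * / nsq lam x y c)) in E by (unfold Rdiv; ring). nra.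
Qed.

(* A flow line that keeps away from [lam] also solves the truncated equation, which has solutions
   depending continuously on the starting point. *)
Lemma nearby_flow (lam : R -> R) (b c : R) (x y : R -> R) :
  (forall s, continuity_pt lam s) -> 0 <= b -> 0 < c -> sol lam 2 b x y ->
  (forall s, 0 <= s <= b -> 4 * (c * c) <= nsq lam x y s) ->
  exists del, 0 < del /\ forall x0 y0, Rabs (x0 - x 0) < del -> Rabs (y0 - y 0) < del ->
    exists x' y', sol lam 2 b x' y' /\ x' 0 = x0 /\ y' 0 = y0 /\
      forall s, 0 <= s <= b -> c * c <= nsq lam x' y' s.
Proof.
  intros Hl Hb Hc S HN. assert (Hcc : 0 < c * c) by nra.
  set (L := 2 * / (c * c)). assert (HL : 0 < L) by (unfold L; pose proof (Rinv_0_lt_compat _ Hcc); lra).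
  set (E := exp ((2 * L + 1) * b)). assert (HE : 0 < E) by apply exp_pos.
  (* The initial error is at most 2 del, and [gronwall] turns it into 2 del times 2E = c. A line at
     distance 2c from [lam] thus leaves distance c to its neighbour, where truncation at c is
     inactive. *)
  set (del := c / (4 * E)). assert (Hdel : 0 < del) by (apply Rdiv_lt_0_compat; lra).
  exists del. split; [exact Hdel|]. intros x0 y0 Hx0 Hy0.
  destruct (trunc_flow lam 2 c x0 y0 Hl Hc) as [x' [y' [Ex [Ey H]]]].
  exists x', y'.
  assert (Cl : forall s, 0 <= s <= b -> dsq x' y' x y s <= c * c).
  { intros s Hs.
    assert (B : Cmod (path x' y' s - path x y s)%C <= 2 * del * (2 * E)).
    { apply (gronwall (fun s => (path x' y' s - path x y s)%C)
       (fun s => (2 * ((x' s - lam s) / cap c (x' s - lam s) (y' s) - (x s - lam s) / cap c (x s - lam s) (y s)),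
         - (2 * (y' s / cap c (x' s - lam s) (y' s) - y s / cap c (x s - lam s) (y s))))) b L); try lra; auto.
      - intros r Hr. apply ccont_minus; [|now apply (sol_ccont lam 2 b)].
        destruct (H r ltac:(lra)) as [D1 D2].
        split; [exact (is_derive_continuity_pt x' r _ D1)|exact (is_derive_continuity_pt y' r _ D2)].
      - intros r Hr. destruct (H r ltac:(lra)) as [D1 D2]. destruct S as [_ S]. destruct (S r Hr) as [D3 D4].
        assert (En : nsq lam x y r = cap c (x r - lam r) (y r)).
        { unfold cap. specialize (HN r ltac:(lra)). unfold nsq in *. rewrite Rmax_left; [reflexivity|lra]. }
        rewrite En in D3, D4. pose proof (conj D1 D2 : cder (path x' y') r (_, _)) as F1.
        pose proof (conj D3 D4 : cder (path x y) r (_, _)) as F2.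
        eapply cder_eq; [apply (cder_minus _ _ _ _ _ F1 F2)|].
        unfold Cminus, Cplus, Copp, Rdiv. cbn [fst snd]. f_equal; ring.
      - intros r Hr.
        pose proof (trunc_lipschitz_sq c (x' r - lam r) (y' r) (x r - lam r) (y r) Hc) as T. unfold Rsqr in T.
        replace (x' r - lam r - (x r - lam r)) with (x' r - x r) in T by ring.
        apply Rle_trans with (L * Cmod (path x' y' r - path x y r)%C); [|lra].
        apply Rsqr_incr_0_var; [|apply Rmult_le_pos; [lra|apply Cmod_ge_0]]. unfold Rsqr.
        replace (L * Cmod (path x' y' r - path x y r)%C * (L * Cmod (path x' y' r - path x y r)%C))
          with (L * L * (Cmod (path x' y' r - path x y r)%C * Cmod (path x' y' r - path x y r)%C)) by ring.
        rewrite !Cmod_sq. unfold path, Cminus, Cplus, Copp. cbn [fst snd].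
        apply (Rmult_le_compat_l (L * L)) in T; [|nra].
        replace (L * L) with (4 * / (c * c * (c * c))) in T at 1 by (unfold L; field; lra).
        rewrite <- Rmult_assoc, (Rmult_assoc 4), Rinv_l, Rmult_1_r in T by nra. unfold Rminus in *. lra.
      - apply Rsqr_incr_0_var; [|lra]. unfold Rsqr. rewrite Cmod_sq.
        unfold path, Cminus, Cplus, Copp. cbn [fst snd]. rewrite Ex, Ey.
        apply Rabs_def2 in Hx0. apply Rabs_def2 in Hy0. unfold Rminus in *. nra. }
    replace (2 * del * (2 * E)) with c in B by (unfold del; field; lra).
    pose proof (Cmod_ge_0 (path x' y' s - path x y s)%C).
    replace (dsq x' y' x y s) with (Cmod (path x' y' s - path x y s)%C * Cmod (path x' y' s - path x y s)%C)
      by (rewrite Cmod_sq; reflexivity). nra. }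
  assert (N' : forall s, 0 <= s <= b -> c * c <= nsq lam x' y' s).
  { intros s Hs. specialize (Cl s Hs). specialize (HN s Hs). unfold dsq in Cl. unfold nsq in *.
    set (X := x s - lam s) in *. set (X' := x' s - lam s) in *.
    replace (x' s - x s) with (X' - X) in Cl by (unfold X, X'; ring).
    pose proof (mul_self_nonneg (X' - X + X')) as Z1. pose proof (mul_self_nonneg (y' s - y s + y' s)) as Z2.
    pose proof (mul_self_nonneg (2 * X' - X)) as Z3. pose proof (mul_self_nonneg (2 * y' s - y s)) as Z4. nra. }
  split; [|auto]. apply (sol_of_trunc lam 2 c); auto.
Qed.

(* If no point of the half plane were swallowed up to time [b], then [Im z - Im g_b(z)] would be a
   positive harmonic function vanishing on the real line and at infinity, against the maximum
   principle.  The latter is run on approximate maxima of that function plus [eps x^2], using the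
   four-point estimate. *)
Lemma no_global_flow (lam : R -> R) (b : R) :
  (forall s, continuity_pt lam s) -> 0 < b ->
  (forall x0 y0, 0 < y0 -> exists x y, sol lam 2 b x y /\ x 0 = x0 /\ y 0 = y0) -> False.
Proof.
  intros Hl Hb Hall.
  destruct (Hall 0 1 Rlt_0_1) as [xa [ya [Sa [Exa Eya]]]].
  set (m := 1 - ya b).
  assert (Hm0 : 0 < m).
  { unfold m. pose proof (sol_im_decreasing lam b xa ya Hl Hb Sa ltac:(lra)). lra. }
  assert (Hm1 : m < 1).
  { unfold m. pose proof (sol_im_pos lam b xa ya Hl ltac:(lra) Sa ltac:(lra) b ltac:(lra)). lra. }
  destruct (continuity_ab_maj (fun s => Rabs (lam s)) 0 b ltac:(lra)) as [s0 [HLam _]].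
  { intros c _. apply (continuity_pt_comp lam Rabs); [apply Hl|apply Rcontinuity_abs]. }
  set (Lam := Rabs (lam s0)) in *.
  assert (HLam0 : 0 <= Lam) by apply Rabs_pos.
  (* Makes the displacement 2b/rho of distant points equal to m/4, a quarter of the drop m in height
     observed at the point i. *)
  set (rho := 8 * b / m). assert (Hrho : 0 < rho) by (apply Rdiv_lt_0_compat; lra).
  assert (Erho : 2 * / rho * b = m / 4) by (unfold rho; field; lra).
  set (Rd := Lam + rho + 1).
  assert (Hfar : forall x y, sol lam 2 b x y -> 0 < y 0 -> Rd <= Rabs (x 0) \/ Rd <= y 0 -> y 0 - y b <= m / 4).
  { intros x y S Hy Hc.
    destruct (far_flow lam Lam rho b (x 0) (y 0) Hl Hrho ltac:(lra)) as [x' [y' [S' [Ex' [Ey' Hd]]]]].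
    - intros s Hs. now apply HLam.
    - rewrite Erho. unfold Rd in Hc. destruct Hc; [left|right]; lra.
    - destruct (flow_unique lam 2 b x y x' y' Hl S S' ltac:(congruence) ltac:(congruence) b ltac:(lra)) as [_ E].
      rewrite <- E, Erho in Hd. apply Rabs_le_between in Hd. lra. }
  (* One number serves as radius of the neighbourhood and as lower bound for the distance to [lam].
     Outside the half plane the value 1 is a placeholder. *)
  assert (Hloc : forall u v, exists del : posreal, 0 < v ->
     forall x0 y0, Rabs (x0 - u) < del -> Rabs (y0 - v) < del ->
     exists x y, sol lam 2 b x y /\ x 0 = x0 /\ y 0 = y0 /\ forall s, 0 <= s <= b -> del * del <= nsq lam x y s).
  { intros u v. destruct (Rlt_dec 0 v) as [Hv|Hv].
    - destruct (Hall u v Hv) as [x [y [S [Ex Ey]]]].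
      destruct (nsq_min lam 2 b x y Hl ltac:(lra) S) as [mn [Hmn HN]].
      set (c := Rmin 1 mn / 2).
      assert (Hmm : 0 < Rmin 1 mn) by (apply Rmin_glb_lt; lra).
      pose proof (Rmin_l 1 mn). pose proof (Rmin_r 1 mn).
      assert (Hc : 0 < c) by (unfold c; lra).
      destruct (nearby_flow lam b c x y Hl ltac:(lra) Hc S) as [del [Hdel Hnear]].
      { intros s Hs. specialize (HN s Hs). unfold c. nra. }
      assert (Hd : 0 < Rmin del c) by (now apply Rmin_glb_lt).
      pose proof (Rmin_l del c). pose proof (Rmin_r del c).
      exists (mkposreal _ Hd). simpl. intros _ x0 y0 Hx Hy. rewrite <- Ex in Hx. rewrite <- Ey in Hy.
      destruct (Hnear x0 y0 ltac:(lra) ltac:(lra)) as [x' [y' [S' [Ex' [Ey' N']]]]].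
      exists x', y'. repeat (split; [assumption|]). intros s Hs. specialize (N' s Hs).
      assert (Rmin del c * Rmin del c <= c * c) by nra. lra.
    - exists (mkposreal 1 Rlt_0_1). intros; contradiction. }
  set (del := fun u v => proj1_sig (constructive_indefinite_description _ (Hloc u v))).
  assert (Hdel : forall u v, 0 < v ->
     forall x0 y0, Rabs (x0 - u) < del u v -> Rabs (y0 - v) < del u v ->
     exists x y, sol lam 2 b x y /\ x 0 = x0 /\ y 0 = y0 /\ forall s, 0 <= s <= b -> del u v * del u v <= nsq lam x y s).
  { intros u v. apply (proj2_sig (constructive_indefinite_description _ (Hloc u v))). }
  clearbody del.
  (* Gives one d for the whole rectangle, as [four_point] needs a uniform distance from [lam]. Below
     its lower edge the drop is less than m/4, and for |x| >= Rd or y >= Rd it is at most m/4. *)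
  destruct (compactness_value_2d (- (Rd + 1)) (Rd + 1) (m / 4) (Rd + 1) del) as [d Hd].
  assert (HU : forall x0 y0, - (Rd + 1) <= x0 <= Rd + 1 -> m / 4 <= y0 <= Rd + 1 ->
    exists x y, sol lam 2 b x y /\ x 0 = x0 /\ y 0 = y0 /\ forall s, 0 <= s <= b -> d * d <= nsq lam x y s).
  { intros x0 y0 Hx Hy. destruct (NNPP _ (Hd x0 y0 Hx Hy)) as [u [v [_ [Hv [H1 [H2 H3]]]]]].
    destruct (Hdel u v ltac:(lra) x0 y0 H1 H2) as [x [y [S [Ex [Ey N]]]]].
    exists x, y. repeat (split; [assumption|]). intros s Hs. specialize (N s Hs).
    pose proof (cond_pos d). assert (d * d <= del u v * del u v) by nra. lra. }
  destruct (four_point lam b d ltac:(lra) (cond_pos d)) as [K [HK H4]].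
  (* The perturbation eps x^2 is then at most m/8 on the rectangle, too small to move an approximate
     maximum to its edge. *)
  set (eps := m / (8 * ((Rd + 1) * (Rd + 1)))).
  assert (HRd : 1 <= Rd) by (unfold Rd; lra).
  assert (Heps : 0 < eps) by (unfold eps; apply Rdiv_lt_0_compat; nra).
  assert (Eeps : eps * ((Rd + 1) * (Rd + 1)) = m / 8) by (unfold eps; field; lra).
  (* Working with the supremum of these values avoids a continuity statement for the map from z to
     g_b(z). *)
  set (E := fun w => exists x y, sol lam 2 b x y /\ (forall s, 0 <= s <= b -> d * d <= nsq lam x y s) /\
     - (Rd + 1) <= x 0 <= Rd + 1 /\ m / 4 <= y 0 <= Rd + 1 /\ w = y 0 - y b + eps * (x 0 * x 0)).
  assert (HE : forall x, - (Rd + 1) <= x <= Rd + 1 -> eps * (x * x) <= m / 8).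
  { intros x Hx. rewrite <- Eeps. apply Rmult_le_compat_l; [lra|]. nra. }
  destruct (completeness E) as [Sup [Hub Hleast]].
  { exists (Rd + 1 + m / 8). intros w [x [y [S [_ [Hx [Hy ->]]]]]]. specialize (HE _ Hx).
    pose proof (sol_im_pos lam b x y Hl ltac:(lra) S ltac:(lra) b ltac:(lra)). lra. }
  { destruct (HU 0 1 ltac:(lra) ltac:(lra)) as [x [y [S [Ex [Ey N]]]]].
    exists (y 0 - y b + eps * (x 0 * x 0)), x, y. repeat (split; [first [assumption|lra]|]). reflexivity. }
  assert (HSup : m <= Sup).
  { destruct (HU 0 1 ltac:(lra) ltac:(lra)) as [x [y [S [Ex [Ey N]]]]].
    destruct (flow_unique lam 2 b x y xa ya Hl S Sa ltac:(congruence) ltac:(congruence) b ltac:(lra)) as [_ Eb].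
    assert (Hin : E (y 0 - y b + eps * (x 0 * x 0))).
    { exists x, y. repeat (split; [first [assumption|lra]|]). reflexivity. }
    specialize (Hub _ Hin). rewrite Ex, Ey, Eb in Hub. unfold m. lra. }
  (* A near-maximum has drop at least 3m/4, hence height above 3m/4, so the step m/4 keeps its four
     neighbours in the rectangle. The other bound gives K eta^3 <= eps eta^2, half of the gain 2 eps
     eta^2 from the quadratic term. *)
  set (eta := Rmin (m / 4) (eps / (K + 1))).
  assert (Heta : 0 < eta) by (apply Rmin_glb_lt; [lra|apply Rdiv_lt_0_compat; lra]).
  assert (Heta1 : eta <= m / 4) by apply Rmin_l.
  assert (Heta2 : K * eta <= eps).
  { assert (eta <= eps / (K + 1)) by apply Rmin_r.
    assert ((K + 1) * eta <= eps) by (apply (Rmult_le_compat_l (K + 1)) in H; [|lra];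
      replace ((K + 1) * (eps / (K + 1))) with eps in H by (field; lra); exact H). lra. }
  assert (Heta3 : 0 < eps * (eta * eta)) by (apply Rmult_lt_0_compat; nra).
  assert (Hnear : exists w, E w /\ Sup - Rmin (eps * (eta * eta) / 8) (m / 8) < w).
  { apply NNPP; intro Hno.
    assert (Hm8 : 0 < Rmin (eps * (eta * eta) / 8) (m / 8)) by (apply Rmin_glb_lt; lra).
    assert (Sup <= Sup - Rmin (eps * (eta * eta) / 8) (m / 8)); [|lra].
    apply Hleast. intros w Hw. apply Rnot_lt_le; intro. apply Hno. now exists w. }
  destruct Hnear as [w0 [[x [y [S0 [N0 [Hx [Hy Ew]]]]]] Hw0]].
  pose proof (Rmin_l (eps * (eta * eta) / 8) (m / 8)). pose proof (Rmin_r (eps * (eta * eta) / 8) (m / 8)).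
  assert (Hv : 3 / 4 * m <= y 0 - y b) by (specialize (HE _ Hx); lra).
  pose proof (sol_im_pos lam b x y Hl ltac:(lra) S0 ltac:(lra) b ltac:(lra)) as Hyb.
  assert (Hx1 : Rabs (x 0) < Rd).
  { apply Rnot_le_lt; intro Hc. pose proof (Hfar x y S0 ltac:(lra) (or_introl Hc)). lra. }
  assert (Hy1 : y 0 < Rd).
  { apply Rnot_le_lt; intro Hc. pose proof (Hfar x y S0 ltac:(lra) (or_intror Hc)). lra. }
  apply Rabs_def2 in Hx1.
  destruct (HU (x 0 + eta) (y 0) ltac:(lra) ltac:(lra)) as [x1 [y1 [S1 [Ex1 [Ey1 N1]]]]].
  destruct (HU (x 0 - eta) (y 0) ltac:(lra) ltac:(lra)) as [x2 [y2 [S2 [Ex2 [Ey2 N2]]]]].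
  destruct (HU (x 0) (y 0 + eta) ltac:(lra) ltac:(lra)) as [x3 [y3 [S3 [Ex3 [Ey3 N3]]]]].
  destruct (HU (x 0) (y 0 - eta) ltac:(lra) ltac:(lra)) as [x4 [y4 [S4 [Ex4 [Ey4 N4]]]]].
  pose proof (H4 eta ltac:(lra) x y x1 y1 x2 y2 x3 y3 x4 y4 S0 S1 S2 S3 S4 N0 N1 N2 N3 N4
    Ex1 Ey1 Ex2 Ey2 Ex3 Ey3 Ex4 Ey4) as F.
  assert (Hin : forall x' y', sol lam 2 b x' y' -> (forall s, 0 <= s <= b -> d * d <= nsq lam x' y' s) ->
    - (Rd + 1) <= x' 0 <= Rd + 1 -> m / 4 <= y' 0 <= Rd + 1 -> y' 0 - y' b + eps * (x' 0 * x' 0) <= Sup).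
  { intros x' y' S' N' Hx' Hy'. apply Hub. exists x', y'. repeat (split; [assumption|]). reflexivity. }
  pose proof (Hin x1 y1 S1 N1 ltac:(lra) ltac:(lra)) as G1. pose proof (Hin x2 y2 S2 N2 ltac:(lra) ltac:(lra)) as G2.
  pose proof (Hin x3 y3 S3 N3 ltac:(lra) ltac:(lra)) as G3. pose proof (Hin x4 y4 S4 N4 ltac:(lra) ltac:(lra)) as G4.
  rewrite Ex1, Ey1 in G1. rewrite Ex2, Ey2 in G2. rewrite Ex3, Ey3 in G3. rewrite Ex4, Ey4 in G4.
  apply Rabs_le_between in F.
  assert (K * (eta * (eta * eta)) <= eps * (eta * eta)).
  { replace (K * (eta * (eta * eta))) with (K * eta * (eta * eta)) by ring. apply Rmult_le_compat_r; [nra|exact Heta2]. }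
  (* The four neighbours sum to at least four times the centre value plus eps eta^2. They are all at
     most [Sup], and the centre is within eps eta^2 / 8 of it: a contradiction. *)
  assert (eps * ((x 0 + eta) * (x 0 + eta)) + eps * ((x 0 - eta) * (x 0 - eta)) = 2 * (eps * (x 0 * x 0)) + 2 * (eps * (eta * eta))) by ring.
  lra.
Qed.

(** The backward flow shows that g_a maps onto the half plane. If every point surviving up to a also
    survived up to b, restarting at time a would give a flow on [0, b - a] that swallows nothing. *)
Lemma hull_grows (lam : R -> R) (a b : R) :
  (forall s, continuity_pt lam s) -> 0 <= a < b ->
  exists x0 y0, 0 < y0 /\ (exists x y, sol lam 2 a x y /\ x 0 = x0 /\ y 0 = y0) /\
    ~ (exists x y, sol lam 2 b x y /\ x 0 = x0 /\ y 0 = y0).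
Proof.
  intros Hl Hab. apply NNPP; intro Hno.
  apply (no_global_flow (fun s => lam (a + 1 * s)) (b - a)).
  - intros s. now apply continuity_pt_affine.
  - lra.
  - intros x0 y0 Hy0.
    destruct (backward_flow (fun s => lam (a + -1 * s)) a x0 y0 (fun s => continuity_pt_affine lam a (-1) s (Hl _)) Hy0)
      as [x [y [S [Ex [Ey M]]]]].
    pose proof (sol_reverse (fun s => lam (a + -1 * s)) lam (-2) 2 a x y S ltac:(lra) ltac:(intros s Hs; cbv beta; f_equal; ring)) as Sf.
    assert (Hex : exists X Y, sol lam 2 b X Y /\ X 0 = x (a + -1 * 0) /\ Y 0 = y (a + -1 * 0)).
    { apply NNPP; intro Hn. apply Hno. exists (x (a + -1 * 0)), (y (a + -1 * 0)).
      split; [specialize (M (a + -1 * 0) ltac:(lra)); lra|]. split; [|exact Hn].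
      exists (fun s => x (a + -1 * s)), (fun s => y (a + -1 * s)). auto. }
    destruct Hex as [X [Y [SX [EX EY]]]].
    destruct (flow_unique lam 2 a X Y (fun s => x (a + -1 * s)) (fun s => y (a + -1 * s)) Hl
      (sol_restrict lam 2 b a X Y SX ltac:(lra)) Sf EX EY a ltac:(lra)) as [Ux Uy].
    exists (fun s => X (a + 1 * s)), (fun s => Y (a + 1 * s)). split; [|split].
    + apply (sol_shift lam (fun s => lam (a + 1 * s)) 2 b (b - a) a X Y SX); try lra. intros s Hs. f_equal; ring.
    + replace (a + 1 * 0) with a by ring. rewrite Ux, <- Ex. f_equal; ring.
    + replace (a + 1 * 0) with a by ring. rewrite Uy, <- Ey. f_equal; ring.
Qed.

(** In the half plane gamma(t) is swallowed by time t, so [far_flow] fails there. With radius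
    t^alpha, M + 3 adds M for the driving function, 1 for the radius and 2 for the drift 2t/t^alpha,
    which is at most 2 t^alpha because alpha <= 1/2 and t < 1. *)
Lemma rough_curve_bound (alpha T : R) (lam : R -> R) (gam : R -> Cplx) :
  0 < alpha <= 1 / 2 -> 0 < T -> lam 0 = 0 -> Holder_class T 0 alpha lam -> generates T lam gam ->
  exists K, forall t, 0 < t -> t < 1 -> t <= T ->
    Rabs (Re (gam t)) <= K * Rpower t alpha /\ Rabs (Im (gam t)) <= K * Rpower t alpha.
Proof.
  intros Ha HT Hl0 [D [[HD0 _] [HC [_ [M HH]]]]] Hg.
  assert (HM : 0 <= M).
  { specialize (HH T 0 ltac:(lra) ltac:(lra)). pose proof (Rabs_pos (D O T - D O 0)).
    assert (0 < Rpower (Rabs (T - 0)) alpha) by apply exp_pos. nra. }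
  set (el := extend T lam).
  assert (Hel : forall s, 0 <= s <= T -> el s = lam s) by (intros s Hs; unfold el, extend; now rewrite clamp_id).
  assert (Hcl : forall s, continuity_pt el s).
  { intros s. apply (clamp_continuous lam 0 T); [lra|]. intros r Hr eps He.
    destruct (HC O ltac:(lia) r Hr eps He) as [dd [Hdd Hdd']]. exists dd; split; [exact Hdd|].
    intros u Hu Hc. rewrite <- !HD0 by assumption. auto. }
  assert (Hpow : forall s t, 0 < s <= t -> Rpower s alpha <= Rpower t alpha) by (intros; apply Rle_Rpower_l; lra).
  assert (HU : forall t, 0 < t -> t < 1 -> t <= T -> 0 < Im (gam t) ->
     Rabs (Re (gam t)) <= (M + 3) * Rpower t alpha /\ Rabs (Im (gam t)) <= (M + 3) * Rpower t alpha).
  { intros t Ht Ht1 HtT Him.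
    set (R0 := Rpower t alpha). assert (HR0 : 0 < R0) by apply exp_pos.
    assert (HtR : t <= R0 * R0).
    { unfold R0. rewrite <- Rpower_plus. rewrite <- (Rpower_1 t) at 1 by lra.
      apply Rpower_decreasing; lra. }
    assert (HtR2 : 2 * / R0 * t <= 2 * R0).
    { apply Rmult_le_reg_r with R0; [lra|]. replace (2 * / R0 * t * R0) with (2 * t) by (field; lra). lra. }
    assert (Hns : ~ (exists x y, sol el 2 t x y /\ x 0 = Re (gam t) /\ y 0 = Im (gam t))).
    { intros Hs. apply (survives_iff T lam Hcl) in Hs; [|lra].
      apply (component_iff T lam gam Hg) in Hs; [|lra|exact Him].
      destruct Hs as [[_ Hs] _]. apply (Hs t); [lra|reflexivity]. }
    assert (Hlam : forall s, 0 <= s <= t -> Rabs (el s) <= M * R0).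
    { intros s Hs. rewrite Hel by lra. destruct (Req_dec s 0) as [->|Hs0].
      - rewrite Hl0, Rabs_R0. apply Rmult_le_pos; lra.
      - specialize (HH s 0 ltac:(lra) ltac:(lra)). rewrite !HD0, Hl0, !Rminus_0_r, (Rabs_pos_eq s) in HH by lra.
        eapply Rle_trans; [exact HH|]. apply Rmult_le_compat_l; [exact HM|]. apply Hpow; lra. }
    assert (Hf : ~ (M * R0 + R0 + 2 * / R0 * t <= Rabs (Re (gam t)) \/ R0 + 2 * / R0 * t <= Im (gam t))).
    { intros Hf. apply Hns.
      destruct (far_flow el (M * R0) R0 t _ _ Hcl HR0 ltac:(lra) Hlam Hf) as [x [y [S [Ex [Ey _]]]]]. now exists x, y. }
    assert (0 <= M * R0) by (apply Rmult_le_pos; lra).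
    rewrite (Rabs_pos_eq (Im (gam t))) by lra.
    split; apply Rnot_lt_le; intro Hlt; apply Hf; [left|right]; lra. }
  exists (M + 3). intros t Ht Ht1 HtT.
  destruct (Rlt_dec 0 (Im (gam t))) as [Him|Him]; [now apply HU|].
  assert (Hdense : forall e, 0 < e -> exists s, 0 < s <= t /\ t - e < s /\ 0 < Im (gam s)).
  { intros e He. apply NNPP; intro Hno.
    (* Half of e makes all times in (a, t] strictly later than t - e; the maximum keeps a in the
       domain. If the curve is real on (a, t], the slit domains at a and t coincide. *)
    set (a := Rmax 0 (t - e / 2)).
    assert (Ha0 : 0 <= a) by apply Rmax_l.
    assert (Hae : t - e / 2 <= a) by apply Rmax_r.
    assert (Hat : a < t) by (unfold a; apply Rmax_lub_lt; lra).
    destruct (hull_grows el a t Hcl ltac:(lra)) as [x0 [y0 [Hy0 [Hs Hn]]]]. apply Hn.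
    apply (survives_iff T lam Hcl a (x0, y0)) in Hs; [|lra].
    apply (component_iff T lam gam Hg) in Hs; [|lra|exact Hy0].
    apply (survives_iff T lam Hcl t (x0, y0)); [lra|].
    apply (component_iff T lam gam Hg); [lra|exact Hy0|].
    assert (Hsl : forall w, slit_domain gam a w -> slit_domain gam t w).
    { intros w [Hw1 Hw2]. split; [exact Hw1|]. intros s Hs1 Heq.
      destruct (Rle_dec s a) as [Hsa|Hsa]; [apply (Hw2 s); [lra|exact Heq]|].
      apply Hno. exists s. rewrite <- Heq. repeat split; lra. }
    destruct Hs as [Hs1 Hs2]. split; [now apply Hsl|].
    intros M0. destruct (Hs2 M0) as [p [P1 [P2 [P3 P4]]]]. exists p.
    repeat (split; [assumption|]). intros u Hu. apply Hsl, P4, Hu. }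
  destruct Hg as [Hgc _].
  assert (Hlim : forall eps, 0 < eps ->
    Rabs (Re (gam t)) <= (M + 3) * Rpower t alpha + eps /\ Rabs (Im (gam t)) <= (M + 3) * Rpower t alpha + eps).
  { intros eps He. destruct (Hgc t ltac:(lra) eps He) as [del [Hdel Hd]].
    destruct (Hdense del Hdel) as [s [Hs1 [Hs2 Hs3]]].
    specialize (Hd s ltac:(lra)). rewrite Rabs_left1 in Hd by lra. specialize (Hd ltac:(lra)).
    destruct (HU s ltac:(lra) ltac:(lra) ltac:(lra) Hs3) as [U1 U2].
    assert ((M + 3) * Rpower s alpha <= (M + 3) * Rpower t alpha) by (apply Rmult_le_compat_l; [lra|apply Hpow; lra]).
    pose proof (Re_le_Cnorm (Csub (gam s) (gam t))) as A1. pose proof (Im_le_Cnorm (Csub (gam s) (gam t))) as A2.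
    cbn [Csub Re Im fst snd] in A1, A2. fold (Re (gam s)) (Re (gam t)) (Im (gam s)) (Im (gam t)) in A1, A2.
    split.
    - replace (Re (gam t)) with (Re (gam s) + - (Re (gam s) - Re (gam t))) by ring.
      eapply Rle_trans; [apply Rabs_triang|]. rewrite Rabs_Ropp. lra.
    - replace (Im (gam t)) with (Im (gam s) + - (Im (gam s) - Im (gam t))) by ring.
      eapply Rle_trans; [apply Rabs_triang|]. rewrite Rabs_Ropp. lra. }
  split; apply le_epsilon; intros eps He; apply Hlim, He.
Qed.

Theorem theorem1p3 :
  exists F : nat -> (nat -> R) -> R,
    (forall (m : nat) (d1 d2 : nat -> R),
        (forall k, (1 <= k)%nat -> (k <= Nat.div m 2)%nat -> d1 k = d2 k) ->
        F m d1 = F m d2) /\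
    forall (n : nat) (alpha T : R) (lam : R -> R) (gam : R -> Cplx),
      0 < alpha <= 1 -> 0 < T ->
      lam 0 = 0 ->
      Holder_class T n alpha lam ->
      generates T lam gam ->
      forall D : nat -> R -> R, is_deriv_family T n lam D ->
      let a : nat -> R :=
        fun m => if Nat.eqb m 1 then 2 else F m (fun k => D k 0) in
      let N : nat := if Rle_dec alpha (1/2) then (2 * n)%nat else (2 * n + 1)%nat in
      exists K delta, 0 < delta /\
        forall t, 0 < t -> t < delta -> t <= T ->
          Cnorm (Csub (gam t) (expansion a N t)) <= K * Rpower t (INR n + alpha).
Proof.
  exists (fun m d => curve_coeff d m). split.
  { intros m d1 d2 H. unfold curve_coeff. now rewrite (coeff_ext d1 d2). }
  intros n alpha T lam gam Ha HT Hl0 HH Hg D HD a N.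
  set (d := fun k => D k 0) in *.
  (* The prescribed value 2 at m = 1 agrees with q_1(1), as q_1 = 2x. *)
  assert (Ea : forall m, a m = curve_coeff d m).
  { intros m. unfold a. destruct (Nat.eqb_spec m 1) as [->|]; [|reflexivity].
    unfold curve_coeff. simpl. ring. }
  destruct (Nat.eq_dec n 0) as [Hn|Hn]; [destruct (Rle_dec alpha (1 / 2)) as [Hal|Hal]|].
  - subst n. unfold N. destruct (rough_curve_bound alpha T lam gam ltac:(lra) HT Hl0 HH Hg) as [K HK].
    exists (2 * K), 1. split; [lra|]. intros t Ht Ht1 HtT.
    destruct (HK t Ht Ht1 HtT) as [H1 H2].
    eapply Rle_trans; [apply Cnorm_le_add|]. simpl. rewrite !Rminus_0_r, Rplus_0_l.
    unfold Re, Im in *. lra.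
  - destruct (simple_curve_expansion n alpha T lam gam D Ha HT Hl0 ltac:(right; lra) HH Hg HD) as [K [del [Hdel HK]]].
    exists (2 * K), del. split; [lra|]. intros t Ht Htd HtT.
    destruct (HK t Ht Htd HtT) as [H1 H2]. fold d in H1, H2.
    unfold N. rewrite (expansion_eq_cser d a) by auto.
    eapply Rle_trans; [apply Cnorm_le_add|]. cbn [Csub Re Im fst snd].
    unfold Re, Im in *. lra.
  - destruct (simple_curve_expansion n alpha T lam gam D Ha HT Hl0 ltac:(left; lia) HH Hg HD) as [K [del [Hdel HK]]].
    (* The factor 2 adds the real and imaginary errors. The extra summand absorbs the term of order
       t^(n+1/2) when alpha <= 1/2 and the expansion stops at 2n. *)
    exists (2 * K + Rabs (a (2 * n + 1)%nat)), del. split; [lra|]. intros t Ht Htd HtT.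
    destruct (HK t Ht Htd HtT) as [H1 H2]. fold d in H1, H2.
    assert (Hp : 0 < Rpower t (INR n + alpha)) by apply exp_pos.
    pose proof (Rabs_pos (a (2 * n + 1)%nat)) as Ha0.
    eapply Rle_trans; [apply Cnorm_le_add|].
    rewrite <- (expansion_eq_cser d a) in H1, H2 by auto.
    unfold N. destruct (Rle_dec alpha (1 / 2)) as [Hal|Hal].
    + assert (Hlast : Rabs (a (2 * n + 1)%nat * Rpower t (INR (2 * n + 1) / 2))
         <= Rabs (a (2 * n + 1)%nat) * Rpower t (INR n + alpha)).
      { rewrite Rabs_mult, (Rabs_pos_eq (Rpower _ _)) by (left; apply exp_pos).
        apply Rmult_le_compat_l; [exact Ha0|]. apply Rpower_decreasing; [lra|].
        rewrite plus_INR, mult_INR. simpl. lra. }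
      assert (E : expansion a (2 * n + 1) t =
        Cadd (expansion a (2 * n) t) (0, a (2 * n + 1)%nat * Rpower t (INR (2 * n + 1) / 2))).
      { rewrite Nat.add_1_r. cbn [expansion]. f_equal. unfold exp_term.
        replace (Nat.even (S (2 * n))) with false; [reflexivity|].
        rewrite Nat.even_succ, Nat.odd_mul. reflexivity. }
      rewrite E in H1, H2. set (w := a (2 * n + 1)%nat * _) in *.
      cbn [Csub Cadd Re Im fst snd] in *. unfold Re, Im in *.
      set (z := gam t) in *. set (e := expansion a (2 * n) t) in *.
      replace (snd z - snd e) with ((snd z - (snd e + w)) + w) by ring.
      replace (fst z - fst e) with (fst z - (fst e + 0)) by ring.
      pose proof (Rabs_triang (snd z - (snd e + w)) w). lra.
    + cbn [Csub Re Im fst snd] in *. unfold Re, Im in *.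
      assert (0 <= Rabs (a (2 * n + 1)%nat) * Rpower t (INR n + alpha)) by (apply Rmult_le_pos; lra).
      lra.
Qed.
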